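(* For every $\gamma>0$ there is a randomized algorithm running in time $n^{O(\log n/\gamma^2)}$ that, given an instance $(V,I,w,k,h)$ of Submodular Densest $k$-Subgraph with $|V|=n$, outputs a set $T$ with $|T|=k$ and $I\subseteq T\subseteq V$ such that for every set $T^{\mathrm{OPT}}$ with $|T^{\mathrm{OPT}}|=k$ and $I\subseteq T^{\mathrm{OPT}}\subseteq V$, $$\mathbb{E}[h(T)+\mathrm{den}(T)]\ge (1-1/e-\gamma)\,h(T^{\mathrm{OPT}})+\mathrm{den}(T^{\mathrm{OPT}})-\gamma.$$
   Context: Submodular Densest $k$-Subgraph: the input is a finite set $V$ of $n$ vertices, a set $I\subseteq V$ of vertices that must be chosen, weights $w:\binom{V}{2}\to[0,1]$, an integer $k$ with $|I|\le k\le n$, and a monotone submodular set function $h:2^V\to\mathbb{R}_{\ge0}$ accessible via a value oracle. For $T\subseteq V$ with $|T|\ge2$, $\mathrm{den}(T):=\frac{1}{|T|(|T|-1)/2}\sum_{\{u,v\}\subseteq T}w(\{u,v\})$. The goal is to find $T$ of size $k$ with $I\subseteq T\subseteq V$ maximizing $h(T)+\mathrm{den}(T)$. *)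

(* Defs.v *)
From mathcomp Require Import all_boot all_order all_algebra.
From mathcomp Require Import reals.

Set Implicit Arguments.
Unset Strict Implicit.
Unset Printing Implicit Defensive.

Import Order.TTheory GRing.Theory Num.Theory.
Local Open Scope ring_scope.

Section SetFunctions.
Variables (R : realType) (V : finType).
Implicit Types (h w : {set V} -> R).

Definition monotone_setfun h : Prop :=
  forall A B : {set V}, A \subset B -> h A <= h B.

Definition submodular h : Prop :=
  forall A B : {set V}, h (A :|: B) + h (A :&: B) <= h A + h B.

(* [w] is only ever read on two-element sets.  When #|T| <= 1 the sum is
   empty, so that den w T = 0. *)
Definition den w (T : {set V}) : R :=
  (#|T|%:R * (#|T|%:R - 1) / 2)^-1 *
  \sum_(e : {set V} | (e \subset T) && (#|e| == 2)%N) w e.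

End SetFunctions.

(* The vertices are numbered 0, ..., n-1, as they are presented to the
   machine below. *)
Record instance (R : realType) := Instance {
  nvert : nat;
  forced : {set 'I_nvert};
  weight : {set 'I_nvert} -> R;
  target : nat;
  reward : {set 'I_nvert} -> R;
  weight_itv : forall e : {set 'I_nvert}, (#|e| == 2)%N -> 0 <= weight e <= 1;
  target_range : (#|forced| <= target <= nvert)%N;
  reward_ge0 : forall T, 0 <= reward T;
  reward_monotone : monotone_setfun reward;
  reward_submodular : submodular reward }.

Arguments weight {R} i _.
Arguments reward {R} i _.

Definition feasible (R : realType) (J : instance R) (T : {set 'I_(nvert J)}) :
  bool := (#|T| == target J) && (forced J \subset T).

Arguments feasible {R} J T.

(* A randomized real RAM with a value oracle.  A program is a finite piece of
   syntax that mentions neither the instance nor any real constant; it works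
   on finitely many unbounded arrays, each named by a number, holding natural
   numbers or real numbers.  Natural numbers can only be added, subtracted
   (truncated at 0) and compared: unit-cost multiplication or division of
   unbounded integers is not available.  Real numbers support the field
   operations and comparison, but not rounding to an integer. *)

Inductive nexp : Type :=
| NLit of nat
| NVert
| NTarget
| NForced of nexp
| NGet of nat & nexp
| NAdd of nexp & nexp
| NSub of nexp & nexp.

Inductive rexp : Type :=
| RNat of nexp
| RWeight of nexp & nexp
| RGet of nat & nexp
| RAdd of rexp & rexp
| RSub of rexp & rexp
| RMul of rexp & rexp
| RDiv of rexp & rexp.

Inductive bexp : Type :=
| BNatLe of nexp & nexp
| BRealLe of rexp & rexp
| BNot of bexp
| BAnd of bexp & bexp.

(* SetNat a i e    : a[i] := e, in an array of natural numbers
   SetReal a i e   : a[i] := e, in an array of real numbers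
   Draw a i e      : a[i] := a uniformly random element of {0, ..., e}
   Query a i b     : a[i] := value of the oracle on the set of the vertices v
                     such that b[v] is nonzero *)
Inductive cmd : Type :=
| Skip
| Seq of cmd & cmd
| SetNat of nat & nexp & nexp
| SetReal of nat & nexp & rexp
| If of bexp & cmd & cmd
| While of bexp & cmd
| Draw of nat & nexp & nexp
| Query of nat & nexp & nat.

Fixpoint ncost (e : nexp) : nat :=
  match e with
  | NLit _ | NVert | NTarget => 1
  | NForced e1 | NGet _ e1 => (ncost e1).+1
  | NAdd e1 e2 | NSub e1 e2 => (ncost e1 + ncost e2).+1
  end.

Fixpoint rcost (e : rexp) : nat :=
  match e with
  | RNat e1 | RGet _ e1 => (ncost e1).+1
  | RWeight e1 e2 => (ncost e1 + ncost e2).+1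
  | RAdd e1 e2 | RSub e1 e2 | RMul e1 e2 | RDiv e1 e2 =>
      (rcost e1 + rcost e2).+1
  end.

Fixpoint bcost (b : bexp) : nat :=
  match b with
  | BNatLe e1 e2 => (ncost e1 + ncost e2).+1
  | BRealLe e1 e2 => (rcost e1 + rcost e2).+1
  | BNot b1 => (bcost b1).+1
  | BAnd b1 b2 => (bcost b1 + bcost b2).+1
  end.

Section Machine.
Variables (R : realType) (J : instance R).

Record memory := Memory {
  nmem : nat -> nat -> nat;
  rmem : nat -> nat -> R }.

Definition memory0 : memory := Memory (fun _ _ => 0%N) (fun _ _ => 0).

Definition update (X : Type) (m : nat -> nat -> X) (a i : nat) (x : X) :
    nat -> nat -> X :=
  fun b j => if (b == a) && (j == i) then x else m b j.

Definition set_nat (s : memory) (a i x : nat) : memory :=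
  Memory (update (nmem s) a i x) (rmem s).

Definition set_real (s : memory) (a i : nat) (x : R) : memory :=
  Memory (nmem s) (update (rmem s) a i x).

Definition vertex_set (s : memory) (a : nat) : {set 'I_(nvert J)} :=
  [set v : 'I_(nvert J) | nmem s a v != 0%N].

Fixpoint neval (s : memory) (e : nexp) : nat :=
  match e with
  | NLit c => c
  | NVert => nvert J
  | NTarget => target J
  | NForced e1 =>
      if insub (neval s e1) is Some v then (v \in forced J : nat) else 0%N
  | NGet a e1 => nmem s a (neval s e1)
  | NAdd e1 e2 => (neval s e1 + neval s e2)%N
  | NSub e1 e2 => (neval s e1 - neval s e2)%N
  end.

Definition read_weight (i j : nat) : R :=
  match insub i, insub j with
  | Some u, Some v => if u != v then weight J [set u; v] else 0
  | _, _ => 0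
  end.

Fixpoint reval (s : memory) (e : rexp) : R :=
  match e with
  | RNat e1 => (neval s e1)%:R
  | RWeight e1 e2 => read_weight (neval s e1) (neval s e2)
  | RGet a e1 => rmem s a (neval s e1)
  | RAdd e1 e2 => reval s e1 + reval s e2
  | RSub e1 e2 => reval s e1 - reval s e2
  | RMul e1 e2 => reval s e1 * reval s e2
  | RDiv e1 e2 => reval s e1 / reval s e2
  end.

Fixpoint beval (s : memory) (b : bexp) : bool :=
  match b with
  | BNatLe e1 e2 => (neval s e1 <= neval s e2)%N
  | BRealLe e1 e2 => reval s e1 <= reval s e2
  | BNot b1 => ~~ beval s b1
  | BAnd b1 b2 => beval s b1 && beval s b2
  end.

(* [todo] is the stack of the commands still to be executed. *)
Record config := Config {
  clock : nat;
  todo : seq cmd;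
  mem : memory }.

(* [Branch m next] moves to [next i] for a uniformly random i in 'I_m.+1. *)
Inductive transition : Type :=
| Stop
| Branch (m : nat) of 'I_m.+1 -> config.

Definition det (x : config) : transition := @Branch 0 (fun=> x).

Definition step (x : config) : transition :=
  let s := mem x in
  match todo x with
  | [::] => Stop
  | c :: K =>
    let go cost K' s' := Config (clock x + cost.+1) K' s' in
    match c with
    | Skip => det (go 0%N K s)
    | Seq c1 c2 => det (go 0%N (c1 :: c2 :: K) s)
    | SetNat a i e =>
        det (go (ncost i + ncost e)%N K
               (set_nat s a (neval s i) (neval s e)))
    | SetReal a i e =>
        det (go (ncost i + rcost e)%N K
               (set_real s a (neval s i) (reval s e)))
    | If b c1 c2 =>
        det (go (bcost b) ((if beval s b then c1 else c2) :: K) s)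
    | While b c1 =>
        det (go (bcost b)
               (if beval s b then c1 :: While b c1 :: K else K) s)
    | Draw a i e =>
        @Branch (neval s e) (fun r =>
          go (ncost i + ncost e)%N K (set_nat s a (neval s i) r))
    | Query a i b =>
        det (go (ncost i) K
               (set_real s a (neval s i) (reward J (vertex_set s b))))
    end
  end.

(* [Q] holds of every configuration that the machine, started in [x], can be
   in after [t] steps (or when it stops, if it stops earlier). *)
Fixpoint always (t : nat) (x : config) (Q : config -> Prop) : Prop :=
  if t is t'.+1 then
    match step x with
    | Stop => Q x
    | Branch m next => forall i : 'I_m.+1, always t' (next i) Q
    end
  else Q x.

(* The expected value of [f] on that configuration. *)
Fixpoint expect (t : nat) (x : config) (f : config -> R) : R :=
  if t is t'.+1 then
    match step x with
    | Stop => f x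
    | Branch m next => m.+1%:R^-1 * \sum_(i < m.+1) expect t' (next i) f
    end
  else f x.

Definition start (p : cmd) : config := Config 0 [:: p] memory0.

Definition halted (x : config) : bool := nilp (todo x).

Definition output (x : config) : {set 'I_(nvert J)} := vertex_set (mem x) 0.

(* Every step advances the clock by at least one, so a run of total cost at
   most [t] has stopped after at most [t] steps. *)
Definition halts_within (p : cmd) (t : nat) : Prop :=
  always t (start p) (fun x => halted x /\ (clock x <= t)%N).

Definition output_always (p : cmd) (t : nat) (Q : {set 'I_(nvert J)} -> Prop) :
  Prop := always t (start p) (fun x => Q (output x)).

Definition output_expect (p : cmd) (t : nat) (f : {set 'I_(nvert J)} -> R) :
  R := expect t (start p) (fun x => f (output x)).

End Machine.

Arguments output_always {R} J p t Q.
Arguments output_expect {R} J p t f.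

(* Main.v *)
(* Write A for the weight matrix, O for the optimum, and normalise fractional
   solutions x to total mass k.  A random multiset S of O(log n / gamma^2)
   vertices of O satisfies y := k A 1_S / |S| = A 1_O up to gamma k in every
   coordinate, and there are only n^O(log n / gamma^2) candidates for S, so that
   all of them can be tried.

   Given S, a discretised continuous greedy algorithm averages N sets Z_i of
   size k: Z_i maximises the linear score
     (weighted gradient of the multilinear extension of h at x)
       + c_i A + (N - i) y,     c_i := 1_{Z_1} + ... + 1_{Z_{i-1}}.
   Comparing Z_i with O, the term O A c_i is the sum over j < i of Z_j y; summed
   over i this is exactly what the weights N - i of y contribute on the other
   side, so that the quadratic form of the average is at least that of O, while
   h is approximated within 1 - 1/e as usual.  The gradient is estimated by
   sampling.

   Independent rounding keeps the expectations of h and of the quadratic form;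
   the size of the rounded set deviates from k by about sqrt (k - |I|), which is
   repaired greedily at a small relative cost.  When k - |I| is too small for
   this, O is contained in I and S for some S, and is found directly. *)

Require Import Defs.
From mathcomp Require Import all_boot all_order all_algebra.
From mathcomp Require Import boolp reals sequences exp.
From mathcomp Require Import zify ring lra.
Import Order.TTheory GRing.Theory Num.Theory.
Set Implicit Arguments.
Unset Strict Implicit.
Unset Printing Implicit Defensive.
Local Open Scope ring_scope.

(** * A Hoare logic for expected values *)

(** The program keeps the best set recorded so far, so its expected value is at least that of any
    single round. Only the round with the right guess is analysed; the others merely must not lower
    [rbest]. All randomness of the program is handled through first and second moments. The logic
    proves lower bounds on expected values, and a loop is analysed by a potential that does not
    decrease in expectation. The gradient error enters the greedy potential as an expected square,
    so no concentration or union bound over the steps is involved; rounding pays a penalty quadratic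
    in the deviation of the size, whose mean is a variance. The resulting error is relative to the
    largest reward [H] of a feasible set, which may be far above the reward of the set one compares
    with. The analysis is therefore run against a maximiser [O] of (1 - 1/e - gamma/10) h + den.
    Densities lie in [0, 1], so [H] exceeds the reward of [O] by at most 3, and the error is paid by
    the discount gamma/10 on the reward of [O]. *)

Fixpoint nwrites (c : cmd) : seq nat :=
  match c with
  | SetNat a _ _ | Draw a _ _ => [:: a]
  | Seq c1 c2 | If _ c1 c2 => nwrites c1 ++ nwrites c2
  | While _ c1 => nwrites c1
  | _ => [::]
  end.

Fixpoint rwrites (c : cmd) : seq nat :=
  match c with
  | SetReal a _ _ | Query a _ _ => [:: a]
  | Seq c1 c2 | If _ c1 c2 => rwrites c1 ++ rwrites c2
  | While _ c1 => rwrites c1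
  | _ => [::]
  end.

(* Bounds the cost of [c] when each of its loops makes at most [U] rounds
   whenever it is entered. *)
Fixpoint tcost (U : nat) (c : cmd) : nat :=
  match c with
  | Skip => 1
  | Seq c1 c2 => (tcost U c1 + tcost U c2).+1
  | SetNat _ i e | Draw _ i e => (ncost i + ncost e).+1
  | SetReal _ i e => (ncost i + rcost e).+1
  | If b c1 c2 => (bcost b + tcost U c1 + tcost U c2).+1
  | While b c1 => U.+1 * (bcost b + tcost U c1).+1
  | Query _ i _ => (ncost i).+1
  end.

Section Logic.
Variables (R : realType) (J : instance R) (U : nat).
Local Notation memory := (memory R).
Local Notation config := (config R).

(** Leaves may lie at different depths. Without a step count, runs compose freely; the fuel of
    [always] and [expect] comes back only in [run_always] and [run_expect]. The bound [g] on the
    mean over the leaves is one-sided. *)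
Inductive run (Q : config -> Prop) (f : config -> R) : config -> R -> Prop :=
| run_stop x g of Q x & g <= f x : run Q f x g
| run_step x m (next : 'I_m.+1 -> config) (gs : 'I_m.+1 -> R) g of
    step J x = Branch next & (forall i, run Q f (next i) (gs i)) &
    g <= m.+1%:R^-1 * \sum_i gs i : run Q f x g.

Lemma run_weak Q f x g g' : run Q f x g -> g' <= g -> run Q f x g'.
Proof.
case=> {x g}[x g Qx le_g|x m next gs g sx rn le_g] le_g'.
  by apply: run_stop => //; apply: le_trans le_g' le_g.
by apply: run_step sx rn _; apply: le_trans le_g' le_g.
Qed.

(** The tower rule: the value that the first run assigns to a leaf is the bound demanded of the
    continuation from that leaf. *)
Lemma run_bind Q f Q' f' x g : run Q f x g ->
  (forall y, Q y -> run Q' f' y (f y)) -> run Q' f' x g.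
Proof.
move=> rx H; elim: rx => {x g}[x g Qx le_g|x m next gs g sx _ IH le_g].
  by apply: run_weak le_g; apply: H.
exact: run_step sx IH le_g.
Qed.

Lemma uniform_mean_const m (a : R) : m.+1%:R^-1 * \sum_(i < m.+1) a = a.
Proof. by rewrite sumr_const card_ord -[a *+ _]mulr_natl mulKf ?pnatr_eq0. Qed.

Lemma run_pure Q f f' x g g' : run Q f x g ->
  (forall y, Q y -> g' <= f' y) -> run Q f' x g'.
Proof.
move=> rx H; elim: rx => {x g}[x g Qx le_g|x m next gs g sx _ IH le_g].
  by apply: run_stop => //; apply: H.
by apply: (run_step sx IH); rewrite uniform_mean_const.
Qed.

Lemma run_shift Q f x g a : run Q f x g -> run Q (fun y => f y + a) x (g + a).
Proof.
elim=> {x g}[x g Qx le_g|x m next gs g sx _ IH le_g].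
  by apply: run_stop => //; rewrite lerD2r.
apply: (run_step sx IH).
by rewrite big_split /= mulrDr uniform_mean_const lerD2r.
Qed.

(* Reading off the transition avoids inverting equations between dependent
   constructors. *)
Definition on_transition (P : config -> Prop) (tr : transition R) : Prop :=
  if tr is Branch m next then forall i : 'I_m.+1, P (next i) else True.

Lemma step_clock x m (next : 'I_m.+1 -> config) i :
  step J x = Branch next -> (clock x < clock (next i))%N.
Proof.
have : on_transition (fun y => clock x < clock y)%N (step J x).
  by case: x => t [|[|c1 c2|a j e|a j e|b c1 c2|b c1|a j e|a j b] K] s //= k;
    rewrite addnS ltnS leq_addr.
by move=> H E; move: H; rewrite E.
Qed.

Lemma run_clock Q f x g T : run Q f x g ->
  (forall y, Q y -> clock y <= T)%N -> (clock x <= T)%N.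
Proof.
move=> rx H; elim: rx => {x g}[x g Qx _|x m next gs g sx _ IH _]; first exact: H.
exact/ltnW/(leq_trans (step_clock ord0 sx) (IH ord0)).
Qed.

(** Each step advances the clock, so a run whose leaves lie before time [T] reaches them before the
    fuel is used up. *)
Lemma run_always Q f x g T t : run Q f x g ->
  (forall y, Q y -> halted y /\ clock y <= T)%N -> (T <= clock x + t)%N ->
  always J t x Q.
Proof.
move=> rx H; elim: rx t => {x g}[x g Qx _ [|t] //= _|x m next gs g sx rn IH _ [|t]].
- by case: (H _ Qx); case: x Qx => c [|? ?] s.
- rewrite addn0 => le_T; have := run_clock (rn ord0) (fun y Qy => (H y Qy).2).
  by move/(leq_trans (step_clock ord0 sx))/leq_trans/(_ le_T); rewrite ltnn.
rewrite /= sx => le_T i; apply: IH; apply: leq_trans le_T _.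
by rewrite addnS -addSn leq_add2r; apply: step_clock sx.
Qed.

Lemma run_expect Q f x g T t : run Q f x g ->
  (forall y, Q y -> halted y /\ clock y <= T)%N -> (T <= clock x + t)%N ->
  g <= expect J t x f.
Proof.
move=> rx H; elim: rx t => {x g}[x g Qx le_g [|t] //= _|x m next gs g sx rn IH le_g [|t]].
- by case: (H _ Qx); case: x Qx le_g => c [|? ?] s.
- rewrite addn0 => le_T; have := run_clock (rn ord0) (fun y Qy => (H y Qy).2).
  by move/(leq_trans (step_clock ord0 sx))/leq_trans/(_ le_T); rewrite ltnn.
rewrite /= sx => le_T; apply: le_trans le_g _.
rewrite ler_pM2l ?invr_gt0 ?ltr0Sn //; apply: ler_sum => i _.
apply: IH; apply: leq_trans le_T _.
by rewrite addnS -addSn leq_add2r; apply: step_clock sx.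
Qed.

Definition stack (x : config) (K : seq cmd) : config :=
  Config (clock x) (todo x ++ K) (Defs.mem x).

Definition stack_transition K (tr : transition R) : transition R :=
  if tr is Branch m next then Branch (fun i : 'I_m.+1 => stack (next i) K)
  else Stop R.

Lemma step_stack x K : todo x <> [::] ->
  step J (stack x K) = stack_transition K (step J x).
Proof.
case: x => t [|c L] s //= _; rewrite /stack /step /=.
by case: c => //= b c; case: beval.
Qed.

Definition leaf K T (Q : memory -> Prop) (y : config) : Prop :=
  [/\ todo y = K, (clock y <= T)%N & Q (Defs.mem y)].

Lemma run_stack T Q f x g K : run (leaf [::] T Q) (fun y => f (Defs.mem y)) x g ->
  run (leaf K T Q) (fun y => f (Defs.mem y)) (stack x K) g.
Proof.
elim=> {x g}[x g [tx le_T Qx] le_g|x m next gs g sx _ IH le_g].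
  by apply: run_stop => //; rewrite /leaf /= tx.
apply: run_step IH le_g; rewrite step_stack ?sx //.
by move=> tx; move: sx; rewrite /step tx.
Qed.

(** The starting clock is universally quantified so that costs add up under sequencing. [f] and [g]
    are the quantitative post- and precondition, the latter at the single memory [s]. *)
Definition triple (c : cmd) (s : memory) (Q : memory -> Prop) (f : memory -> R)
    (g : R) : Prop :=
  forall t, run (leaf [::] (t + tcost U c) Q) (fun y => f (Defs.mem y))
    (Config t [:: c] s) g.

Lemma leaf_weak K T T' (Q Q' : memory -> Prop) y : leaf K T Q y -> (T <= T')%N ->
  (forall s, Q s -> Q' s) -> leaf K T' Q' y.
Proof. by case=> ? le_T Qy le_T' H; split=> //; [apply: leq_trans le_T le_T'|apply: H]. Qed.

Lemma triple_conseq c s (Q Q' : memory -> Prop) f f' g g' a : triple c s Q f g ->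
  (forall s', Q s' -> Q' s' /\ f s' + a <= f' s') -> g' <= g + a ->
  triple c s Q' f' g'.
Proof.
move=> tr H le_g t; have /(run_shift a) := tr t.
move/run_bind => /(_ (leaf [::] (t + tcost U c) Q') (fun y => f' (Defs.mem y))) Hb.
apply: run_weak le_g; apply: Hb => y ly; have [_ _ /H[Q'y le_f]] := ly.
by apply: run_stop => //; case: ly => ? ? _; split.
Qed.

Lemma triple_post c s (Q Q' : memory -> Prop) f g : triple c s Q f g ->
  (forall s', Q s' -> Q' s') -> triple c s Q' f g.
Proof.
move=> tr H; apply: (@triple_conseq _ _ _ _ _ _ _ _ 0) tr _ _ => [s' /H|].
  by rewrite addr0.
by rewrite addr0.
Qed.

Lemma triple_pure c s Q f f' g g' : triple c s Q f g ->
  (forall s', Q s' -> g' <= f' s') -> triple c s Q f' g'.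
Proof. by move=> tr H t; apply: (run_pure (tr t)) => y [_ _ /H]. Qed.

Lemma triple_skip s (Q : memory -> Prop) f g : Q s -> g <= f s ->
  triple Skip s Q f g.
Proof.
move=> Qs le_g t; apply: (@run_step _ _ _ 0%N _ (fun=> g)) => [//|i|].
  by apply: run_stop.
by rewrite uniform_mean_const.
Qed.

Lemma triple_set_nat a i e s (Q : memory -> Prop) f g :
  Q (set_nat s a (neval J s i) (neval J s e)) ->
  g <= f (set_nat s a (neval J s i) (neval J s e)) ->
  triple (SetNat a i e) s Q f g.
Proof.
move=> Qs le_g t; apply: (@run_step _ _ _ 0%N _ (fun=> g)) => [//|k|].
  by apply: run_stop.
by rewrite uniform_mean_const.
Qed.

Lemma triple_set_real a i e s (Q : memory -> Prop) f g :
  Q (set_real s a (neval J s i) (reval J s e)) ->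
  g <= f (set_real s a (neval J s i) (reval J s e)) ->
  triple (SetReal a i e) s Q f g.
Proof.
move=> Qs le_g t; apply: (@run_step _ _ _ 0%N _ (fun=> g)) => [//|k|].
  by apply: run_stop.
by rewrite uniform_mean_const.
Qed.

Lemma triple_query a i b s (Q : memory -> Prop) f g :
  Q (set_real s a (neval J s i) (reward J (vertex_set J s b))) ->
  g <= f (set_real s a (neval J s i) (reward J (vertex_set J s b))) ->
  triple (Query a i b) s Q f g.
Proof.
move=> Qs le_g t; apply: (@run_step _ _ _ 0%N _ (fun=> g)) => [//|k|].
  by apply: run_stop.
by rewrite uniform_mean_const.
Qed.

Lemma triple_draw a i e s (Q : memory -> Prop) f g :
  (forall k : 'I_(neval J s e).+1, Q (set_nat s a (neval J s i) k)) ->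
  g <= (neval J s e).+1%:R^-1 *
       \sum_(k < (neval J s e).+1) f (set_nat s a (neval J s i) k) ->
  triple (Draw a i e) s Q f g.
Proof.
move=> Qs le_g t.
apply: (@run_step _ _ _ (neval J s e) _
  (fun k => f (set_nat s a (neval J s i) k))); [exact: (erefl _)| |by []].
by move=> k; apply: run_stop => //; split=> //=; apply: Qs.
Qed.

Lemma triple_seq c1 c2 s (Q1 Q2 : memory -> Prop) f1 f2 g :
  triple c1 s Q1 f1 g -> (forall s', Q1 s' -> triple c2 s' Q2 f2 (f1 s')) ->
  triple (Seq c1 c2) s Q2 f2 g.
Proof.
move=> tr1 tr2 t; apply: (@run_step _ _ _ 0%N _ (fun=> g)) => [//|k|]; last first.
  by rewrite uniform_mean_const.
have := run_stack [:: c2] (tr1 (t + 1)%N); rewrite /stack /= => /run_bind; apply.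
case=> t' K' s' [/= -> le_t' Qs']; have := tr2 s' Qs' t'.
move/run_bind; apply=> y [ty le_y Qy]; apply: run_stop => //; split=> //.
by apply: leq_trans le_y _ => /=; move: le_t'; lia.
Qed.

Lemma triple_if b c1 c2 s (Q : memory -> Prop) f g :
  triple (if beval J s b then c1 else c2) s Q f g -> triple (If b c1 c2) s Q f g.
Proof.
move=> tr t; apply: (@run_step _ _ _ 0%N _ (fun=> g)) => [//|k|]; last first.
  by rewrite uniform_mean_const.
have /run_bind := tr (t + (bcost b).+1)%N; apply=> y ly; apply: run_stop => //.
by apply: leaf_weak ly _ _ => //=; case: beval; lia.
Qed.

Definition agree (c : cmd) (s s' : memory) : Prop :=
  (forall a i, a \notin nwrites c -> nmem s' a i = nmem s a i) /\
  (forall a i, a \notin rwrites c -> rmem s' a i = rmem s a i).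

(** The invariant along the run: every command left on the stack writes only to arrays that [c]
    writes. *)
Lemma triple_frame c s (Q : memory -> Prop) f g : triple c s Q f g ->
  triple c s (fun s' => Q s' /\ agree c s s') f g.
Proof.
move=> tr t; have := tr t; set x := Config t _ _.
pose wr d := {subset nwrites d <= nwrites c} /\ {subset rwrites d <= rwrites c}.
pose I (x : config) := (forall d, List.In d (todo x) -> wr d) /\ agree c s (Defs.mem x).
have : I x by split=> [d [<-|[]]|] //; split.
move: x => x Ix rx; elim: rx Ix => {x g tr}[x g [tx le_x Qx] le_g|x m next gs g sx _ IH le_g] Ix.
  by apply: run_stop => //; split=> //; split=> //; case: Ix.
apply: (run_step sx _ le_g) => i; apply: IH.
have : on_transition I (step J x).
  case: x {sx} Ix => t' [//|d L] s'; rewrite /I /= => -[sub [agn agr]].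
  have subL e : List.In e L -> wr e by move=> eL; apply: sub; right.
  have [dn dr] : wr d by apply: sub; left.
  case: d sub dn dr => [|c1 c2|a j e|a j e|b c1 c2|b c1|a j e|a j b] /= sub dn dr k.
  - by split.
  - split=> // e [<-|[<-|/subL//]].
      by split=> z zz; [apply: dn|apply: dr]; rewrite mem_cat zz.
    by split=> z zz; [apply: dn|apply: dr]; rewrite mem_cat zz orbT.
  - split=> //; split=> // b z nb; rewrite /= /update.
    by case: eqP => [E|_] /=; [move: nb; rewrite E dn ?mem_head|apply: agn].
  - split=> //; split=> // b z nb; rewrite /= /update.
    by case: eqP => [E|_] /=; [move: nb; rewrite E dr ?mem_head|apply: agr].
  - split=> // e [<-|/subL//].
    by split=> z zz; [apply: dn|apply: dr]; rewrite mem_cat; case: beval zz => ->;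
      rewrite ?orbT.
  - split=> // e /=; case: beval => [|/subL//].
    by case=> [<-|[<-|/subL//]].
  - split=> //; split=> // b z nb; rewrite /= /update.
    by case: eqP => [E|_] /=; [move: nb; rewrite E dn ?mem_head|apply: agn].
  - split=> //; split=> // b' z nb; rewrite /= /update.
    by case: eqP => [E|_] /=; [move: nb; rewrite E dr ?mem_head|apply: agr].
by rewrite sx; apply.
Qed.

Definition For (i : nat) (e : nexp) (c : cmd) : cmd :=
  Seq (SetNat i (NLit 0) (NLit 0))
    (While (BNot (BNatLe e (NGet i (NLit 0))))
      (Seq c (SetNat i (NLit 0) (NAdd (NGet i (NLit 0)) (NLit 1))))).

(** [phi] is a submartingale along the rounds, so its initial value bounds the final mean. The loop
    test evaluates [e] afresh each time, hence the hypothesis that it stays equal to [b]. *)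
Lemma triple_for i e c s b (Inv : nat -> memory -> Prop) (phi : nat -> memory -> R) :
  (b <= U)%N -> Inv 0%N (set_nat s i 0 0) ->
  (forall j s', agree (For i e c) s s' -> (j <= b)%N -> Inv j s' ->
     nmem s' i 0 = j -> neval J s' e = b) ->
  (forall j s', agree (For i e c) s s' -> (j < b)%N -> Inv j s' ->
     nmem s' i 0 = j ->
     triple c s' (fun s'' => nmem s'' i 0 = j /\ Inv j.+1 (set_nat s'' i 0 j.+1))
       (fun s'' => phi j.+1 (set_nat s'' i 0 j.+1)) (phi j s')) ->
  triple (For i e c) s (fun s' => agree (For i e c) s s' /\ Inv b s')
    (phi b) (phi 0%N (set_nat s i 0 0)).
Proof.
move=> le_b Inv0 He Hc.
pose I j s' := [/\ agree (For i e c) s s', Inv j s' & nmem s' i 0 = j].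
rewrite [X in triple X]/For; set w := While _ _.
(* [(ncost e + 2).+1.+1] is the cost of the test, and 7 is the counter increment (6) plus the
   sequencing (1). *)
have Hw j s' : (j <= b)%N -> I j s' -> forall t,
    run (leaf [::] (t + (b - j).+1 * ((ncost e + 2).+1.+1 + tcost U c + 7).+1) (I b))
      (fun y => phi b (Defs.mem y)) (Config t [:: w] s') (phi j s').
  move: {2}(b - j)%N (leqnn (b - j)) => d; elim: d j s' => [|d IH] j s' le_d le_jb [ag Ij Ej] t.
    have Ejb : j = b by move: le_jb le_d; lia.
    rewrite Ejb in Ij Ej *; apply: (@run_step _ _ _ 0%N _ (fun=> phi b s')); first exact: (erefl _).
      move=> kk; rewrite /= (He b) // Ej leqnn /=.
      by apply: run_stop => //; split=> //=; lia.
    by rewrite uniform_mean_const.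
  case: (ltnP j b) => [lt_jb|le_bj]; last first.
    by apply: IH => //; move: le_d; lia.
  apply: (@run_step _ _ _ 0%N _ (fun=> phi j s')); first exact: (erefl _).
    move=> kk; rewrite /= (He j) // Ej leqNgt lt_jb /=.
    set t1 := (t + (ncost e + 2).+3)%N.
    have tb : triple (Seq c (SetNat i (NLit 0) (NAdd (NGet i (NLit 0)) (NLit 1)))) s'
        (I j.+1) (phi j.+1) (phi j s').
      apply: triple_seq (triple_frame (Hc j s' ag lt_jb Ij Ej)) _ => s2 [[Ei2 Inv2] [an ar]].
      apply: triple_set_nat; rewrite /= Ei2 addn1 //; split=> //.
        split=> a z na /=; rewrite /update.
          case: eqP => [E|_] /=; first by move: na; rewrite E /= inE eqxx.
          rewrite an; last by apply: contra na => /= na; rewrite inE mem_cat na orbT.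
          by case: ag => + _; apply.
        rewrite ar; last by apply: contra na => /= na; rewrite mem_cat na.
        by case: ag => _; apply.
      by rewrite /= /update !eqxx.
    apply: (run_bind (run_stack [:: w] (tb t1))).
    case=> t' K' s2 [/= -> le_t' Is2].
    have := IH j.+1 s2; move/(_ _ lt_jb Is2 t')/run_bind; apply; first by move: le_d; lia.
    move=> y ly; apply: run_stop => //; apply: leaf_weak ly _ _ => //.
    rewrite (_ : (b - j).+1 = (b - j.+1).+2); last by move: lt_jb; lia.
    by move: le_t'; rewrite /t1; nia.
  by rewrite uniform_mean_const.
apply: triple_seq (_ : triple _ _ (fun s' => s' = set_nat s i 0 0) (fun=> phi 0%N (set_nat s i 0 0)) _) _.
  by apply: triple_set_nat.
move=> _ -> t; have := Hw 0%N (set_nat s i 0 0) isT.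
have I0 : I 0%N (set_nat s i 0 0).
  split=> //; last by rewrite /= /update !eqxx.
  split=> a z na //=; rewrite /update.
  by case: eqP => [E|_] //=; move: na; rewrite E /= inE eqxx.
move/(_ I0 t)/run_bind; apply=> y [ty le_y [ag Ib Eb]]; apply: run_stop => //; split=> //.
apply: leq_trans le_y _; rewrite leq_add2l /w /=.
by rewrite subn0; apply: leq_mul; lia.
Qed.

End Logic.

(** * Product measures and submodular functions *)

Section SubmodularFacts.
Variables (R : realType) (V : finType) (h : {set V} -> R).
Hypotheses (h0 : forall X, 0 <= h X) (hm : monotone_setfun h) (hs : submodular h).

Definition gain (X : {set V}) (v : V) : R := h (v |: X) - h X.

Lemma gain_ge0 X v : 0 <= gain X v.
Proof. by rewrite subr_ge0; apply/hm/subsetUr. Qed.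

(** Submodularity applied to [v |: X] and [Y]. If [v] is in [Y], their intersection may be larger
    than [X], and monotonicity closes the gap. *)
Lemma gain_decr (X Y : {set V}) v : X \subset Y -> gain Y v <= gain X v.
Proof.
move=> sXY; have := hs (v |: X) Y.
rewrite -setUA (setUidPr sXY).
have : h X <= h ((v |: X) :&: Y) by apply/hm; rewrite subsetI subsetUr.
rewrite /gain; lra.
Qed.

Lemma sum_gain (X O : {set V}) : h O - h X <= \sum_(v in O) gain X v.
Proof.
have H (l : seq V) : h (X :|: [set v in l]) - h X <= \sum_(v <- l) gain X v.
  elim: l => [|v l IH]; first by rewrite big_nil set_nil setU0 subrr.
  rewrite big_cons set_cons setUCA.
  have := @gain_decr X (X :|: [set v in l]) v (subsetUl _ _); rewrite {1}/gain; lra.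
rewrite -big_enum; apply: le_trans (H (enum O)).
rewrite lerD2r; apply: hm; apply/subsetP => v vO.
by rewrite !inE mem_enum vO orbT.
Qed.

(** If the elements of [D] are removed one after the other, each costs at least what it costs when
    removed from [X] alone, and the actual costs telescope. So some element of [D] costs at most a
    fraction [1 / #|D|] of [h X], which is what greedy shrinking needs. *)
Lemma sum_removal_loss (X D : {set V}) : D \subset X ->
  \sum_(v in D) (h X - h (X :\ v)) <= h X.
Proof.
move=> sDX.
have H (l : seq V) : uniq l -> {subset l <= X} ->
    \sum_(v <- l) (h X - h (X :\ v)) <= h X - h (X :\: [set v in l]).
  elim: l => [|v l IH]; first by rewrite big_nil set_nil setD0 subrr.
  rewrite big_cons set_cons /= => /andP[vl ul] sl.
  have vX : v \in X by apply: sl; rewrite mem_head.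
  have {}IH := IH ul (fun u ul => sl u (mem_behead (s := v :: l) ul)).
  have := @gain_decr (X :\: (v |: [set u in l])) (X :\ v) v.
  rewrite /gain setD1K //.
  have -> : v |: X :\: (v |: [set u in l]) = X :\: [set u in l].
    apply/setP => u; rewrite !inE.
    by case: eqP => [->|_] //=; rewrite vX (negPf vl).
  have sub : X :\: (v |: [set u in l]) \subset X :\ v by apply: setDS; apply: subsetUl.
  by move=> /(_ sub); lra.
rewrite -big_enum; apply: le_trans (H (enum D) (enum_uniq _) _) _.
  by move=> u; rewrite mem_enum; apply: (subsetP sDX).
by rewrite gerBl.
Qed.

End SubmodularFacts.

(** * Expectations under product measures: the multilinear extension *)

Section ProductMean.
Variables (R : realType) (V : finType).
Implicit Types (p : V -> R) (psi : {set V} -> R) (X Y : {set V}) (l : seq V).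

(** [X] holds the elements already chosen. The program samples in the same order, so the conditional
    mean after a partial draw is again an [lmean]. *)
Fixpoint lmean l p psi X : R :=
  if l is v :: l' then
    p v * lmean l' p psi (v |: X) + (1 - p v) * lmean l' p psi X
  else psi X.

(* Expectation of psi on the random set that contains each v independently
   with probability p v. *)
Definition mean p psi : R := lmean (enum V) p psi set0.

Definition unit_range p : Prop := forall v, 0 <= p v <= 1.

Lemma lmean_le l p psi psi' X : unit_range p ->
  (forall Y, (forall v, v \notin l -> (v \in Y) = (v \in X)) -> psi Y <= psi' Y) ->
  lmean l p psi X <= lmean l p psi' X.
Proof.
move=> p01; elim: l X => [|v l IH] X H /=; first by apply: H.
have /andP[p0 p1] := p01 v.
apply: lerD; apply: ler_wpM2l; rewrite ?subr_ge0 //; apply: IH => Y HY; apply: H => u;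
  rewrite inE negb_or => /andP[uv ul]; rewrite HY //.
by rewrite in_setU1 (negPf uv).
Qed.

Lemma lmean_eq l p psi psi' X :
  (forall Y, (forall v, v \notin l -> (v \in Y) = (v \in X)) -> psi Y = psi' Y) ->
  lmean l p psi X = lmean l p psi' X.
Proof.
elim: l X => [|v l IH] X H /=; first by apply: H.
congr (_ * _ + _ * _); apply: IH => Y HY; apply: H => u;
  rewrite inE negb_or => /andP[uv ul]; rewrite HY //.
by rewrite in_setU1 (negPf uv).
Qed.

Lemma lmean_eqp l p p' psi X : {in l, p =1 p'} -> lmean l p psi X = lmean l p' psi X.
Proof.
elim: l X => [|v l IH] X H //=.
have H' : {in l, p =1 p'} by move=> u ul; apply: H; rewrite inE ul orbT.
by rewrite !IH // H ?mem_head.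
Qed.

Lemma lmean_lin l p a psi psi' X :
  lmean l p (fun Y => a * psi Y + psi' Y) X = a * lmean l p psi X + lmean l p psi' X.
Proof. by elim: l X => [|v l IH] X //=; rewrite !IH; ring. Qed.

Lemma lmean_const l p a X : lmean l p (fun=> a) X = a.
Proof. by elim: l X => [|v l IH] X //=; rewrite !IH; ring. Qed.

Lemma lmean_setU1 l p psi v X :
  lmean l p psi (v |: X) = lmean l p (fun Y => psi (v |: Y)) X.
Proof. by elim: l X => [|u l IH] X //=; rewrite setUCA !IH. Qed.

Lemma lmean_setU1_drop l p psi v X : v \notin l ->
  lmean l p (fun Y => psi (v |: Y)) (v |: X) = lmean l p (fun Y => psi (v |: Y)) X.
Proof.
move=> vl; rewrite lmean_setU1; apply: lmean_eq => Y _.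
by rewrite setUA setUid.
Qed.

Lemma lmean_setD1 l p psi v X : v \notin l -> v \notin X ->
  lmean l p (fun Y => psi (Y :\ v)) X = lmean l p psi X.
Proof.
move=> vl vX; apply: lmean_eq => Y HY; congr psi; apply/setP => u.
by rewrite !inE; case: eqP => // ->; rewrite HY // (negPf vX).
Qed.

Lemma lmean_setU1_setD1 l p psi v X : v \notin l -> v \notin X ->
  lmean l p (fun Y => psi (Y :\ v)) (v |: X) = lmean l p psi X.
Proof.
move=> vl vX; rewrite lmean_setU1 -[RHS](lmean_setD1 _ _ vl vX).
by apply: lmean_eq => Y _; congr psi; apply/setP => u; rewrite !inE; case: eqP.
Qed.

Lemma lmean_coord l p psi X v : uniq l -> v \in l -> v \notin X ->
  lmean l p psi X = p v * lmean l p (fun Y => psi (v |: Y)) X +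
                    (1 - p v) * lmean l p (fun Y => psi (Y :\ v)) X.
Proof.
elim: l X => [//|u l IH] X /= /andP[ul uql] vl vX.
move: vl; rewrite inE; case: eqP => [Evu _|/eqP vu /= vl].
  subst u; rewrite lmean_setU1_drop // lmean_setU1_setD1 // lmean_setD1 //.
  by rewrite lmean_setU1; ring.
by rewrite (IH (u |: X)) // ?inE ?negb_or ?vu // (IH X) //; ring.
Qed.

(** The mean is affine in the coordinate [p v]: the integrand of the slope ignores whether [v] was
    drawn, so the slope does not depend on [p v]. *)
Lemma lmean_change l p p' psi X v : uniq l -> v \in l -> v \notin X ->
  (forall u, u != v -> p' u = p u) ->
  lmean l p' psi X = lmean l p psi X +
    (p' v - p v) * lmean l p (fun Y => psi (v |: Y) - psi (Y :\ v)) X.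
Proof.
move=> uql vl vX Hp.
have E psi' : (forall Y, psi' (v |: Y) = psi' Y) ->
    lmean l p' psi' X = lmean l p psi' X.
  move=> Hpsi; elim: l X uql {vl vX} => [//|u l IH] X /= /andP[ul uql].
  have [Euv|uv] := eqVneq u v; last by rewrite Hp // !IH.
  subst u; rewrite !(IH _ uql).
  rewrite lmean_setU1; have -> : lmean l p (fun Y => psi' (v |: Y)) X = lmean l p psi' X.
    by apply: lmean_eq => Y _; apply: Hpsi.
  by ring.
rewrite (lmean_coord p' psi uql vl vX) (lmean_coord p psi uql vl vX).
rewrite !E; last 2 first.
- move=> Y; congr psi; apply/setP => u; rewrite !inE; by case: eqP.
- by move=> Y; rewrite setUA setUid.
have -> : lmean l p (fun Y => psi (v |: Y) - psi (Y :\ v)) X =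
   -1 * lmean l p (fun Y => psi (Y :\ v)) X + lmean l p (fun Y => psi (v |: Y)) X.
  by rewrite -lmean_lin; apply: lmean_eq => Y _; ring.
by ring.
Qed.

Lemma mean_le p psi psi' : unit_range p -> (forall Y, psi Y <= psi' Y) ->
  mean p psi <= mean p psi'.
Proof. by move=> p01 H; apply: lmean_le => // Y _. Qed.

Lemma mean_eq p psi psi' : psi =1 psi' -> mean p psi = mean p psi'.
Proof. by move=> H; apply: lmean_eq => Y _. Qed.

Lemma mean_const p a : mean p (fun=> a) = a.
Proof. exact: lmean_const. Qed.

Lemma mean_lin p a psi psi' :
  mean p (fun Y => a * psi Y + psi' Y) = a * mean p psi + mean p psi'.
Proof. exact: lmean_lin. Qed.

Lemma mean_sum p (I : Type) (r : seq I) (P : pred I) (psi : I -> {set V} -> R) :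
  mean p (fun Y => \sum_(i <- r | P i) psi i Y) = \sum_(i <- r | P i) mean p (psi i).
Proof.
elim: r => [|i r IH].
  by rewrite big_nil -[RHS](mean_const p); apply: mean_eq => Y; rewrite big_nil.
rewrite big_cons; case: ifP => Pi; last first.
  by rewrite -IH; apply: mean_eq => Y; rewrite big_cons Pi.
rewrite -IH -[mean p (psi i)]mul1r -mean_lin; apply: mean_eq => Y.
by rewrite big_cons Pi mul1r.
Qed.

Lemma mean_change p p' psi v : (forall u, u != v -> p' u = p u) ->
  mean p' psi = mean p psi +
    (p' v - p v) * mean p (fun Y => psi (v |: Y) - psi (Y :\ v)).
Proof. by move=> Hp; apply: lmean_change; rewrite ?enum_uniq ?mem_enum ?inE. Qed.

Lemma mean_pair p u v : u != v ->
  mean p (fun Y => ((u \in Y) && (v \in Y))%:R) = p u * p v.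
Proof.
move=> uv; rewrite /mean.
have E : lmean (enum V) p (fun Y => (v \in Y)%:R) set0 = p v.
  rewrite (@lmean_coord _ _ _ _ v) ?enum_uniq ?mem_enum ?inE //.
  rewrite (@lmean_eq _ _ _ (fun=> 1)); last by move=> Y _; rewrite !inE eqxx.
  rewrite lmean_const (@lmean_eq _ _ _ (fun=> 0)); last by move=> Y _; rewrite !inE eqxx.
  by rewrite lmean_const; ring.
rewrite (@lmean_coord _ _ _ _ u) ?enum_uniq ?mem_enum ?inE //.
rewrite (@lmean_eq _ _ _ (fun Y => (v \in Y)%:R)); last first.
  by move=> Y _; rewrite !inE eqxx /= eq_sym (negPf uv).
rewrite E (@lmean_eq _ _ (fun Y => ((u \in Y :\ u) && _)%:R) (fun=> 0)); last first.
  by move=> Y _; rewrite !inE eqxx.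
by rewrite lmean_const; ring.
Qed.

(** Squared bias plus the variance of a sum of independent indicators. *)
Lemma mean_sqr_dev p t :
  mean p (fun Y => (#|Y|%:R - t) ^+ 2) =
    (\sum_v p v - t) ^+ 2 + \sum_v p v * (1 - p v).
Proof.
have H l X : uniq l -> [disjoint X & l] ->
    lmean l p (fun Y => (#|Y|%:R - t) ^+ 2) X =
    (#|X|%:R + \sum_(v <- l) p v - t) ^+ 2 + \sum_(v <- l) p v * (1 - p v).
  elim: l X => [|v l IH] X /=; first by rewrite !big_nil !addr0.
  case/andP=> vl ul; rewrite disjoint_sym disjoint_cons => /andP[vX dX].
  rewrite !big_cons !IH //; last 2 first.
  - by rewrite disjoint_sym.
  - rewrite disjoint_sym; apply/pred0P => u /=; rewrite !inE.
    case: (u =P v) => [->|_] /=; first by rewrite (negPf vl).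
    by apply: (pred0P dX).
  by rewrite cardsU1 vX add1n -natr1; ring.
rewrite /mean H ?enum_uniq //; last by apply/pred0P => u /=; rewrite inE.
by rewrite cards0 add0r !big_enum.
Qed.

End ProductMean.

(** * One step of the continuous greedy method *)

Section FractionalStep.
Variables (R : realType) (V : finType) (h : {set V} -> R) (B : R).
Hypotheses (h0 : forall X, 0 <= h X) (hm : monotone_setfun h) (hs : submodular h).
Hypothesis gainB : forall X v, gain h X v <= B.

(** This is [1 - p v] times the partial derivative of the multilinear extension, since [gain]
    vanishes when [v] is already drawn. The smaller quantity suffices for the greedy step and is
    what the program samples. *)
Definition mgain (p : V -> R) (v : V) : R := mean p (fun X => gain h X v).

(** The coordinates in [Z] are raised one at a time. Gains lie between 0 and [B], so each rise
    lowers a mean gain by at most [d * B]; the total is the second-order loss. *)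
Lemma mean_step (p : V -> R) (d : R) (Z : {set V}) :
  unit_range p -> 0 <= d -> (forall v, v \in Z -> p v + d <= 1) ->
  mean p h + d * \sum_(v in Z) mgain p v - (d * #|Z|%:R) ^+ 2 * B <=
  mean (fun v => p v + d * (v \in Z)%:R) h.
Proof.
move=> p01 d0 pd.
(* [gainB] yields [0 <= B] only in the presence of a vertex. *)
have [V0|v0] := pickP (mem V); last first.
  have ZE : Z = set0 by apply/setP => v; have := v0 v; rewrite inE.
  rewrite ZE big_set0 cards0 !mulr0 expr2 mul0r mul0r subr0 addr0.
  rewrite le_eqVlt; apply/orP; left; apply/eqP; apply: lmean_eqp => v _.
  by rewrite inE mulr0 addr0.
have B0 : 0 <= B by apply: le_trans (gainB set0 V0); apply: gain_ge0.
pose q l v := p v + d * (v \in (l : seq V))%:R.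
have q01 l : {subset l <= Z} -> unit_range (q l).
  move=> sl v; rewrite /q; have /andP[? ?] := p01 v.
  by case: (boolP (v \in l)) => [/sl/pd ?|_] /=; lra.
have qch u l : u \notin l -> forall psi, mean (q (u :: l)) psi =
    mean (q l) psi + d * mean (q l) (fun Y => psi (u |: Y) - psi (Y :\ u)).
  move=> ul psi; rewrite (@mean_change _ _ (q l) _ _ u); last first.
    by move=> v vu; rewrite /q inE (negPf vu).
  congr (_ + _ * _); rewrite /q inE eqxx (negPf ul) /=; ring.
have Hdrop v l : uniq l -> {subset l <= Z} ->
    mgain p v - d * (size l)%:R * B <= mgain (q l) v.
  elim: l => [|u l IH] /=.
    move=> _ _; rewrite mulr0 mul0r subr0 le_eqVlt; apply/orP; left; apply/eqP.
    by apply: lmean_eqp => x _; rewrite /q /= mulr0 addr0.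
  case/andP=> ul uql sl; have sl' : {subset l <= Z} by move=> x xl; apply: sl; rewrite inE xl orbT.
  have {}IH := IH uql sl'.
  rewrite /mgain (qch u l ul) -natr1.
  have : - B <= mean (q l) (fun Y => gain h (u |: Y) v - gain h (Y :\ u) v).
    rewrite -(mean_const (q l) (- B)); apply: mean_le; first exact: q01.
    by move=> Y; have := gain_ge0 hm (u |: Y) v; have := gainB (Y :\ u) v; lra.
  move/(ler_wpM2l d0); move: IH; rewrite /mgain; nra.
have Hmain l : uniq l -> {subset l <= Z} ->
    mean p h + d * \sum_(v <- l) mgain p v - (d * (size l)%:R) ^+ 2 * B <= mean (q l) h.
  elim: l => [|u l IH] /=.
    move=> _ _; rewrite big_nil !mulr0 expr2 mulr0 mul0r subr0 addr0 le_eqVlt.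
    by apply/orP; left; apply/eqP; apply: lmean_eqp => x _; rewrite /q /= mulr0 addr0.
  case/andP=> ul uql sl; have sl' : {subset l <= Z} by move=> x xl; apply: sl; rewrite inE xl orbT.
  have {}IH := IH uql sl'; rewrite (qch u l ul) big_cons -natr1.
  (* The slope at [u] also takes [u] out of the sample, so by monotonicity it is at least the mean
     gain. *)
  have : mgain (q l) u <= mean (q l) (fun Y => h (u |: Y) - h (Y :\ u)).
    apply: mean_le; first exact: q01.
    by move=> Y; rewrite /gain lerB //; apply: hm; apply: subsetDl.
  move/(ler_wpM2l d0); have := Hdrop u l uql sl' => /(ler_wpM2l d0).
  have s0 : 0 <= (size l)%:R :> R by [].
  have : 0 <= d * d * B * ((size l)%:R + 1) by rewrite !mulr_ge0 // addr_ge0.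
  set s := (size l)%:R in IH s0 *; set S := \sum_(v <- l) _ in IH *.
  by nra.
have -> : \sum_(v in Z) mgain p v = \sum_(v <- enum Z) mgain p v by rewrite big_enum.
rewrite cardE => _; apply: le_trans (Hmain (enum Z) (enum_uniq _) _) _.
  by move=> v; rewrite mem_enum.
rewrite le_eqVlt; apply/orP; left; apply/eqP; apply: lmean_eqp => v _.
by rewrite /q mem_enum.
Qed.

(** [sum_gain] averaged over the sample. This is the inequality behind the factor 1 - 1/e: the
    elements of [O] together offer the whole gap to [h O]. *)
Lemma sum_mgain p (O : {set V}) : unit_range p ->
  h O - mean p h <= \sum_(v in O) mgain p v.
Proof.
move=> p01; rewrite /mgain -mean_sum.
have -> : h O - mean p h = mean p (fun Y => -1 * h Y + h O).
  by rewrite mean_lin mean_const; ring.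
apply: mean_le => // Y; apply: le_trans (sum_gain hm hs Y O).
by rewrite mulN1r addrC.
Qed.

Lemma mgain_range p v : unit_range p -> 0 <= mgain p v <= B.
Proof.
move=> p01; apply/andP; split.
  by rewrite -(mean_const p 0); apply: mean_le => // Y; apply: gain_ge0.
by rewrite -(mean_const p B); apply: mean_le.
Qed.

(* One more sample raises the expected squared error by a variance <= B^2. *)
Lemma mean_sqr_error p v (a j : R) : unit_range p ->
  mean p (fun X => (a + gain h X v - (j + 1) * mgain p v) ^+ 2) <=
  (a - j * mgain p v) ^+ 2 + B ^+ 2.
Proof.
move=> p01; set m := mgain p v; have /andP[m0 mB] := mgain_range v p01.
have -> : mean p (fun X => (a + gain h X v - (j + 1) * m) ^+ 2) =
    (2 * (a - (j + 1) * m)) * m +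
    (1 * mean p (fun X => gain h X v ^+ 2) + (a - (j + 1) * m) ^+ 2).
  rewrite -[X in _ = _ + (_ + X)](mean_const p) -mean_lin -mean_lin.
  by apply: mean_eq => Y; ring.
have : mean p (fun X => gain h X v ^+ 2) <= B * m.
  have -> : B * m = mean p (fun X => B * gain h X v + 0).
    by rewrite mean_lin mean_const addr0.
  apply: mean_le => // Y; have := gainB Y v; have := gain_ge0 hm Y v; nra.
nra.
Qed.

End FractionalStep.

(** * A small multiset that represents the neighbourhood of a set *)

Section Sparsification.
Variables (R : realType) (V : finType) (w : V -> V -> R).
Hypothesis w01 : forall u v, 0 <= w u v <= 1.

(** From [1 - z <= expR (- z)] comes [(1 - z) * expR z <= 1], while [(1 - z) * (1 + z + 2 * z ^+ 2)
    = 1 + z ^+ 2 * (1 - 2 * z)] is at least 1 for [z <= 1/2]. *)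
Lemma expR_le_quadratic (z : R) : `|z| <= 2^-1 -> expR z <= 1 + z + 2 * z ^+ 2.
Proof.
rewrite ler_norml => /andP[z1 z2].
have := expR_ge1Dx (- z); rewrite expRN => Hz.
have e0 := expR_gt0 z.
have : (1 - z) * expR z <= 1.
  by have := ler_wpM2r (ltW e0) Hz; rewrite mulVf ?gt_eqF.
have : 0 <= z ^+ 2 * (1 - 2 * z) by rewrite mulr_ge0 ?sqr_ge0 //; lra.
by move=> H1 H2; rewrite -(ler_pM2l (_ : 0 < 1 - z)); [nra|lra].
Qed.

Lemma exists_le_mean (T : finType) (P : pred T) (G : T -> R) (a : R) :
  (exists x, P x) -> \sum_(x | P x) G x <= \sum_(x | P x) a ->
  exists2 x, P x & G x <= a.
Proof.
move=> [x0 Px0] le_s.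
case: (boolP [exists x, P x && (G x <= a)]) => [/existsP[x /andP[? ?]]|]; first by exists x.
rewrite negb_exists => /forallP H; exfalso; move: le_s; apply/negP; rewrite -ltNge.
rewrite (bigD1 x0) // [X in _ < X](bigD1 x0) //=.
have lt_x x : P x -> a < G x by move=> Px; have := H x; rewrite Px /= -ltNge.
apply: ltr_leD; first exact: lt_x.
by apply: ler_sum => x /andP[Px _]; apply/ltW/lt_x.
Qed.

(** A moment bound of Hoeffding type: the linear term of the quadratic estimate cancels because [A]
    is centred. *)
Lemma sum_expR_centred (O : {set V}) (A : V -> R) (eta : R) :
  0 <= eta <= 2^-1 -> (forall u, `|A u| <= 1) -> \sum_(u in O) A u = 0 ->
  \sum_(u in O) expR (eta * A u) <= #|O|%:R * expR (2 * eta ^+ 2).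
Proof.
move=> /andP[e0 e1] A1 sA.
have : \sum_(u in O) expR (eta * A u) <= \sum_(u in O) (1 + eta * A u + 2 * eta ^+ 2).
  apply: ler_sum => u _; apply: le_trans (expR_le_quadratic _) _.
    by rewrite normrM ger0_norm //; apply: le_trans (ler_wpM2l e0 (A1 u)) _; rewrite mulr1.
  rewrite lerD2l ler_pM2l // exprMn ler_piMr ?sqr_ge0 //.
  by rewrite -real_normK ?num_real // expr_le1.
move/le_trans; apply.
rewrite !big_split /= -mulr_sumr sA mulr0 addr0 !sumr_const -mulrnDl -[X in X <= _]mulr_natl.
by rewrite ler_wpM2l // expR_ge1Dx.
Qed.

(** Chernoff and union bound in counting form. [G] adds up the exponentials of both signs of the
    deviation at all vertices; some [f] with values in [O] has [G f] at most the average, so each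
    single exponential is small, and so is each deviation. *)
Lemma sparse_neighbourhood (O : {set V}) (r s L : nat) :
  (0 < #|O|)%N -> (0 < s)%N -> (#|V| <= 2 ^ L)%N -> (8 * s ^ 2 * L.+1 <= r)%N ->
  exists2 f : 'I_r -> V, (forall t, f t \in O) &
  forall v, `|#|O|%:R / r%:R * (\sum_(t < r) w (f t) v) - \sum_(u in O) w u v|
            <= #|O|%:R / s%:R.
Proof.
move=> O0 s0 VL rL.
have r0 : (0 < r)%N by apply: leq_trans rL; rewrite !muln_gt0 /= s0.
have k0 : 0 < #|O|%:R :> R by rewrite ltr0n.
have sR : 1 <= s%:R :> R by rewrite ler1n.
have rR : 0 < r%:R :> R by rewrite ltr0n.
(* With this choice the hypothesis on [r] gives [L.+1 <= 2 * eta ^+ 2 * r]. The factor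
   [2 * #|V| <= expR L.+1] then at most doubles the exponent, and the deviation [4 * eta * r]
   obtained in the end is exactly [r / s]. *)
pose eta : R := (4 * s%:R)^-1.
have eta0 : 0 < eta by rewrite invr_gt0; lra.
have etas : eta * (4 * s%:R) = 1 by rewrite mulVf // gt_eqF //; lra.
have eta1 : 0 <= eta <= 2^-1 by apply/andP; split; [exact: ltW|nra].
pose A v u : R := w u v - (\sum_(x in O) w x v) / #|O|%:R.
have Asum v : \sum_(u in O) A v u = 0.
  rewrite big_split /= sumr_const -[_ *+ _]mulr_natl mulrN [_ * (_ / _)]mulrC divfK ?subrr //.
  by rewrite gt_eqF.
have A1 v u : `|A v u| <= 1.
  have /andP[? ?] := w01 u v.
  have : 0 <= (\sum_(x in O) w x v) / #|O|%:R <= 1.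
    rewrite divr_ge0 ?sumr_ge0 ?(ltW k0) //=; last by move=> x _; case/andP: (w01 x v).
    rewrite ler_pdivrMr // mul1r -sum1_card natr_sum.
    by apply: ler_sum => x _; case/andP: (w01 x v).
  by move=> /andP[? ?]; rewrite ler_norml; apply/andP; split; rewrite /A; lra.
pose G (f : {ffun 'I_r -> V}) := \sum_v
  (\prod_(t < r) expR (eta * A v (f t)) + \prod_(t < r) expR (eta * - A v (f t))).
pose bound : R := #|V|%:R * 2 * expR (2 * eta ^+ 2) ^+ r.
have [f fO Gf] : exists2 f, f \in ffun_on (mem O) & G f <= bound.
  apply: exists_le_mean.
    have /card_gt0P[o oO] := O0; exists [ffun=> o]; apply/ffun_onP => t; by rewrite ffunE.
  rewrite /G exchange_big /= sumr_const card_ffun_on card_ord.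
  have -> : bound *+ #|O| ^ r = \sum_(v : V)
      ((#|O|%:R * expR (2 * eta ^+ 2)) ^+ r + (#|O|%:R * expR (2 * eta ^+ 2)) ^+ r).
    rewrite sumr_const -[LHS]mulr_natl -[RHS]mulr_natl natrX exprMn /bound; ring.
  apply: ler_sum => v _; rewrite big_split /=.
  have H (B : V -> R) : (forall u, `|B u| <= 1) -> \sum_(u in O) B u = 0 ->
      \sum_(f in ffun_on (mem O)) \prod_(t < r) expR (eta * B (f t)) <=
      (#|O|%:R * expR (2 * eta ^+ 2)) ^+ r.
    move=> B1 B0.
    rewrite -(bigA_distr_big _ (fun=> fun u => expR (eta * B u))) prodr_const card_ord.
    rewrite lerXn2r ?nnegrE ?mulr_ge0 ?expR_ge0 ?sumr_ge0 // => [u _|]; first exact: expR_ge0.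
    exact: sum_expR_centred.
  apply: lerD; first exact: (H (A v)).
  apply: (H (fun u => - A v u)) => [u|]; first by rewrite normrN.
  by rewrite sumrN Asum oppr0.
exists f; first by move=> t; move/ffun_onP: fO; apply.
have bound_le : bound <= expR (4 * eta ^+ 2 * r%:R).
  have HL : #|V|%:R * 2 <= expR L.+1%:R :> R.
    rewrite -natrM; apply: (@le_trans _ _ (2 ^+ L.+1)).
      by rewrite -natrX ler_nat expnSr leq_mul2r VL.
    rewrite -[L.+1%:R]mulr1 expRM_natl lerXn2r ?nnegrE ?expR_ge0 //.
    by have := expR_ge1Dx (1 : R); lra.
  rewrite /bound -expRM_natl; apply: le_trans (ler_wpM2r (expR_ge0 _) HL) _.
  rewrite -expRD ler_expR.
  have : (8 * s ^ 2 * L.+1)%:R <= r%:R :> R by rewrite ler_nat.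
  rewrite 2!natrM natrX => Hr.
  have : (2 * eta ^+ 2) * (8 * s%:R ^+ 2 * L.+1%:R) <= 2 * eta ^+ 2 * r%:R.
    by apply: ler_wpM2l Hr; rewrite mulr_ge0 // sqr_ge0.
  have -> : (2 * eta ^+ 2) * (8 * s%:R ^+ 2 * L.+1%:R) = (eta * (4 * s%:R)) ^+ 2 * L.+1%:R by ring.
  by rewrite etas expr1n mul1r; lra.
have key (sg : bool) v : (-1) ^+ sg * \sum_(t < r) A v (f t) <= r%:R / s%:R.
  have : expR (eta * ((-1) ^+ sg * \sum_(t < r) A v (f t))) <= expR (4 * eta ^+ 2 * r%:R).
    apply: le_trans bound_le; apply: le_trans Gf; rewrite /G (bigD1 v) //=.
    rewrite -[X in X <= _]addr0; apply: lerD; last first.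
      by apply: sumr_ge0 => u _; apply: addr_ge0; apply: prodr_ge0 => t _; apply: expR_ge0.
    rewrite -!expR_sum -!mulr_sumr sumrN.
    by case: sg; rewrite ?expr0 ?expr1 ?mulN1r ?mul1r;
      [rewrite lerDr|rewrite lerDl]; apply: expR_ge0.
  rewrite ler_expR expr2 (_ : 4 * (eta * eta) * r%:R = eta * (4 * eta * r%:R)); last by ring.
  rewrite ler_pM2l // => /le_trans; apply.
  rewrite ler_pdivlMr ?(lt_le_trans ltr01) //.
  have -> : 4 * eta * r%:R * s%:R = eta * (4 * s%:R) * r%:R by ring.
  by rewrite etas mul1r.
move=> v; set D := \sum_(u in O) w u v.
have -> : #|O|%:R / r%:R * (\sum_(t < r) w (f t) v) - D =
    #|O|%:R / r%:R * \sum_(t < r) A v (f t).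
  rewrite /A big_split /= sumr_const card_ord -/D -[_ *+ r]mulr_natl.
  by field; rewrite !gt_eqF.
have kr0 : 0 <= #|O|%:R / r%:R :> R by rewrite divr_ge0 // ltW.
have E : #|O|%:R / s%:R = #|O|%:R / r%:R * (r%:R / s%:R) :> R.
  by field; rewrite !gt_eqF //; lra.
rewrite E normrM ger0_norm // ler_wpM2l // ler_norml.
have := key false v; have := key true v; rewrite expr0 expr1 mulN1r mul1r.
by move=> ? ?; apply/andP; split; lra.
Qed.
End Sparsification.

(** * The greedy potential and the rounding *)

Section Potential.
Variables (R : realType) (V : finType) (h : {set V} -> R) (w : V -> V -> R).
Hypotheses (h0 : forall X, 0 <= h X) (hm : monotone_setfun h) (hs : submodular h).
Hypotheses (w01 : forall u v, 0 <= w u v <= 1) (wC : forall u v, w u v = w v u).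
Hypothesis wvv : forall v, w v v = 0.

Definition quad (z : V -> R) : R := \sum_u \sum_v z u * z v * w u v.

Definition pairs (X : {set V}) : R := \sum_(u in X) \sum_(v in X) w u v.

Lemma pairs_quad X : pairs X = quad (fun v => (v \in X)%:R).
Proof.
rewrite /pairs big_mkcond; apply: eq_bigr => u _; case: (u \in X); last first.
  by rewrite big1 // => v _; rewrite !mul0r.
rewrite big_mkcond; apply: eq_bigr => v _.
by case: (v \in X); rewrite ?mul1r ?mulr0 ?mul0r.
Qed.

Lemma mean_pairs p : mean p pairs = quad p.
Proof.
rewrite /quad (@mean_eq _ _ _ _ (fun X => \sum_u \sum_v w u v * ((u \in X) && (v \in X))%:R)).
  rewrite mean_sum; apply: eq_bigr => u _; rewrite mean_sum; apply: eq_bigr => v _.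
  have [->|uv] := eqVneq u v.
    by rewrite wvv mulr0 -[RHS](mean_const p); apply: mean_eq => X; rewrite mul0r.
  have -> : p u * p v * w u v = w u v * (p u * p v) + 0 by ring.
  rewrite -(mean_pair p uv) -[X in _ + X](mean_const p) -mean_lin.
  by apply: mean_eq => X; rewrite addr0.
move=> X; rewrite pairs_quad; apply: eq_bigr => u _; apply: eq_bigr => v _.
by case: (u \in X); case: (v \in X); rewrite ?mulr1 ?mulr0 ?mul1r ?mul0r.
Qed.

Lemma quad_scale a z : quad (fun v => a * z v) = a ^+ 2 * quad z.
Proof.
rewrite /quad mulr_sumr; apply: eq_bigr => u _; rewrite mulr_sumr.
by apply: eq_bigr => v _; ring.
Qed.

Lemma quad_ge0 z : (forall v, 0 <= z v) -> 0 <= quad z.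
Proof.
move=> z0; apply: sumr_ge0 => u _; apply: sumr_ge0 => v _.
by rewrite !mulr_ge0 //; case/andP: (w01 u v).
Qed.

Lemma quad_step z (Z : {set V}) : 
  quad z + 2 * \sum_(v in Z) \sum_u z u * w u v <=
  quad (fun v => z v + (v \in Z)%:R).
Proof.
pose e v : R := (v \in Z)%:R.
have E : quad (fun v => z v + e v) =
    quad z + (\sum_u \sum_v z u * e v * w u v + \sum_u \sum_v e u * z v * w u v) + quad e.
  rewrite /quad -!big_split; apply: eq_bigr => u _ /=; rewrite -!big_split.
  by apply: eq_bigr => v _ /=; ring.
rewrite E.
have -> : \sum_u \sum_v e u * z v * w u v = \sum_u \sum_v z u * e v * w u v.
  rewrite exchange_big; apply: eq_bigr => u _; apply: eq_bigr => v _.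
  by rewrite (wC v u); ring.
have -> : \sum_u \sum_v z u * e v * w u v = \sum_(v in Z) \sum_u z u * w u v.
  rewrite exchange_big [RHS]big_mkcond; apply: eq_bigr => v _ /=; rewrite /e.
  case: (v \in Z); last by rewrite big1 // => u _; rewrite mulr0 mul0r.
  by apply: eq_bigr => u _; rewrite mulr1.
have : 0 <= quad e by apply: quad_ge0 => v.
lra.
Qed.

Variables (N k : nat) (y : V -> R) (O : {set V}) (B E tau : R).
Hypotheses (gainB : forall X v, gain h X v <= B) (N0 : (0 < N)%N) (kO : #|O| = k).
Hypotheses (yE : forall u, `|y u - \sum_(v in O) w u v| <= E) (tau0 : 0 < tau).
Hypothesis B0 : 0 <= B.

Definition fractional (c : V -> nat) : V -> R := fun v => N%:R^-1 * (c v)%:R.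
(** Discount for reward gained early: every later step closes a fraction 1/N of the gap to [h O], so
    only the fraction 1 - 1/N of a present gain survives it. *)
Definition alpha (j : nat) : R := (1 - N%:R^-1) ^+ (N - j).
(** The density factor for sums over ordered pairs, which meet each edge twice. Division by zero
    makes it 0 for [k <= 1], where densities vanish too. *)
Definition kap : R := 1 / (k%:R * (k%:R - 1)).

(** [N ^ 2] times the contribution of [v] to the linearised increase of [potential], with [acc] in
    the place of [N * mgain]. *)
Definition score (j : nat) (acc : V -> R) (c : V -> nat) (v : V) : R :=
  alpha j.+1 * acc v +
  2 * kap * (\sum_u (c u)%:R * w u v + (N - j - 1)%N%:R * y v).

(** In order: use of [y] instead of the degrees into [O]; second-order loss of [mean_step]; the
    constant part of the AM-GM bound on the gradient noise; its square part, at an expected squared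
    error of [N * B ^ 2] per vertex. *)
Definition step_error : R := 2 * kap * k%:R * E / N%:R + k%:R ^+ 2 * B / N%:R ^+ 2 +
  #|V|%:R * tau / (2 * N%:R ^+ 2) + #|V|%:R * B ^+ 2 / (2 * tau * N%:R).

(* With m = N - j steps to go, the fractional solution fractional c is worth
   h-part + pairs already formed + pairs that m further copies of O would
   form, the latter being estimated through y. *)
Definition potential (j : nat) (c : V -> nat) : R :=
  alpha j * mean (fractional c) h +
  kap / N%:R ^+ 2 *
    (quad (fun v => (c v)%:R) + 2 * (N - j)%N%:R * \sum_v (c v)%:R * y v) +
  (1 - alpha j) * h O +
  kap / N%:R ^+ 2 * ((N - j)%N%:R * ((N - j)%N%:R - 1)) * (pairs O - k%:R * E) -
  (N - j)%N%:R * step_error.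

Lemma kap_ge0 : 0 <= kap.
Proof.
rewrite /kap; case: (k) => [|[|m]]; rewrite ?mul0r ?subrr ?mulr0 ?invr0 ?mulr0 //.
by rewrite divr_ge0 // mulr_ge0 // subr_ge0 ler1n.
Qed.

Lemma alpha_range j : 0 <= alpha j <= 1.
Proof.
have N1 : 1 <= N%:R :> R by rewrite ler1n.
have i1 : N%:R^-1 <= 1 :> R by rewrite invf_le1 // (lt_le_trans ltr01).
have i0 : 0 <= N%:R^-1 :> R by rewrite invr_ge0.
rewrite /alpha exprn_ge0 /=; last lra.
by apply: exprn_ile1; lra.
Qed.

Lemma alphaS j : (j < N)%N -> alpha j = alpha j.+1 * (1 - N%:R^-1).
Proof. by move=> jN; rewrite /alpha -exprSr -subSn. Qed.

(** Nothing is random here: the squared gradient error stays on the right, and the extra term on the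
    left is a bound for its mean. With [m = N - j - 1], the degrees of [O] towards [c] make up for
    the factor of the cross term falling from [m + 1] to [m], and [2 * m] times the [y]-mass of [O]
    makes up for [(m + 1) * m] falling to [m * (m - 1)]. *)
Lemma potential_step j acc c (Z : {set V}) : (j < N)%N ->
  (forall v, (c v <= j)%N) -> (\sum_v c v = j * k)%N -> #|Z| = k ->
  \sum_(v in O) score j acc c v <= \sum_(v in Z) score j acc c v ->
  potential j c + #|V|%:R * B ^+ 2 / (2 * tau * N%:R) <=
  potential j.+1 (fun v => c v + (v \in Z))%N +
    (2 * tau * N%:R ^+ 2)^-1 * \sum_v (acc v - N%:R * mgain h (fractional c) v) ^+ 2.
Proof.
move=> jN cj csum kZ topZ.
have NR : 0 < N%:R :> R by rewrite ltr0n.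
set iN : R := N%:R^-1.
have iN0 : 0 < iN by rewrite invr_gt0.
have iNN : iN * N%:R = 1 by rewrite mulVf ?gt_eqF.
set m := (N - j - 1)%N.
have Em : (N - j)%N%:R = m%:R + 1 :> R by rewrite natr1 /m; congr (_%:R); lia.
have Em1 : (N - j.+1)%N = m by rewrite /m; lia.
set x := fractional c; set c' := fun v => (c v + (v \in Z))%N.
have x01 : unit_range x.
  move=> v; rewrite /x /fractional mulr_ge0 ?(ltW iN0) //= -/iN.
  rewrite -(ler_pM2r NR) mul1r mulrAC iNN mul1r ler_nat.
  by apply: leq_trans (cj v) (ltnW jN).
have xZ v : v \in Z -> x v + iN <= 1.
  move=> _; rewrite /x /fractional -/iN -[X in _ + X]mulr1 -mulrDr -(ler_pM2r NR) mul1r mulrAC iNN mul1r.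
  by rewrite natr1 ler_nat; apply: leq_ltn_trans (cj v) jN.
have step1 := mean_step hm gainB x01 (ltW iN0) xZ.
have x'E : mean (fun v => x v + iN * (v \in Z)%:R) h = mean (fractional c') h.
  by apply: lmean_eqp => v _; rewrite /fractional /c' natrD mulrDr.
rewrite x'E kZ in step1.
have step2 := sum_mgain hm hs O x01.
have step8 := quad_step (fun v => (c v)%:R) Z.
have c'E : quad (fun v => (c v)%:R + (v \in Z)%:R) = quad (fun v => (c' v)%:R).
  by apply: eq_bigr => u _; apply: eq_bigr => v _; rewrite /c' !natrD.
rewrite c'E in step8.
have cy'E : \sum_v (c' v)%:R * y v = \sum_v (c v)%:R * y v + \sum_(v in Z) y v.
  rewrite [X in _ + X]big_mkcond -big_split; apply: eq_bigr => v _ /=.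
  by rewrite /c' natrD mulrDl; case: (v \in Z); rewrite ?mul1r ?mul0r.
have scoreE (S : {set V}) : \sum_(v in S) score j acc c v =
    alpha j.+1 * \sum_(v in S) acc v + 2 * kap *
    (\sum_(v in S) \sum_u (c u)%:R * w u v + m%:R * \sum_(v in S) y v).
  by rewrite /score big_split /= -mulr_sumr -mulr_sumr big_split /= -mulr_sumr.
rewrite !scoreE in topZ.
pose e v := acc v - N%:R * mgain h x v.
have accE (S : {set V}) : \sum_(v in S) acc v = \sum_(v in S) e v + N%:R * \sum_(v in S) mgain h x v.
  by rewrite mulr_sumr -big_split; apply: eq_bigr => v _; rewrite /e /=; ring.
rewrite !accE in topZ.
set eZ := \sum_(v in Z) e v in topZ; set eO := \sum_(v in O) e v in topZ.
set GZ := \sum_(v in Z) mgain h x v in topZ step1; set GO := \sum_(v in O) mgain h x v in topZ step2.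
set AZ := \sum_(v in Z) \sum_u _ in topZ step8; set AO := \sum_(v in O) \sum_u _ in topZ.
set yZ := \sum_(v in Z) y v in topZ cy'E; set yO := \sum_(v in O) y v in topZ.
set cy := \sum_v (c v)%:R * y v in cy'E *.
set a := alpha j.+1 in topZ; have /andP[a0 a1] : 0 <= a <= 1 := alpha_range j.+1.
set F := mean x h in step1 step2; set F' := mean (fractional c') h in step1.
have kp0 := kap_ge0.
(* Weighted AM-GM replaces each error by its square, the only moment that sampling controls. A
   vertex counts at most once, through [Z] alone or [O] alone. *)
have noise : eZ - eO <= (2 * tau)^-1 * \sum_v e v ^+ 2 + #|V|%:R * tau / 2.
  have -> : #|V|%:R * tau / 2 = \sum_(v : V) (tau / 2).
    by rewrite sumr_const -[RHS]mulr_natl mulrA.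
  rewrite mulr_sumr -big_split /= /eZ /eO [\sum_(v in Z) _]big_mkcond [\sum_(v in O) _]big_mkcond -sumrB /=; apply: ler_sum => v _.
  have H : `|e v| <= (2 * tau)^-1 * e v ^+ 2 + tau / 2.
    rewrite -(ler_pM2l (_ : 0 < 2 * tau)); last by rewrite mulr_gt0.
    rewrite mulrDr mulrA mulfV ?mul1r; last by rewrite mulf_neq0 ?gt_eqF.
    rewrite -[e v ^+ 2]real_normK ?num_real //.
    have := sqr_ge0 (`|e v| - tau); nra.
  have := ler_norm (e v); have := ler_norm (- e v); rewrite normrN.
  have := normr_ge0 (e v).
  by case: (v \in Z); case: (v \in O); lra.
have noise0 : 0 <= (2 * tau)^-1 * \sum_v e v ^+ 2 + #|V|%:R * tau / 2.
  by rewrite addr_ge0 ?divr_ge0 ?mulr_ge0 ?invr_ge0 ?sumr_ge0 ?(ltW tau0) // => [|v _];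
    rewrite ?sqr_ge0 // mulr_ge0 // ltW.
have anoise : a * (eZ - eO) <= (2 * tau)^-1 * \sum_v e v ^+ 2 + #|V|%:R * tau / 2.
  by apply: le_trans (ler_wpM2l a0 noise) _; rewrite ler_piMl.
set NS := _ + #|V|%:R * tau / 2 in anoise.
have E0 : 0 <= k%:R * E.
  case: (posnP k) => [->|k0]; first by rewrite mul0r.
  have /card_gt0P[o _] : (0 < #|O|)%N by rewrite kO.
  by rewrite mulr_ge0 //; apply: le_trans (yE o); apply: normr_ge0.
(* After exchanging the sums, each [u] is weighted by its degree into [O], which [y u] approximates
   up to [E]; the total weight of [c] is [j * k]. *)
have stepA : cy - j%:R * k%:R * E <= AO.
  rewrite /AO exchange_big /=.
  have -> : j%:R * k%:R * E = \sum_u (c u)%:R * E.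
    by rewrite -mulr_suml -natr_sum csum natrM.
  rewrite /cy -sumrB; apply: ler_sum => u _; rewrite -mulrBr -mulr_sumr ler_wpM2l //.
  by have := yE u; rewrite ler_norml => /andP[_]; lra.
have stepY : pairs O - k%:R * E <= yO.
  rewrite /pairs /yO -kO mulr_natl -sumr_const -sumrB; apply: ler_sum => u _.
  by have := yE u; rewrite ler_norml => /andP[+ _]; lra.
set D := pairs O - k%:R * E in stepY *.
have jR : j%:R <= N%:R :> R by rewrite ler_nat ltnW.
have sumE : (2 * tau * N%:R ^+ 2)^-1 * \sum_v (acc v - N%:R * mgain h x v) ^+ 2 =
    iN ^+ 2 * ((2 * tau)^-1 * \sum_v e v ^+ 2).
  by rewrite [RHS]mulrA; congr (_ * _); rewrite /iN invfM mulrC exprVn.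
rewrite sumE /potential Em Em1 -/x -/F -/F' -/c' cy'E -/cy (alphaS jN) -/a -/iN.
set q := quad (fun v => (c v)%:R) in step8 *; set q' := quad (fun v => (c' v)%:R) in step8 *.
have -> : kap / N%:R ^+ 2 = iN ^+ 2 * kap by rewrite exprVn mulrC.
have errE : step_error = 2 * kap * k%:R * E * iN + iN ^+ 2 * (k%:R ^+ 2 * B) +
    iN ^+ 2 * (#|V|%:R * tau / 2) + #|V|%:R * B ^+ 2 / (2 * tau * N%:R).
  by rewrite /step_error /iN; field; rewrite !gt_eqF.
rewrite errE; set X := #|V|%:R * B ^+ 2 / _.
have i20 : 0 <= iN ^+ 2 by rewrite sqr_ge0.
have e1 : a * (iN * GZ) - iN ^+ 2 * (k%:R ^+ 2 * B) <= a * (F' - F).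
  have : a * (iN * GZ - (iN * k%:R) ^+ 2 * B) <= a * (F' - F) by apply: ler_wpM2l => //; lra.
  have : a * (iN ^+ 2 * (k%:R ^+ 2 * B)) <= iN ^+ 2 * (k%:R ^+ 2 * B).
    by apply: ler_piMl => //; apply: mulr_ge0 => //; apply: mulr_ge0 => //; apply: sqr_ge0.
  by rewrite exprMn -mulrA mulrBr; lra.
have e2 : a * iN * (h O - F) <= a * iN * GO by rewrite ler_wpM2l // mulr_ge0 // ltW.
have e3 : iN ^+ 2 * (a * eO) + a * iN * GO + iN ^+ 2 * (2 * kap * (AO + m%:R * yO)) <=
   iN ^+ 2 * (a * eZ) + a * iN * GZ + iN ^+ 2 * (2 * kap * (AZ + m%:R * yZ)).
  have : iN ^+ 2 * (a * (eO + N%:R * GO) + 2 * kap * (AO + m%:R * yO)) <=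
     iN ^+ 2 * (a * (eZ + N%:R * GZ) + 2 * kap * (AZ + m%:R * yZ)) by apply: ler_wpM2l.
  have H G t' e' : iN ^+ 2 * (a * (e' + N%:R * G) + t') =
     iN ^+ 2 * (a * e') + (iN * N%:R) * (a * iN * G) + iN ^+ 2 * t' by ring.
  by rewrite !H iNN !mul1r.
have e4 : iN ^+ 2 * (a * (eZ - eO)) <= iN ^+ 2 * NS by apply: ler_wpM2l.
have ik0 : 0 <= iN ^+ 2 * kap by apply: mulr_ge0.
have e5 : iN ^+ 2 * kap * (cy - j%:R * k%:R * E) <= iN ^+ 2 * kap * AO by apply: ler_wpM2l.
have e6 : iN ^+ 2 * kap * (m%:R * D) <= iN ^+ 2 * kap * (m%:R * yO).
  by apply: ler_wpM2l => //; apply: ler_wpM2l.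
have e7 : iN ^+ 2 * kap * (q + 2 * AZ) <= iN ^+ 2 * kap * q' by apply: ler_wpM2l.
have e8 : iN ^+ 2 * kap * (j%:R * k%:R * E) <= kap * k%:R * E * iN.
  have -> : kap * k%:R * E * iN = iN ^+ 2 * kap * (N%:R * k%:R * E).
    transitivity (iN * N%:R * (iN * kap * (k%:R * E))); last by ring.
    by rewrite iNN; ring.
  by apply: ler_wpM2l => //; rewrite -!mulrA; apply: ler_wpM2r.
move: e1 e2 e3 e4 e5 e6 e7 e8; rewrite /NS.
rewrite !(mulrDr, mulrBr, mulrDl, mulrBl, mulr1, mul1r, mulNr, mulrN).
set mm := m%:R.
lra.
Qed.

(** [alpha 0 <= 1/e] because [1 - 1/N <= expR (- 1/N)]. Only the [N * (N - 1)] ordered pairs of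
    distinct copies of [O] count, whence the factor 1 - 1/N. *)
Lemma potential0 c : (forall v, c v = 0%N) ->
  (1 - (expR 1)^-1) * h O + (1 - N%:R^-1) * (kap * (pairs O - k%:R * E)) - N%:R * step_error
  <= potential 0 c.
Proof.
move=> c0; rewrite /potential subn0.
have NR : 0 < N%:R :> R by rewrite ltr0n.
have -> : quad (fun v => (c v)%:R) = 0.
  by apply: big1 => u _; apply: big1 => v _; rewrite c0 !mul0r.
have -> : \sum_v (c v)%:R * y v = 0 by apply: big1 => u _; rewrite c0 mul0r.
have /andP[a0 a1] := alpha_range 0.
have : 0 <= mean (fractional c) h.
  rewrite -(mean_const (fractional c) 0); apply: mean_le => // v.
  by rewrite /fractional c0 mulr0 lexx ler01.
move=> /(mulr_ge0 a0).
have : alpha 0 <= (expR 1)^-1.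
  rewrite /alpha subn0 -expRN.
  have <- : expR (- N%:R^-1) ^+ N = expR (- 1) :> R.
    by rewrite -expRM_natl mulrN mulfV ?gt_eqF.
  have i1 : N%:R^-1 <= 1 :> R by rewrite invf_le1 // ler1n.
  have := expR_ge1Dx (- N%:R^-1 : R) => H.
  by rewrite lerXn2r ?nnegrE ?expR_ge0 // subr_ge0.
move=> /(ler_wpM2r (h0 O)).
have -> : kap / N%:R ^+ 2 * (N%:R * (N%:R - 1)) * (pairs O - k%:R * E) =
   (1 - N%:R^-1) * (kap * (pairs O - k%:R * E)) by field; rewrite gt_eqF.
rewrite mulr0 addr0 mulr0 addr0; lra.
Qed.

Lemma potentialN c : potential N c = mean (fractional c) h + kap * quad (fractional c).
Proof.
have NR : 0 < N%:R :> R by rewrite ltr0n.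
rewrite /potential subnn /alpha subnn expr0 quad_scale exprVn; ring.
Qed.

End Potential.

(** An element of [Z :\: O] is outside [I], hence at least as good as every element of [O :\: Z].
    The two differences have equal size, so the best element of [O :\: Z] separates their sums. *)
Lemma top_sum (R : realType) (V : finType) (I O Z : {set V}) (f : V -> R) :
  I \subset O -> #|O| = #|Z| ->
  (forall u v, u \in Z -> u \notin I -> v \notin Z -> f v <= f u) ->
  \sum_(v in O) f v <= \sum_(v in Z) f v.
Proof.
move=> sIO eOZ H.
rewrite (big_setID Z) /= [X in _ <= X](big_setID O) /= setIC lerD2l.
have eD : #|O :\: Z| = #|Z :\: O|.
  by apply/eqP; rewrite -(eqn_add2l #|O :&: Z|) cardsID setIC cardsID eOZ.
case: (set_0Vmem (O :\: Z)) => [E|[v0 v0D]].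
  by rewrite E cards0 in eD *; rewrite big_set0 (cards0_eq (esym eD)) big_set0.
case: (arg_maxP f v0D) => v vD vmax.
apply: (@le_trans _ _ (\sum_(u in O :\: Z) f v)); first by apply: ler_sum => u /vmax.
rewrite sumr_const eD -sumr_const; apply: ler_sum => u; rewrite inE => /andP[uO uZ].
have /setDP[_ vZ] : v \in O :\: Z := vD; apply: H => //.
by apply: contra uO; apply: (subsetP sIO).
Qed.

(** * Independent rounding and the repair of the size *)

Section Rounding.
Variables (R : realType) (V : finType) (h : {set V} -> R) (w : V -> V -> R).
Hypotheses (h0 : forall X, 0 <= h X) (hm : monotone_setfun h).
Hypotheses (w01 : forall u v, 0 <= w u v <= 1).
Hypothesis wvv : forall v, w v v = 0.
Variables (I : {set V}) (k : nat).
Local Notation kapk := (kap R k).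

Definition resized (X T : {set V}) : Prop :=
  [/\ I \subset T, #|T| = k, ((#|X| <= k)%N -> X \subset T) &
      ((k <= #|X|)%N -> T \subset X /\
         (k - #|I|)%:R * h X <= (#|X| - #|I|)%:R * h T)].

Variables (H : R) (s : nat).
Hypotheses (H0 : 0 <= H) (s0 : (0 < s)%N) (Ik : (#|I| < k)%N).

Definition kp : R := (k - #|I|)%:R.
(** Price of one surplus vertex: the reward lost by shrinking plus the first-order loss in
    density. *)
Definition slope : R := H / kp + 2 * kapk * k%:R.
Lemma kp_gt0 : 0 < kp.
Proof. by rewrite ltr0n subn_gt0. Qed.

Lemma slope_ge0 : 0 <= slope.
Proof.
apply: addr_ge0; first by apply: divr_ge0 => //; apply/ltW/kp_gt0.
by apply: mulr_ge0 => //; apply: mulr_ge0 => //; apply: kap_ge0.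
Qed.

(** Designed as a lower bound for the value after resizing. It is quadratic in the deviation of the
    size, so its mean needs only a variance. The coefficients come from AM-GM applied to [slope]
    times the deviation, which is tight at [kp / s]. *)
Definition rounded (X : {set V}) : R :=
  h X + kapk * pairs w X -
  ((s%:R / (2 * kp) * slope + kapk) * (#|X|%:R - k%:R) ^+ 2 + kp / (2 * s%:R) * slope).

Lemma pairs_mono (X T : {set V}) : X \subset T -> pairs w X <= pairs w T.
Proof.
move=> sXT; rewrite !pairs_quad; apply: ler_sum => u _; apply: ler_sum => v _.
have /andP[w0 _] := w01 u v; apply: ler_wpM2r => //.
have le x : (x \in X)%:R <= (x \in T)%:R :> R.
  by case: (boolP (x \in X)) => [/(subsetP sXT)->|_].
by apply: ler_pM.
Qed.

Lemma pairs_remove (X T : {set V}) : T \subset X ->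
  pairs w X - pairs w T <= #|X|%:R ^+ 2 - #|T|%:R ^+ 2.
Proof.
move=> sTX.
have E (S : {set V}) : #|S|%:R ^+ 2 = \sum_u \sum_v (u \in S)%:R * (v \in S)%:R :> R.
  under eq_bigr do rewrite -mulr_sumr.
  by rewrite -mulr_suml -natr_sum -expr2 -sum1_card [in LHS]big_mkcond;
    congr (_%:R ^+ 2); apply: eq_bigr => u _; case: (u \in S).
rewrite !pairs_quad !E /quad -!sumrB; apply: ler_sum => u _; rewrite -!sumrB.
apply: ler_sum => v _; have /andP[w0 w1] := w01 u v; rewrite -mulrBl ler_piMr //.
rewrite subr_ge0; apply: ler_pM => //; case: (boolP (_ \in T)) => //.
- by move/(subsetP sTX)->.
- by move/(subsetP sTX)->.
Qed.

(** Growing loses nothing, so only a surplus [a] is charged: shrinking loses at most [a * H / kp] in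
    reward and [2 * k * a + a ^ 2] in ordered pairs. *)
Lemma resized_value (X T : {set V}) : I \subset X -> resized X T -> h T <= H ->
  rounded X <= h T + kapk * pairs w T.
Proof.
move=> sIX [sIT kT up down] HT.
have kp0 := kp_gt0.
have sR : 0 < s%:R :> R by rewrite ltr0n.
have kk0 := kap_ge0 R k.
have sl0 := slope_ge0.
pose a : R := #|X|%:R - k%:R.
have amgm : a <= s%:R / (2 * kp) * a ^+ 2 + kp / (2 * s%:R).
  rewrite -subr_ge0.
  have -> : s%:R / (2 * kp) * a ^+ 2 + kp / (2 * s%:R) - a =
     (s%:R * a - kp) ^+ 2 / (2 * s%:R * kp) by field; rewrite !gt_eqF.
  by rewrite divr_ge0 ?sqr_ge0 // !mulr_ge0 ?ltW.
have amgm0 : 0 <= s%:R / (2 * kp) * a ^+ 2 + kp / (2 * s%:R).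
  apply: addr_ge0; last by rewrite divr_ge0 ?mulr_ge0 ?ltW.
  by rewrite mulr_ge0 ?sqr_ge0 // divr_ge0 ?mulr_ge0 ?ltW.
have sqk : 0 <= kapk * a ^+ 2 by rewrite mulr_ge0 ?sqr_ge0.
have E : (s%:R / (2 * kp) * slope + kapk) * a ^+ 2 + kp / (2 * s%:R) * slope =
  (s%:R / (2 * kp) * a ^+ 2 + kp / (2 * s%:R)) * slope + kapk * a ^+ 2 by ring.
rewrite /rounded -/a E.
case: (leqP #|X| k) => [le_Xk|/ltnW le_kX].
  have sXT := up le_Xk.
  have : h X <= h T by apply: hm.
  have : kapk * pairs w X <= kapk * pairs w T by apply/ler_wpM2l/pairs_mono.
  have := mulr_ge0 amgm0 sl0; lra.
have [sTX hXT] := down le_kX.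
have a0 : 0 <= a by rewrite subr_ge0 ler_nat.
have aE : (#|X| - #|I|)%:R = kp + a.
  by rewrite /kp /a natrB ?subset_leq_card // natrB ?(ltnW Ik) //; ring.
rewrite aE -/kp in hXT.
have l1 : h X - h T <= a * (H / kp).
  rewrite -(ler_pM2l kp0).
  have -> : kp * (a * (H / kp)) = a * H by field; rewrite gt_eqF.
  have := ler_wpM2l a0 HT; lra.
have l2 : kapk * (pairs w X - pairs w T) <= kapk * (2 * k%:R * a + a ^+ 2).
  apply: ler_wpM2l => //; apply: le_trans (pairs_remove sTX) _.
  by rewrite kT /a le_eqVlt; apply/orP; left; apply/eqP; ring.
have l3 : a * slope <= (s%:R / (2 * kp) * a ^+ 2 + kp / (2 * s%:R)) * slope.
  exact: ler_wpM2r.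
move: l1 l2 l3; rewrite /slope; lra.
Qed.

(** Forced vertices are drawn surely, so the variance of the size is at most the mass of the others,
    [k - #|I|]. *)
Lemma mean_rounded p : unit_range p -> \sum_v p v = k%:R ->
  (forall v, v \in I -> p v = 1) ->
  mean p h + kapk * quad w p -
    ((s%:R / (2 * kp) * slope + kapk) * kp + kp / (2 * s%:R) * slope)
  <= mean p rounded.
Proof.
move=> p01 sp pI.
set c1 := s%:R / (2 * kp) * slope + kapk; set c0 := kp / (2 * s%:R) * slope.
have kp0 := kp_gt0.
have c10 : 0 <= c1.
  apply: addr_ge0; last exact: kap_ge0.
  by apply: mulr_ge0 slope_ge0; rewrite divr_ge0 // mulr_ge0 // ltW.
have -> : mean p rounded = 1 * mean p h + (kapk * mean p (pairs w) +
    (- c1 * mean p (fun X => (#|X|%:R - k%:R) ^+ 2) + - c0)).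
  rewrite -[X in _ = _ + (_ + (_ + X))](mean_const p) -!mean_lin.
  by apply: mean_eq => X; rewrite /rounded -/c1 -/c0; ring.
rewrite (mean_pairs wvv) mean_sqr_dev sp subrr expr2 mul0r add0r.
have : \sum_v p v * (1 - p v) <= kp.
  have -> : kp = \sum_v p v * (v \notin I)%:R.
    rewrite /kp natrB ?(ltnW Ik) // -sp -sum1_card natr_sum [\sum_(i in I) _]big_mkcond.
    rewrite -sumrB; apply: eq_bigr => v _.
    by case: (boolP (v \in I)) => [/pI->|_] /=; ring.
  apply: ler_sum => v _; have /andP[? ?] := p01 v.
  by case: (boolP (v \in I)) => [/pI->|_] /=; nra.
move/(ler_wpM2l c10); lra.
Qed.

(** Since [s ^ 2 <= kp], the cost is at most [kp / s * slope + kapk * kp]. As [kapk * k * kp <= 2],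
    here [kp * slope <= H + 4] and [kapk * kp <= 2 / s]. *)
Lemma rounding_error : (1 < k)%N -> (s ^ 2 <= k - #|I|)%N ->
  (s%:R / (2 * kp) * slope + kapk) * kp + kp / (2 * s%:R) * slope <= (H + 6) / s%:R.
Proof.
move=> k1 sk.
have sR : 1 <= s%:R :> R by rewrite ler1n.
have s0' : 0 < s%:R :> R by lra.
have kp0 := kp_gt0.
have skR : s%:R ^+ 2 <= kp by rewrite -natrX ler_nat.
have kR : 2 <= k%:R :> R by rewrite ler_nat.
have kpk : kp <= k%:R by rewrite ler_nat leq_subr.
have kk0 := kap_ge0 R k.
have kk : kapk * (k%:R * (k%:R - 1)) = 1.
  by rewrite /kap mul1r mulVf // mulf_neq0 // gt_eqF //; lra.
have sl0 := slope_ge0.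
have -> : (s%:R / (2 * kp) * slope + kapk) * kp + kp / (2 * s%:R) * slope =
   (s%:R / 2 + kp / (2 * s%:R)) * slope + kapk * kp by field; rewrite !gt_eqF.
have l1 : s%:R / 2 + kp / (2 * s%:R) <= kp / s%:R.
  rewrite -(ler_pM2r s0').
  have -> : (s%:R / 2 + kp / (2 * s%:R)) * s%:R = (s%:R ^+ 2 + kp) / 2 by field; rewrite gt_eqF.
  by rewrite divfK ?gt_eqF //; lra.
have := ler_wpM2r sl0 l1; move/(lerD)/(_ (lexx (kapk * kp)))/le_trans; apply.
have -> : kp / s%:R * slope = (H + 2 * (kapk * k%:R * kp)) / s%:R.
  by rewrite /slope; field; rewrite !gt_eqF.
have l2 : kapk * k%:R * kp <= 2.
  have : kapk * k%:R * kp <= kapk * k%:R * (2 * (k%:R - 1)).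
    by apply: ler_wpM2l; [rewrite mulr_ge0|lra].
  lra.
have l3 : kapk * kp <= 2 / s%:R.
  rewrite ler_pdivlMr //.
  have : kapk * kp * s%:R <= kapk * kp * k%:R.
    apply: ler_wpM2l; first by rewrite mulr_ge0 // ltW.
    by apply: le_trans kpk; apply: le_trans skR; rewrite expr2 ler_peMr //; lra.
  move: l2; lra.
rewrite !mulrDl; move: l3; set i := s%:R^-1.
have i0 : 0 < i by rewrite invr_gt0.
have := ler_wpM2r (ltW i0) l2; lra.
Qed.

End Rounding.

Section Density.
Variables (R : realType) (V : finType) (w : {set V} -> R).

Definition pair_weight (u v : V) : R := if u != v then w [set u; v] else 0.

(** Double counting: each edge inside [T] comes from exactly two ordered pairs. *)
Lemma den_pairs (k : nat) (T : {set V}) : #|T| = k ->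
  den w T = kap R k * pairs pair_weight T.
Proof.
move=> kT; rewrite /den kT /kap.
have E : pairs pair_weight T =
    2 * \sum_(e : {set V} | (e \subset T) && (#|e| == 2)%N) w e.
  rewrite mulr_sumr.
  transitivity (\sum_(e : {set V} | (e \subset T) && (#|e| == 2)%N)
     \sum_(u in e) \sum_(v in e | u != v) w e); last first.
    apply: eq_bigr => e /andP[_ e2].
    have /eqP e2' := e2; under eq_bigr => u ue.
      rewrite sumr_const (_ : #|_| = 1%N); first over.
      have := cardsD1 u e; rewrite ue e2' add1n => -[E1]; rewrite [RHS]E1.
      by apply: eq_card => v; rewrite !inE eq_sym andbC.
    by rewrite sumr_const e2' mulr2n mulr1n; ring.
  transitivity (\sum_(e : {set V} | (e \subset T) && (#|e| == 2)%N)
     \sum_u \sum_v (if [&& u \in e, v \in e & u != v] then w e else 0)); last first.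
    apply: eq_bigr => e _; rewrite [RHS]big_mkcond; apply: eq_bigr => u _.
    by case: (u \in e); [rewrite [RHS]big_mkcond|rewrite big1].
  rewrite /pairs [RHS]exchange_big /= [LHS]big_mkcond; apply: eq_bigr => u _.
  rewrite [RHS]exchange_big /=.
  case: (boolP (u \in T)) => uT; last first.
    rewrite big1 // => v _; rewrite big1 // => e /andP[sT _].
    by case: (boolP (u \in e)) => //= /(subsetP sT); rewrite (negPf uT).
  rewrite [LHS]big_mkcond; apply: eq_bigr => v _; rewrite /pair_weight.
  case: (boolP (v \in T)) => vT; last first.
    rewrite big1 // => e /andP[sT _].
    by case: (boolP (v \in e)) => [/(subsetP sT)|]; rewrite ?(negPf vT) // andbF.
  have [->|uv] := eqVneq u v; first by rewrite big1 // => e _; rewrite !andbF.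
  rewrite (bigD1 [set u; v]) /=; last first.
    by rewrite cards2 uv andbT; apply/subsetP => x /set2P[->|->].
  rewrite !inE !eqxx orbT /= big1 ?addr0 // => e /andP[/andP[_ /eqP e2] ne].
  case: ifP => // /and3P[ue ve _]; case/eqP: ne.
  apply/eqP; rewrite eq_sym eqEcard cards2 uv e2 leqnn andbT.
  by apply/subsetP => x /set2P[->|->].
by rewrite E; set S := \sum_(e | _) _; rewrite !invfM invrK; ring.
Qed.

End Density.

(** * The program *)

(* Arrays of natural numbers; array 0 holds the output, and array numbers
   from 20 on are loop counters. *)
Local Notation aR := 1%N.     (* current set *)
Local Notation aE := 2%N.     (* candidates of a maximisation *)
Local Notation aD := 3%N.     (* guessed vertices *)
Local Notation aC := 4%N.     (* numerators of the fractional solution *)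
Local Notation sBest := 5%N.
Local Notation sCnt := 6%N.
Local Notation sL := 7%N.
Local Notation sP := 8%N.
Local Notation sr := 9%N.
Local Notation sN := 10%N.
Local Notation sB := 11%N.
Local Notation sz := 12%N.
Local Notation sd := 13%N.
Local Notation sOld := 14%N.
(* Arrays of real numbers *)
Local Notation rV := 0%N.     (* scores *)
Local Notation rAcc := 1%N.
Local Notation rH := 2%N.
Local Notation rval := 3%N.
Local Notation rbest := 4%N.
Local Notation ralpha := 5%N.

Local Notation "'cell' a" := (NGet a (NLit 0)) (at level 10, a at level 9).
Local Notation "'rcell' a" := (RGet a (NLit 0)) (at level 10, a at level 9).
Local Notation "c1 ;; c2" := (Seq c1 c2) (at level 60, right associativity).
Local Notation "a '::=' e" := (SetNat a (NLit 0) e) (at level 50).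
Local Notation "a ':r=' e" := (SetReal a (NLit 0) e) (at level 50).

(** The number of vertices serves as the initial [sBest]: it is no vertex and means that no
    candidate has been met. *)
Definition argmax : cmd :=
  sBest ::= NVert ;;
  For 20 NVert
    (If (BNatLe (NGet aE (cell 20)) (NLit 0)) Skip
      (If (BAnd (BNot (BNatLe NVert (cell sBest)))
                (BRealLe (RGet rV (cell 20)) (RGet rV (cell sBest))))
        Skip (sBest ::= cell 20))).

(** Used twice: for the greedy choice, with scores in [rV], and to fill up undersized sets, where
    any filling will do. *)
Definition grow : cmd :=
  For 24 (NSub NTarget (cell sCnt))
    (For 21 NVert (SetNat aE (cell 21) (NSub (NLit 1) (NGet aR (cell 21)))) ;;
     argmax ;;
     SetNat aR (cell sBest) (NLit 1)).

Definition shrink : cmd :=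
  For 23 (NSub (cell sCnt) NTarget)
    (For 21 NVert
       (SetNat aE (cell 21) (NSub (NGet aR (cell 21)) (NForced (cell 21))) ;;
        sOld ::= NGet aR (cell 21) ;;
        SetNat aR (cell 21) (NLit 0) ;;
        Query rV (cell 21) aR ;;
        SetNat aR (cell 21) (cell sOld)) ;;
     argmax ;;
     SetNat aR (cell sBest) (NLit 0)).

Definition count_members : cmd :=
  sCnt ::= NLit 0 ;;
  For 22 NVert (sCnt ::= NAdd (cell sCnt) (NGet aR (cell 22))).

Definition rone : rexp := RNat (NLit 1).

Definition rkap : rexp :=
  RDiv rone (RMul (RNat NTarget) (RSub (RNat NTarget) rone)).

Definition value : cmd :=
  Query rval (NLit 0) aR ;;
  For 25 NVert (For 26 NVert
    (rval :r= RAdd (rcell rval)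
      (RMul rkap (RMul (RMul (RNat (NGet aR (cell 25))) (RNat (NGet aR (cell 26))))
        (RWeight (cell 25) (cell 26)))))).

Definition record : cmd :=
  If (BRealLe (rcell rval) (rcell rbest)) Skip
    (For 27 NVert (SetNat 0 (cell 27) (NGet aR (cell 27))) ;;
     rbest :r= rcell rval).

(** [sCnt] keeps the size from before [shrink], so by truncated subtraction at most one of [shrink]
    and [grow] makes any round. *)
Definition fix_record : cmd := count_members ;; shrink ;; grow ;; value ;; record.

Section Specs.
Variables (R : realType) (J : instance R) (U : nat).
Local Notation n := (nvert J).
Local Notation k := (target J).
Local Notation I := (forced J).
Local Notation h := (reward J).
Local Notation w := (pair_weight (weight J)).
Local Notation triple := (triple J U).
Local Notation memory := (memory R).
Hypothesis nU : (n <= U)%N.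

(** The constant value 0 leaves only cost and postcondition. *)
Definition ptriple c s Q := triple c s Q (fun=> 0) 0.

Lemma ptriple_of c s Q f g : triple c s Q f g -> ptriple c s Q.
Proof. by move/triple_pure; apply. Qed.

Lemma ptriple_post c s (Q Q' : memory -> Prop) : ptriple c s Q ->
  (forall s', Q s' -> Q' s') -> ptriple c s Q'.
Proof. exact: triple_post. Qed.

Lemma triple_seqp c1 c2 s (Q1 Q2 : memory -> Prop) f g : ptriple c1 s Q1 ->
  (forall s', agree c1 s s' -> Q1 s' -> triple c2 s' Q2 f g) ->
  triple (c1 ;; c2) s Q2 f g.
Proof.
move=> tr1 tr2; apply: triple_seq (triple_pure (f' := fun=> g) (triple_frame tr1) _) _ => //.
by move=> s' [Q1s' ag]; apply: tr2.
Qed.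

Lemma triple_nat_seq a i e c s Q f g :
  triple c (set_nat s a (neval J s i) (neval J s e)) Q f g ->
  triple (SetNat a i e ;; c) s Q f g.
Proof.
move=> tr; apply: (@triple_seq _ _ _ _ _ _
  (fun s' => s' = set_nat s a (neval J s i) (neval J s e)) _ (fun=> g)).
  by apply: triple_set_nat.
by move=> _ ->.
Qed.

Lemma triple_real_seq a i e c s Q f g :
  triple c (set_real s a (neval J s i) (reval J s e)) Q f g ->
  triple (SetReal a i e ;; c) s Q f g.
Proof.
move=> tr; apply: (@triple_seq _ _ _ _ _ _
  (fun s' => s' = set_real s a (neval J s i) (reval J s e)) _ (fun=> g)).
  by apply: triple_set_real.
by move=> _ ->.
Qed.

Lemma triple_query_seq a i b c s Q f g :
  triple c (set_real s a (neval J s i) (h (vertex_set J s b))) Q f g ->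
  triple (Query a i b ;; c) s Q f g.
Proof.
move=> tr; apply: (@triple_seq _ _ _ _ _ _
  (fun s' => s' = set_real s a (neval J s i) (h (vertex_set J s b))) _ (fun=> g)).
  by apply: triple_query.
by move=> _ ->.
Qed.

Lemma ptriple_for i e c s b (Inv : nat -> memory -> Prop) :
  (b <= U)%N -> Inv 0%N (set_nat s i 0 0) ->
  (forall j s', agree (For i e c) s s' -> (j <= b)%N -> Inv j s' ->
     nmem s' i 0 = j -> neval J s' e = b) ->
  (forall j s', agree (For i e c) s s' -> (j < b)%N -> Inv j s' ->
     nmem s' i 0 = j ->
     ptriple c s' (fun s'' => nmem s'' i 0 = j /\ Inv j.+1 (set_nat s'' i 0 j.+1))) ->
  ptriple (For i e c) s (fun s' => Inv b s').
Proof.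
move=> bU I0 He Hc.
apply: ptriple_post (triple_for (phi := fun _ _ => 0) bU I0 He Hc) _.
by move=> s' [].
Qed.

Lemma ptriple_forv i c s (Inv : nat -> memory -> Prop) :
  Inv 0%N (set_nat s i 0 0) ->
  (forall (v : 'I_n) s', agree (For i NVert c) s s' -> Inv v s' ->
     nmem s' i 0 = v ->
     ptriple c s' (fun s'' => nmem s'' i 0 = v /\ Inv v.+1 (set_nat s'' i 0 v.+1))) ->
  ptriple (For i NVert c) s (fun s' => Inv n s').
Proof.
by move=> I0 Hc; apply: ptriple_for => // j s' ag jn; apply: (Hc (Ordinal jn)).
Qed.

Lemma fill_spec i a e s (F : nat -> nat) : i != a ->
  (forall (v : 'I_n) s', agree (For i NVert (SetNat a (cell i) e)) s s' ->
     (forall l, (v <= l)%N -> nmem s' a l = nmem s a l) ->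
     nmem s' i 0 = v -> neval J s' e = F v) ->
  ptriple (For i NVert (SetNat a (cell i) e)) s
    (fun s' => forall v, (v < n)%N -> nmem s' a v = F v).
Proof.
move=> ia He.
apply: ptriple_post (@ptriple_forv _ _ _ (fun j s' =>
  (forall v, (v < j)%N -> nmem s' a v = F v) /\
  (forall v, (j <= v)%N -> nmem s' a v = nmem s a v)) _ _) _.
- split=> // v _; by rewrite /= /update eq_sym (negPf ia).
- move=> v s' ag [H1 H2] Ei; apply: triple_set_nat => //=.
  rewrite Ei (He v) // /update (negPf ia) /=; split=> //; split=> l; rewrite eq_sym (negPf ia) eqxx /=.
    by rewrite ltnS leq_eqVlt; case: eqP => [->|_] //= /H1.
  by move=> vl; rewrite gtn_eqF // H2 // ltnW.
by move=> s' [].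
Qed.

(** Stricter than [vertex_set], which only tests for nonzero entries: counting and [value] use the
    entries as numbers 0 and 1. *)
Definition reps (s : memory) (a : nat) (X : {set 'I_n}) : Prop :=
  forall v : 'I_n, nmem s a v = (v \in X).

Lemma vertex_set_reps s a X : reps s a X -> vertex_set J s a = X.
Proof. by move=> rX; apply/setP => v; rewrite inE rX; case: (v \in X). Qed.

Lemma read_weightE (u v : 'I_n) : read_weight J u v = w u v.
Proof. by rewrite /read_weight !valK. Qed.

Lemma argmax_spec s : (exists v : 'I_n, nmem s aE v != 0%N) ->
  ptriple argmax s (fun s' => exists b : 'I_n, [/\ nmem s' sBest 0 = b,
    nmem s aE b != 0%N &
    forall u : 'I_n, nmem s aE u != 0%N -> rmem s rV u <= rmem s rV b]).
Proof.
move=> [v0 Ev0]; apply: triple_nat_seq; set s1 := set_nat _ _ _ _.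
pose Inv (j : nat) (s' : memory) :=
  (nmem s' sBest 0 = n /\ forall u : 'I_n, (u < j)%N -> nmem s aE u = 0%N) \/
  (exists b : 'I_n, [/\ nmem s' sBest 0 = b, nmem s aE b != 0%N &
    forall u : 'I_n, (u < j)%N -> nmem s aE u != 0%N -> rmem s rV u <= rmem s rV b]).
apply: ptriple_post (@ptriple_forv _ _ _ Inv _ _) _; first by left.
- move=> v s' [an ar] Hinv Ei.
  have EE l : nmem s' aE l = nmem s aE l by rewrite (an aE l isT).
  have EV l : rmem s' rV l = rmem s rV l by rewrite (ar rV l isT).
  apply: triple_if; rewrite /= Ei EE.
  case: (posnP (nmem s aE v)) => [Ev|Ev].
    rewrite Ev leqnn; apply: triple_skip => //; split=> //; case: Hinv => [[Eb H]|[b [Eb Hb H]]].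
      left; split=> // u; rewrite ltnS leq_eqVlt => /orP[/eqP uv|/H//].
      by rewrite (ord_inj uv).
    right; exists b; split=> // u; rewrite ltnS leq_eqVlt => /orP[/eqP uv|/H//].
    by rewrite (ord_inj uv) Ev.
  rewrite leqNgt Ev /=; apply: triple_if; rewrite /= Ei !EV.
  case: Hinv => [[Eb H]|[b [Eb Hb H]]].
    rewrite Eb leqnn /=; apply: triple_set_nat => //=; rewrite Ei; split=> //.
    right; exists v; split=> //; first by rewrite -lt0n.
    move=> u; rewrite ltnS leq_eqVlt => /orP[/eqP uv|/H->//].
    by rewrite (ord_inj uv).
  rewrite Eb leqNgt ltn_ord /=; case: ifP => le_v.
    apply: triple_skip => //; split=> //; right; exists b; split=> // u.
    rewrite ltnS leq_eqVlt => /orP[/eqP uv _|/H//].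
    by rewrite (ord_inj uv).
  apply: triple_set_nat => //=; rewrite Ei; split=> //; right; exists v; split=> //.
    by rewrite -lt0n.
  move/negbT: le_v; rewrite -ltNge => /ltW le_b u.
  rewrite ltnS leq_eqVlt => /orP[/eqP uv _|/H Hu /Hu/le_trans-> //].
  by rewrite (ord_inj uv).
move=> s' [[_ H]|[b [Eb Hb H]]]; first by move: Ev0; rewrite H.
by exists b; split=> // u; apply: H.
Qed.

Lemma reps_set (s : memory) (b : 'I_n) (X : {set 'I_n}) : reps s aR X ->
  reps (set_nat s aR b 1) aR (b |: X).
Proof.
move=> rX v; rewrite /= /update /= rX !inE.
by rewrite -[val v == val b]/(v == b); case: eqP.
Qed.

Lemma reps_unset (s : memory) (b : 'I_n) (X : {set 'I_n}) : reps s aR X ->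
  reps (set_nat s aR b 0) aR (X :\ b).
Proof.
move=> rX v; rewrite /= /update /= rX !inE.
by rewrite -[val v == val b]/(v == b); case: eqP.
Qed.

Lemma grow_spec s X : (k <= U)%N -> reps s aR X ->
  (#|X| + (k - nmem s sCnt 0) <= n)%N ->
  ptriple grow s (fun s' => exists X', [/\ reps s' aR X', X \subset X',
    #|X'| = (#|X| + (k - nmem s sCnt 0))%N &
    forall u v, u \in X' -> u \notin X -> v \notin X' -> rmem s rV v <= rmem s rV u]).
Proof.
move=> kU rX cX.
pose Inv (t : nat) (s' : memory) := exists X', [/\ reps s' aR X', X \subset X',
    #|X'| = (#|X| + t)%N &
    forall u v, u \in X' -> u \notin X -> v \notin X' -> rmem s rV v <= rmem s rV u].
apply: (@ptriple_for _ _ _ _ _ Inv).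
- by apply: leq_trans kU; apply: leq_subr.
- by exists X; rewrite addn0; split=> // u v ->.
- by move=> j s' [an _] _ _ _ /=; rewrite (an sCnt 0%N isT).
move=> j s' [an ar] jb [X' [rX' sX cX' HX']] Ej.
apply: triple_seqp (@fill_spec 21 aE _ s' (fun v => 1 - nmem s' aR v)%N isT _) _.
  by move=> v s2 [an2 _] _ Ev /=; rewrite Ev (an2 aR _ isT).
move=> s2 [an2 ar2] E2.
have [v vX'] : exists v, v \notin X'.
  apply/existsP; apply: contraLR (leq_trans (_ : #|X'| < _)%N cX); last by rewrite cX' ltn_add2l.
  rewrite negb_exists => /forallP H; rewrite -leqNgt.
  rewrite (_ : X' = setT) ?cardsT ?card_ord //; apply/setP => v; have := H v.
  by rewrite negbK inE.
have EE u : nmem s2 aE (u : 'I_n) = (u \notin X') by rewrite E2 // rX'; case: (u \in X').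
apply: triple_seqp (@argmax_spec s2 _) _; first by exists v; rewrite EE vX'.
move=> s3 [an3 ar3] [b [Eb]]; rewrite EE eqb0 negbK => bX' bmax.
apply: triple_set_nat => //=; rewrite Eb; split.
  by rewrite /update /= (an3 24%N _ isT) (an2 24%N _ isT).
exists (b |: X').
have r3 : reps s3 aR X' by move=> u; rewrite (an3 aR _ isT) (an2 aR _ isT).
split.
- exact: (reps_set b r3).
- by apply: subset_trans sX _; apply: subsetUr.
- by rewrite cardsU1 bX' cX' add1n addnS.
have EV u : rmem s2 rV u = rmem s rV u by rewrite (ar2 rV _ isT) (ar rV _ isT).
move=> u x; rewrite !inE negb_or => /orP[/eqP-> _|uX' uX] /andP[xb xX'].
  by have := bmax x; rewrite EE xX' !EV => ->.
exact: HX'.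
Qed.

(** The reward per unforced vertex never falls: with [m.+1] removable vertices left, the best
    removal costs at most a fraction [1 / m.+1] of the current reward, by [sum_removal_loss]. *)
Lemma shrink_spec s X : reps s aR X -> I \subset X ->
  nmem s sCnt 0 = #|X| ->
  ptriple shrink s (fun s' => exists X', [/\ reps s' aR X', X' \subset X, I \subset X',
    #|X'| = (#|X| - (#|X| - k))%N &
    (#|X'| - #|I|)%:R * h X <= (#|X| - #|I|)%:R * h X']).
Proof.
move=> rX sIX cX.
have cXn : (#|X| <= n)%N by rewrite -[X in (_ <= X)%N]card_ord max_card.
have /andP[Ik kn] := target_range J.
pose Inv (t : nat) (s' : memory) := exists X', [/\ reps s' aR X', X' \subset X, I \subset X',
    #|X'| = (#|X| - t)%N & (#|X'| - #|I|)%:R * h X <= (#|X| - #|I|)%:R * h X'].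
apply: (@ptriple_for _ _ _ _ (#|X| - k)%N Inv).
- by apply: leq_trans nU; apply: leq_trans (leq_subr _ _) cXn.
- by exists X; rewrite subn0.
- by move=> j s' [an _] _ _ _ /=; rewrite (an sCnt 0%N isT) cX.
move=> j s' [an ar] jb [X' [rX' sX sIX' cX' HX']] Ej.
pose Inv2 (l : nat) (s2 : memory) := [/\ reps s2 aR X',
  forall v : 'I_n, (v < l)%N -> nmem s2 aE v = ((v \in X') && (v \notin I)) &
  forall v : 'I_n, (v < l)%N -> rmem s2 rV v = h (X' :\ v)].
apply: triple_seqp (@ptriple_forv 21 _ s' Inv2 _ _) _.
- by split.
- move=> v s2 ag [r2 E2 V2] Ev.
  apply: triple_nat_seq; set s3 := set_nat _ _ _ _.
  apply: triple_nat_seq; set s4 := set_nat s3 _ _ _.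
  apply: triple_nat_seq; set s5 := set_nat s4 _ _ _.
  have r5 : reps s5 aR (X' :\ v).
    by rewrite /s5 (_ : neval J s4 (cell 21) = v) //; apply: (@reps_unset s4 v X').
  apply: triple_query_seq; rewrite (vertex_set_reps r5).
  have E5 : neval J s5 (cell 21) = v by exact: Ev.
  rewrite E5; apply: triple_set_nat => //=; split=> //; split.
  + move=> u; rewrite /= /update /= Ev; case: eqP => // uv; rewrite -uv.
    by have := r2 u; rewrite uv.
  + move=> u; rewrite ltnS leq_eqVlt /= /update /= Ev => /orP[/eqP uv|lt_u].
      rewrite uv eqxx valK r2 (ord_inj uv).
      by case: (v \in X'); case: (v \in I).
    by rewrite ltn_eqF // E2.
  + move=> u; rewrite ltnS leq_eqVlt /= /update /= => /orP[/eqP uv|lt_u].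
      by rewrite uv eqxx (ord_inj uv).
    by rewrite ltn_eqF // V2.
move=> s2 [an2 ar2] [r2 E2 V2].
have EE (u : 'I_n) : nmem s2 aE u = ((u \in X') && (u \notin I)) by apply: E2.
have EV (u : 'I_n) : rmem s2 rV u = h (X' :\ u) by apply: V2.
have cD : #|X' :\: I| = (#|X'| - #|I|)%N by rewrite cardsD (setIidPr sIX').
have cD0 : (0 < #|X' :\: I|)%N by rewrite cD cX'; move: jb Ik; clear; lia.
apply: triple_seqp (@argmax_spec s2 _) _.
  by have /card_gt0P[v /setDP[vX vI]] := cD0; exists v; rewrite EE vX vI.
move=> s3 [an3 ar3] [b [Eb]]; rewrite EE eqb0 negbK => /andP[bX' bI] bmax.
apply: triple_set_nat => //=; rewrite Eb; split.
  by rewrite /update /= (an3 23%N _ isT) (an2 23%N _ isT).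
exists (X' :\ b).
have r3 : reps s3 aR X' by move=> u; rewrite (an3 aR _ isT).
have cX'b : #|X' :\ b| = (#|X'| - 1)%N by rewrite [#|X'|](cardsD1 b) bX' add1n subn1.
split.
- exact: (reps_unset b r3).
- by apply: subset_trans sX; apply: subsetDl.
- by rewrite subsetD1 sIX' bI.
- by rewrite cX'b cX' -subnDA addn1.
set m := (#|X' :\ b| - #|I|)%N.
have Em : (#|X'| - #|I|)%N = m.+1 by rewrite -cD /m cX'b; move: cD0; rewrite cD; lia.
rewrite Em in HX' cD.
have loss : m.+1%:R * (h X' - h (X' :\ b)) <= h X'.
  apply: le_trans (sum_removal_loss (@reward_ge0 _ J) (@reward_monotone _ J)
    (@reward_submodular _ J) (subsetDl X' I)).
  rewrite -cD mulr_natl -sumr_const; apply: ler_sum => u /setDP[uX' uI].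
  by rewrite lerD2l lerN2; have := bmax u; rewrite EE uX' uI !EV => ->.
have m10 : 0 < m.+1%:R :> R by rewrite ltr0n.
rewrite -(ler_pM2l m10); move: HX' loss; rewrite -natr1.
have : 0 <= m%:R :> R by [].
have : 0 <= (#|X| - #|I|)%:R :> R by [].
set M : R := m%:R; set A : R := (_ - _)%:R; set hX := h X; set hX' := h X'; set hb := h _.
move=> A0 M0 l1 l2.
have : M * ((M + 1) * hX) <= M * (A * hX') by apply: ler_wpM2l.
have : A * (M * hX') <= A * ((M + 1) * hb) by apply: ler_wpM2l => //; lra.
lra.
Qed.

Lemma weight_range (u v : 'I_n) : 0 <= w u v <= 1.
Proof.
rewrite /pair_weight; case: ifP => [uv|_]; last by rewrite lexx ler01.
by apply: weight_itv; rewrite cards2 uv.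
Qed.

Lemma count_members_spec s X : reps s aR X ->
  ptriple count_members s (fun s' => nmem s' sCnt 0 = #|X|).
Proof.
move=> rX; apply: triple_nat_seq.
apply: ptriple_post (@ptriple_forv 22 _ _ (fun j s' =>
  nmem s' sCnt 0 = \sum_(0 <= l < j) nmem s aR l)%N _ _) _.
- by rewrite big_geq.
- move=> v s' [an _] Es Ev; apply: triple_set_nat => //=; split=> //.
  by rewrite /update /= Es Ev (an aR _ isT) big_nat_recr.
move=> s' ->; rewrite big_mkord -sum1_card [RHS]big_mkcond.
by apply: eq_bigr => v _; rewrite rX; case: (v \in X).
Qed.

Definition obj (T : {set 'I_n}) : R := h T + den (weight J) T.

Lemma obj_ge0 T : 0 <= obj T.
Proof.
apply: addr_ge0; first exact: reward_ge0.
rewrite (den_pairs _ (erefl #|T|)); apply: mulr_ge0; first exact: kap_ge0.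
by apply: sumr_ge0 => u _; apply: sumr_ge0 => v _; case/andP: (weight_range u v).
Qed.

Lemma value_spec s X : reps s aR X -> #|X| = k ->
  ptriple value s (fun s' => rmem s' rval 0 = obj X).
Proof.
move=> rX cX; apply: triple_query_seq; rewrite (vertex_set_reps rX).
set s1 := set_real _ _ _ _.
pose t (u v : nat) : R := kap R k * ((nmem s aR u)%:R * (nmem s aR v)%:R * read_weight J u v).
apply: ptriple_post (@ptriple_forv 25 _ _ (fun j s' =>
  rmem s' rval 0 = h X + \sum_(0 <= u < j) \sum_(0 <= v < n) t u v) _ _) _.
- by rewrite big_geq // addr0.
- move=> u s2 [an ar] Es Eu.
  set S := h X + _ in Es.
  apply: ptriple_post (triple_frame (@ptriple_forv 26 _ _ (fun j s' =>
    rmem s' rval 0 = S + \sum_(0 <= v < j) t u v) _ _)) _.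
  + by rewrite big_geq // addr0 -Es.
  + move=> v s3 [an3 ar3] Es3 Ev; apply: triple_set_real => //; split=> //.
    rewrite big_nat_recr //= addrA -Es3 /update /=; congr (_ + _).
    have E25 : nmem s3 25 0 = u by rewrite (an3 25%N _ isT).
    by rewrite E25 Ev !(an3 aR _ isT) /= !(an aR _ isT).
  move=> s3 [Es3 [an3 _]]; split; first by rewrite (an3 25%N _ isT).
  by rewrite big_nat_recr //= addrA.
move=> s' ->; rewrite /obj (den_pairs _ cX); congr (_ + _).
rewrite pairs_quad /quad mulr_sumr big_mkord; apply: eq_bigr => u _.
rewrite mulr_sumr big_mkord; apply: eq_bigr => v _.
by rewrite /t !rX read_weightE.
Qed.

Definition recorded (s : memory) : Prop := exists O,
  [/\ reps s 0 O, feasible J O & rmem s rbest 0 = obj O].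

Lemma record_spec s X : reps s aR X -> feasible J X ->
  rmem s rval 0 = obj X -> recorded s \/ rmem s rbest 0 < 0 ->
  ptriple record s (fun s' => [/\ recorded s', rmem s rbest 0 <= rmem s' rbest 0 &
    obj X <= rmem s' rbest 0]).
Proof.
move=> rX fX Ev Hb; apply: triple_if; rewrite /= Ev; case: ifP => le_b.
  (* Objectives are nonnegative, so a negative [rbest], the mark of an empty record, is never
     kept. *)
  apply: triple_skip => //; split=> //; case: Hb => // lt0.
  by move: (lt_le_trans lt0 (le_trans (obj_ge0 X) le_b)); rewrite ltxx.
apply: triple_seqp (@fill_spec 27 0 _ s (fun v => nmem s aR v) isT _) _.
  by move=> v s2 [an2 _] _ Ei /=; rewrite Ei (an2 aR _ isT).
move=> s2 [an2 ar2] E2; apply: triple_set_real => //; split.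
- exists X; split=> //; first by move=> v; rewrite /= E2 // rX.
  by rewrite /= /update /= (ar2 rval _ isT).
- rewrite /= /update /= (ar2 rval _ isT) Ev ltW // ltNge.
  by rewrite le_b.
- by rewrite /= /update /= (ar2 rval _ isT) Ev.
Qed.

Lemma fix_record_spec s X : reps s aR X -> I \subset X ->
  recorded s \/ rmem s rbest 0 < 0 ->
  ptriple fix_record s (fun s' => [/\ recorded s', rmem s rbest 0 <= rmem s' rbest 0 &
    exists T, [/\ resized h I k X T, feasible J T & obj T <= rmem s' rbest 0]]).
Proof.
move=> rX sIX Hb; have /andP[Ik kn] := target_range J.
have cXn : (#|X| <= n)%N by rewrite -[X in (_ <= X)%N]card_ord max_card.
apply: triple_seqp (count_members_spec rX) _ => s1 [an1 ar1] E1.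
have r1 : reps s1 aR X by move=> v; rewrite (an1 aR _ isT).
apply: triple_seqp (shrink_spec r1 sIX E1) _ => s2 [an2 ar2] [X2 [r2 s2X sI2 c2 h2]].
have E2 : nmem s2 sCnt 0 = #|X| by rewrite (an2 sCnt _ isT).
apply: triple_seqp (grow_spec _ r2 _) _.
- exact: leq_trans kn nU.
- by rewrite E2 c2; move: cXn kn; clear; lia.
move=> s3 [an3 ar3] [T [r3 s2T cT _]].
have kT : #|T| = k by rewrite cT E2 c2; clear; lia.
have fT : feasible J T by rewrite /feasible kT eqxx (subset_trans sI2).
apply: triple_seqp (value_spec r3 kT) _ => s4 [an4 ar4] E4.
have r4 : reps s4 aR T by move=> v; rewrite (an4 aR _ isT).
have Eb : rmem s4 rbest 0 = rmem s rbest 0.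
  by rewrite (ar4 rbest _ isT) (ar3 rbest _ isT) (ar2 rbest _ isT) (ar1 rbest _ isT).
have Hb4 : recorded s4 \/ rmem s4 rbest 0 < 0.
  rewrite Eb; case: Hb => [[O [rO fO bO]]|]; [left|by right].
  exists O; split=> //; last by rewrite Eb.
  by move=> v; rewrite (an4 0%N _ isT) (an3 0%N _ isT) (an2 0%N _ isT) (an1 0%N _ isT).
apply: ptriple_post (record_spec r4 fT E4 Hb4) _ => s5 [rec5 le5 obj5].
split=> //; first by rewrite -Eb.
exists T; split=> //; split=> //; first exact: (subset_trans sI2).
- move=> le_Xk; apply: subset_trans s2T.
  suff -> : X2 = X by [].
  by apply/eqP; rewrite eqEcard s2X c2; move: le_Xk; clear; lia.
- move=> le_kX.
  have ET : X2 = T.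
    by apply/eqP; rewrite eqEcard s2T kT c2; move: le_kX; clear; lia.
  by rewrite ET kT in h2 s2X.
Qed.

End Specs.

(** * Sampling, gradient estimation and the greedy loop *)

Definition sample : cmd :=
  For 28 NVert
    (Draw sd (NLit 0) (NSub (cell sN) (NLit 1)) ;;
     If (BNatLe (NGet aC (cell 28)) (cell sd))
       (SetNat aR (cell 28) (NLit 0)) (SetNat aR (cell 28) (NLit 1))).

Definition gradient : cmd :=
  For 29 NVert (SetReal rAcc (cell 29) (RNat (NLit 0))) ;;
  For 30 (cell sN)
    (sample ;;
     Query rH (NLit 0) aR ;;
     For 31 NVert
       (sOld ::= NGet aR (cell 31) ;;
        SetNat aR (cell 31) (NLit 1) ;;
        Query rH (NLit 1) aR ;;
        SetReal rAcc (cell 31) (RAdd (RGet rAcc (cell 31))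
          (RSub (RGet rH (NLit 1)) (rcell rH))) ;;
        SetNat aR (cell 31) (cell sOld))).

(* Reads the number of the current step in cell 39. *)
Definition scores : cmd :=
  ralpha :r= rone ;;
  For 32 (NSub (NSub (cell sN) (cell 39)) (NLit 1))
    (ralpha :r= RMul (rcell ralpha) (RSub rone (RDiv rone (RNat (cell sN))))) ;;
  For 33 NVert
    (SetReal rV (cell 33) (RNat (NLit 0)) ;;
     For 34 NVert (SetReal rV (cell 33) (RAdd (RGet rV (cell 33))
       (RMul (RNat (NGet aC (cell 34))) (RWeight (cell 34) (cell 33))))) ;;
     For 35 (cell sr) (SetReal rV (cell 33) (RAdd (RGet rV (cell 33))
       (RMul (RNat (NSub (NSub (cell sN) (cell 39)) (NLit 1)))
         (RMul (RDiv (RNat NTarget) (RNat (cell sr)))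
           (RWeight (NGet aD (cell 35)) (cell 33)))))) ;;
     SetReal rV (cell 33) (RAdd (RMul (rcell ralpha) (RGet rAcc (cell 33)))
       (RMul (RMul (RNat (NLit 2)) rkap) (RGet rV (cell 33))))).

Definition take_forced : cmd := For 36 NVert (SetNat aR (cell 36) (NForced (cell 36))).

Definition greedy_step : cmd :=
  gradient ;; scores ;; take_forced ;; count_members ;; grow ;;
  For 37 NVert (SetNat aC (cell 37) (NAdd (NGet aC (cell 37)) (NGet aR (cell 37)))).

Definition try_greedy : cmd :=
  For 38 NVert (SetNat aC (cell 38) (NLit 0)) ;;
  For 39 (cell sN) greedy_step ;;
  sample ;; fix_record.

Section Specs2.
Variables (R : realType) (J : instance R) (U : nat).
Local Notation n := (nvert J).
Local Notation k := (target J).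
Local Notation I := (forced J).
Local Notation h := (reward J).
Local Notation w := (pair_weight (weight J)).
Local Notation triple := (triple J U).
Local Notation ptriple := (@ptriple R J U).
Local Notation recorded := (@recorded R J).
Local Notation memory := (memory R).
Hypothesis nU : (n <= U)%N.
Variable N : nat.
Hypotheses (NU : (N <= U)%N) (N0 : (0 < n)%N -> (0 < N)%N).

Definition counts (s : memory) : {ffun 'I_n -> nat} := [ffun v : 'I_n => nmem s aC v].

Lemma countsE s v : counts s v = nmem s aC v.
Proof. by rewrite ffunE. Qed.

Lemma sum_threshold (c m : nat) (a b : R) : (c <= m)%N ->
  \sum_(d < m) (if (c <= d)%N then a else b) = c%:R * b + (m - c)%:R * a.
Proof.
move=> cm; rewrite -(big_mkord xpredT (fun d => if (c <= d)%N then a else b)).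
rewrite (big_cat_nat _ (n := c)) //=; congr (_ + _).
  rewrite big_nat (eq_bigr (fun=> b)) => [|d /andP[_ dc]]; last by rewrite leqNgt dc.
  by rewrite -big_nat sumr_const_nat subn0 mulr_natl.
rewrite big_nat (eq_bigr (fun=> a)) => [|d /andP[-> _]] //.
by rewrite -big_nat sumr_const_nat mulr_natl.
Qed.

(** The loop potential is the conditional mean of [psi] given the vertices already decided, a
    martingale. Draws stay below [N], so a vertex with count [N] always enters; this keeps forced
    vertices in the sample. *)
Lemma sample_spec s (psi : {set 'I_n} -> R) : nmem s sN 0 = N ->
  (forall v, counts s v <= N)%N ->
  triple sample s (fun s' => exists X, reps s' aR X /\
      forall v, (N <= counts s v)%N -> v \in X)
    (fun s' => psi (vertex_set J s' aR)) (mean (fractional R N (counts s)) psi).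
Proof.
move=> EN cN; set p := fractional R N (counts s).
pose cur (j : nat) (s' : memory) := [set v : 'I_n | (v < j)%N && (nmem s' aR v != 0%N)].
pose Inv (j : nat) (s' : memory) := forall v : 'I_n, (v < j)%N ->
  (nmem s' aR v <= 1)%N /\ ((N <= counts s v)%N -> nmem s' aR v = 1%N).
pose phi (j : nat) s' := lmean (drop j (enum 'I_n)) p psi (cur j s').
apply: (@triple_conseq _ _ _ _ _ _ _ _ _ _ _ 0
  (@triple_for _ _ _ 28 NVert _ s n Inv phi nU _ _ _)).
- by [].
- by [].
- move=> j s' [an ar] jn Hinv Ej; pose v := Ordinal jn.
  set X := cur j s'; set l := drop j.+1 (enum 'I_n).
  have El : drop j (enum 'I_n) = v :: l.
    by rewrite (drop_nth v) ?size_enum_ord // (nth_ord_enum v v : nth v (enum 'I_n) j = v).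
  have Npos : (0 < N)%N by apply: N0; apply: leq_ltn_trans (jn : (j < n)%N).
  pose A := lmean l p psi (v |: X); pose B := lmean l p psi X.
  apply: (@triple_seq _ _ _ _ _ _ (fun s2 => exists2 d : nat, (d < N)%N & s2 = set_nat s' sd 0 d)
     _ (fun s2 => if (counts s v <= nmem s2 sd 0)%N then B else A)).
    have ED : (neval J s' (NSub (cell sN) (NLit 1))).+1 = N.
      by rewrite /= (an sN _ isT) EN subn1 prednK.
    apply: triple_draw => [d|]; first by exists d => //; rewrite -ED ltn_ord.
    rewrite ED /=.
    rewrite /update /= sum_threshold // /phi El /= -/A -/B -/X /p /fractional natrB //.
    rewrite le_eqVlt; apply/orP; left; apply/eqP.
    by field; rewrite pnatr_eq0 -lt0n.
  move=> _ [d dN ->]; apply: triple_if; rewrite /= /update /= Ej (an aC _ isT) countsE.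
  have cur_eq s2 b : nmem s2 aR v = nat_of_bool b ->
      (forall u : nat, (u < j)%N -> nmem s2 aR u = nmem s' aR u) ->
      cur j.+1 s2 = if b then v |: X else X.
    move=> Ev Eu; apply/setP => u; rewrite !inE ltnS leq_eqVlt.
    case: (u =P v) => [->|/eqP uv].
      by rewrite eqxx Ev /=; case: b {Ev}; rewrite !inE ?eqxx // ltnn.
    have -> : (u == j :> nat) = false by apply/negbTE; apply: contra uv => /eqP E; apply/eqP/ord_inj.
    case: (ltnP u j) => uj /=; last by case: b {Ev}; rewrite !inE ?(negPf uv) /= ltnNge uj.
    by rewrite Eu //; case: b {Ev}; rewrite !inE ?(negPf uv) uj.
  case: (leqP (nmem s aC j) d) => cd.
    apply: triple_set_nat => /=; rewrite /update /= Ej.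
      split=> // u; rewrite ltnS leq_eqVlt /= /update /= => /orP[/eqP uj|uj].
        rewrite uj eqxx; split=> // Nc; exfalso; move: Nc; rewrite countsE uj.
        by move: cd dN; clear; lia.
      by rewrite ltn_eqF //; apply: Hinv.
    rewrite /phi -/l (@cur_eq _ false) ?lexx //=; first by rewrite /update /= eqxx.
    by move=> u uj; rewrite /update /= ltn_eqF.
  apply: triple_set_nat => /=; rewrite /update /= Ej.
    split=> // u; rewrite ltnS leq_eqVlt /= /update /= => /orP[/eqP uj|uj]; first by rewrite uj eqxx.
    by rewrite ltn_eqF //; apply: Hinv.
  rewrite /phi -/l (@cur_eq _ true) ?lexx //=; first by rewrite /update /= eqxx.
  by move=> u uj; rewrite /update /= ltn_eqF.
- move=> s' [_ Hinv]; split.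
    exists (vertex_set J s' aR); split=> [v|v Nc]; rewrite inE.
      by case: (Hinv v (ltn_ord v)); case: (nmem _ _ _) => [|[]].
    by case: (Hinv v (ltn_ord v)) => _ ->.
  have Ec : cur n s' = vertex_set J s' aR by apply/setP => v; rewrite !inE ltn_ord.
  by rewrite addr0 /phi drop_oversize ?size_enum_ord //= Ec.
- by rewrite addr0 /phi drop0 (_ : cur 0%N _ = set0) //; apply/setP => v; rewrite !inE.
Qed.

(** The minus signs turn an upper bound on the error into the lower bound that the logic can
    express. The potential charges [B ^+ 2] per vertex for each sample still to come. *)
Lemma gradient_spec s (lam B : R) : 0 <= lam ->
  (forall X v, gain h X v <= B) -> nmem s sN 0 = N ->
  (forall v, counts s v <= N)%N ->
  triple gradient s (fun=> True)
    (fun s' => - (lam * \sum_(v < n)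
        (rmem s' rAcc v - N%:R * mgain h (fractional R N (counts s)) v) ^+ 2))
    (- (lam * (N%:R * n%:R) * B ^+ 2)).
Proof.
move=> lam0 gB EN cN; set p := fractional R N (counts s); set G := mgain h p.
have p01 : unit_range p.
  move=> v; rewrite /p /fractional mulr_ge0 ?invr_ge0 //=.
  have Npos : 0 < N%:R :> R by rewrite ltr0n N0 // (leq_ltn_trans _ (ltn_ord v)).
  by rewrite mulrC ler_pdivrMr // mul1r ler_nat.
have acc0 : ptriple (For 29 NVert (SetReal rAcc (cell 29) (RNat (NLit 0)))) s
    (fun s' => forall v : 'I_n, rmem s' rAcc v = 0).
  apply: ptriple_post (@ptriple_forv _ _ _ nU _ _ _ (fun j s' =>
    forall v : 'I_n, (v < j)%N -> rmem s' rAcc v = 0) _ _) _ => //.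
  + move=> v s' _ Hinv Ev; apply: triple_set_real => //; split=> // u.
    rewrite ltnS leq_eqVlt /= /update /= Ev => /orP[/eqP->|uv]; first by rewrite eqxx.
    by rewrite ltn_eqF // Hinv.
  + by move=> s' H v; apply: H.
apply: triple_seqp acc0 _ => s1 [an1 ar1] A1.
have EN1 : nmem s1 sN 0 = N by rewrite (an1 sN _ isT).
pose phi (j : nat) (s' : memory) : R :=
  - (lam * \sum_(v < n) (rmem s' rAcc v - j%:R * G v) ^+ 2)
  - lam * ((N - j)%N%:R * n%:R) * B ^+ 2.
apply: (@triple_conseq _ _ _ _ _ _ _ _ _ _ _ 0
  (@triple_for _ _ _ 30 (cell sN) _ s1 N (fun _ _ => True) phi NU _ _ _)) => //.
- by move=> j s' [an _] _ _ _ /=; rewrite (an sN _ isT).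
- move=> j s' [an ar] jN _ Ej.
  have Ec : counts s' = counts s.
    by apply/ffunP => v; rewrite !countsE (an aC _ isT) (an1 aC _ isT).
  pose psi (X : {set 'I_n}) : R :=
    - (lam * \sum_(v < n) (rmem s' rAcc v + gain h X v - (j%:R + 1) * G v) ^+ 2)
    - lam * ((N - j.+1)%N%:R * n%:R) * B ^+ 2.
  have ts := @sample_spec s' psi; rewrite Ec (an sN _ isT) in ts.
  have le_psi : phi j s' <= mean p psi.
    have -> : mean p psi = - lam * \sum_(v < n)
        mean p (fun X => (rmem s' rAcc v + gain h X v - (j%:R + 1) * G v) ^+ 2)
        - lam * ((N - j.+1)%N%:R * n%:R) * B ^+ 2.
      rewrite -mean_sum -[X in _ = _ + X](mean_const p) -mean_lin.
      by apply: mean_eq => X; rewrite /psi mulNr.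
    have : \sum_(v < n) mean p (fun X => (rmem s' rAcc v + gain h X v - (j%:R + 1) * G v) ^+ 2)
        <= \sum_(v < n) ((rmem s' rAcc v - j%:R * G v) ^+ 2 + B ^+ 2).
      by apply: ler_sum => v _; apply: mean_sqr_error => //; apply: reward_monotone.
    rewrite big_split /= sumr_const card_ord -[B ^+ 2 *+ n]mulr_natl.
    move/(ler_wpM2l lam0); rewrite /phi.
    have -> : (N - j)%N%:R = (N - j.+1)%N%:R + 1 :> R by rewrite natr1; congr (_%:R); move: jN; clear; lia.
    set S1 := \sum_(v < n) mean _ _; set S2 := \sum_(v < n) _; lra.
  apply: triple_seq (triple_conseq (a := 0) (f' := fun s2 => psi (vertex_set J s2 aR))
    (Q' := fun s2 => (exists X, reps s2 aR X /\ (forall v, (N <= counts s v)%N -> v \in X)) /\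
      agree sample s' s2) (triple_frame (ts EN1 cN)) _ _) _.
  + by move=> s2 H; rewrite addr0.
  + by rewrite addr0.
  move=> s2 [[X [r2 _]] [an2 ar2]]; rewrite (vertex_set_reps r2).
  apply: triple_query_seq; rewrite (vertex_set_reps r2); set s3 := set_real _ _ _ _.
  pose Inv (l : nat) (s4 : memory) := [/\ reps s4 aR X, rmem s4 rH 0 = h X,
    forall u : 'I_n, (u < l)%N -> rmem s4 rAcc u = rmem s' rAcc u + gain h X u &
    forall u : 'I_n, (l <= u)%N -> rmem s4 rAcc u = rmem s' rAcc u].
  have tl : ptriple (For 31 NVert
       (sOld ::= NGet aR (cell 31) ;;
        SetNat aR (cell 31) (NLit 1) ;;
        Query rH (NLit 1) aR ;;
        SetReal rAcc (cell 31) (RAdd (RGet rAcc (cell 31))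
          (RSub (RGet rH (NLit 1)) (rcell rH))) ;;
        SetNat aR (cell 31) (cell sOld))) s3 (fun s4 => Inv n s4).
    apply: (@ptriple_forv _ _ _ nU 31 _ _ Inv).
      split=> // u _; by rewrite /= /update /= (ar2 rAcc _ isT).
    move=> v s4 _ [r4 H4 A4 B4] Ev.
    apply: triple_nat_seq; set s5 := set_nat _ _ _ _.
    apply: triple_nat_seq; set s6 := set_nat s5 _ _ _.
    have r6 : reps s6 aR (v |: X).
      by rewrite /s6 (_ : neval J s5 (cell 31) = v) //; apply: (@reps_set _ _ s5 v X).
    apply: triple_query_seq; rewrite (vertex_set_reps r6).
    apply: triple_real_seq; apply: triple_set_nat => //=; split=> //; split.
    + move=> u; rewrite /= /update /= Ev; case: eqP => // uv; rewrite -uv.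
      by have := r4 u; rewrite uv.
    + exact: H4.
    + move=> u; rewrite ltnS leq_eqVlt /= /update /= Ev => /orP[/eqP uv|uv].
        by rewrite uv eqxx B4 // H4 (ord_inj uv).
      by rewrite ltn_eqF // A4.
    + move=> u vu; rewrite /= /update /= Ev gtn_eqF // B4 // ltnW //.
  apply: triple_post (triple_pure (triple_frame tl) (f' := fun s'' => phi j.+1 (set_nat s'' 30 0 j.+1)) (g' := psi X) _) _.
    move=> s4 [[_ _ A4 _] _]; rewrite /psi /phi -natr1 lerD2r lerN2.
    by rewrite le_eqVlt; apply/orP; left; apply/eqP; congr (_ * _); apply: eq_bigr => v _; rewrite /= A4.
  move=> s4 [_ [an4 _]]; split=> //.
  by rewrite (an4 30%N _ isT) /= (an2 30%N _ isT).
- move=> s' _; split=> //; rewrite addr0 /phi subnn; lra.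
- rewrite addr0 /phi subn0 big1 ?mulr0 ?oppr0 ?add0r //.
  by move=> v _; rewrite /= A1 mul0r subrr expr2 mul0r.
Qed.

Definition guess_degree (s : memory) (r : nat) (v : 'I_n) : R :=
  \sum_(0 <= t < r) (k%:R / r%:R * read_weight J (nmem s aD t) v).

Definition cur_score (s : memory) (r j : nat) (acc : 'I_n -> R) (c : 'I_n -> nat)
  (v : 'I_n) : R := score w N k (guess_degree s r) j acc c v.

Lemma scores_spec s j r : nmem s sN 0 = N -> nmem s 39 0 = j -> nmem s sr 0 = r ->
  (r <= U)%N ->
  ptriple scores s (fun s' => forall v : 'I_n,
    rmem s' rV v = cur_score s r j (fun v => rmem s rAcc v) (counts s) v).
Proof.
move=> EN Ej Er rU; apply: triple_real_seq; set s1 := set_real _ _ _ _.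
have NjU : (N - j - 1 <= U)%N by move: NU; clear; lia.
apply: triple_seqp (@ptriple_for _ _ _ 32 _ _ _ _ (fun l s' =>
  rmem s' ralpha 0 = (1 - N%:R^-1) ^+ l) NjU _ _ _) _ => //.
- by move=> l s' [an _] _ _ _ /=; rewrite !(an sN _ isT, an 39%N _ isT) /= EN Ej.
- move=> l s' [an _] _ El Ei; apply: triple_set_real => //; split=> //.
  by rewrite /= /update /= El (an sN _ isT) /= EN mul1r exprSr.
move=> s2 [an2 ar2] Ea.
have Eal : rmem s2 ralpha 0 = alpha R N j.+1 by rewrite Ea /alpha; congr (_ ^+ _); clear; lia.
pose sc v := cur_score s r j (fun v => rmem s rAcc v) (counts s) v.
apply: ptriple_post (@ptriple_forv _ _ _ nU 33 _ _ (fun l s' =>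
  forall v : 'I_n, (v < l)%N -> rmem s' rV v = sc v) _ _) _ => //; last first.
  by move=> s' H v; apply: H.
move=> v s3 [an3 ar3] H3 Ev; apply: triple_real_seq; set s4 := set_real _ _ _ _.
have Ev4 : nmem s4 33 0 = v by [].
pose same (s' : memory) := forall u : 'I_n, (u < v)%N -> rmem s' rV u = sc u.
have same4 : same s4 by move=> u uv; rewrite /= /update /= Ev ltn_eqF // H3.
apply: triple_seqp (@ptriple_forv _ _ _ nU 34 _ _ (fun l s' => same s' /\
  rmem s' rV v = \sum_(0 <= u < l) (nmem s aC u)%:R * read_weight J u v) _ _) _.
- by split=> //; rewrite big_geq //= /update /= Ev eqxx.
- move=> u s' [an' _] [sm Es] Eu; apply: triple_set_real => //; split=> //.
  have E33 : nmem s' 33 0 = v by rewrite (an' 33%N _ isT).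
  split=> [x xv|]; rewrite /= /update /= E33; first by rewrite ltn_eqF // sm.
  rewrite eqxx big_nat_recr //= -Es Eu (an' aC _ isT) /= (an3 aC _ isT) (an2 aC _ isT) //.
move=> s5 [an5 ar5] [same5 E5].
have E33 : nmem s5 33 0 = v by rewrite (an5 33%N _ isT).
set S5 := \sum_(0 <= u < n) _ in E5.
apply: triple_seqp (@ptriple_for _ _ _ 35 _ _ _ _ (fun l s' => same s' /\
  rmem s' rV v = S5 + \sum_(0 <= t < l) (N - j - 1)%N%:R *
     (k%:R / r%:R * read_weight J (nmem s aD t) v)) rU _ _ _) _.
- by split=> //; rewrite big_geq // addr0.
- move=> l s' [an' _] _ _ _ /=.
  by rewrite (an' sr _ isT) (an5 sr _ isT) /= (an3 sr _ isT) (an2 sr _ isT).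
- move=> t s' [an' _] tr [sm Es] Et; apply: triple_set_real => //; split=> //.
  have E33' : nmem s' 33 0 = v by rewrite (an' 33%N _ isT).
  split=> [x xv|]; rewrite /= /update /= E33'; first by rewrite ltn_eqF // sm.
  rewrite eqxx big_nat_recr //= addrA -Es Et.
  have ans a i : a \notin [:: 20; 32; 33; 34; 35]%N -> nmem s' a i = nmem s a i.
    rewrite !inE !negb_or => /and5P[_ a1 a2 a3 a4].
    rewrite (an' a) ?inE ?negb_or ?a4 // (an5 a) ?inE ?negb_or ?a3 // (an3 a) ?inE ?negb_or ?a2 ?a3 ?a4 //.
    by rewrite (an2 a) ?inE ?negb_or ?a1.
  by rewrite !ans //= EN Ej Er.
move=> s6 [an6 ar6] [same6 E6]; apply: triple_set_real => //.
have E33' : nmem s6 33 0 = v by rewrite (an6 33%N _ isT).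
split=> // x; rewrite ltnS leq_eqVlt /= /update /= E33' => /orP[/eqP xv|xv]; last first.
  by rewrite ltn_eqF // same6.
rewrite xv eqxx (ord_inj xv) E6 /sc /cur_score /score.
have E6r a i : a != rV -> rmem s6 a i = rmem s2 a i.
  move=> a1; rewrite (ar6 a) ?inE // (ar5 a) ?inE //= /update (negPf a1) /=.
  by rewrite (ar3 a) //= !inE (negPf a1).
rewrite !E6r // Eal (ar2 rAcc _ isT) /=; congr (_ + _ * (_ + _)).
  by rewrite /S5 big_mkord; apply: eq_bigr => u _; rewrite read_weightE countsE.
by rewrite -mulr_sumr.
Qed.

Lemma take_forced_spec s : ptriple take_forced s (fun s' => reps s' aR I).
Proof.
apply: ptriple_post (@fill_spec _ _ _ nU 36 aR _ s
  (fun v => if insub v is Some u then (u \in I : nat) else 0%N) isT _) _.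
  by move=> v s' _ _ Ev; rewrite /= Ev.
by move=> s' H v; rewrite H // valK.
Qed.

Definition add_set (c : {ffun 'I_n -> nat}) (Z : {set 'I_n}) : {ffun 'I_n -> nat} :=
  [ffun v => c v + (v \in Z)]%N.

(** The premise on [phi] holds for every outcome [acc] of the sampling and carries its squared
    error; the mean of that error, from [gradient_spec], cancels the extra term on its left. *)
Lemma greedy_step_spec s j r (lam B : R) (phi : {ffun 'I_n -> nat} -> R) (g : R) :
  0 <= lam -> (forall X v, gain h X v <= B) -> nmem s sN 0 = N ->
  nmem s 39 0 = j -> nmem s sr 0 = r -> (r <= U)%N ->
  (forall v, counts s v <= N)%N ->
  (forall acc (Z : {set 'I_n}), #|Z| = k -> I \subset Z ->
     (forall O, feasible J O -> \sum_(v in O) cur_score s r j acc (counts s) v <=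
                                \sum_(v in Z) cur_score s r j acc (counts s) v) ->
     g + lam * (N%:R * n%:R) * B ^+ 2 <= phi (add_set (counts s) Z) +
       lam * \sum_(v < n)
         (acc v - N%:R * mgain h (fractional R N (counts s)) v) ^+ 2) ->
  triple greedy_step s (fun s' => exists Z : {set 'I_n}, [/\ #|Z| = k, I \subset Z &
    counts s' = add_set (counts s) Z]) (fun s' => phi (counts s')) g.
Proof.
move=> lam0 gB EN Ej Er rU cN Hg; have /andP[Ik kn] := target_range J.
apply: triple_seq (triple_conseq (a := g + lam * (N%:R * n%:R) * B ^+ 2)
  (f' := fun s' => - (lam * \sum_(v < n)
        (rmem s' rAcc v - N%:R * mgain h (fractional R N (counts s)) v) ^+ 2) +
        (g + lam * (N%:R * n%:R) * B ^+ 2))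
  (Q' := agree gradient s) (triple_frame (gradient_spec lam0 gB EN cN)) _ _) _.
- by move=> s' [].
- lra.
move=> s1 [an1 ar1]; set f1 := _ + _.
have Ec1 : counts s1 = counts s by apply/ffunP => v; rewrite !countsE (an1 aC _ isT).
have := @scores_spec s1 j r; rewrite (an1 sN _ isT) (an1 39%N _ isT) (an1 sr _ isT).
move/(_ EN Ej Er rU) => ts; apply: triple_seqp ts _ => s2 [an2 ar2] V2.
apply: triple_seqp (take_forced_spec _) _ => s3 [an3 ar3] r3.
apply: triple_seqp (count_members_spec nU r3) _ => s4 [an4 ar4] E4.
have r4 : reps s4 aR I by move=> v; rewrite (an4 aR _ isT).
apply: triple_seqp (grow_spec nU _ r4 _) _.
- exact: leq_trans kn nU.
- by rewrite E4 subnKC.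
move=> s5 [an5 ar5] [Z [r5 sIZ cZ topZ]]; rewrite E4 subnKC // in cZ.
have ans v : nmem s5 aC v = nmem s aC v.
  by rewrite (an5 aC _ isT) (an4 aC _ isT) (an3 aC _ isT) (an2 aC _ isT) (an1 aC _ isT).
have tl := @fill_spec _ _ _ nU 37 aC (NAdd (NGet aC (cell 37)) (NGet aR (cell 37))) s5
  (fun v => nmem s aC v + nmem s5 aR v)%N isT.
have tl' : ptriple (For 37 NVert (SetNat aC (cell 37) (NAdd (NGet aC (cell 37)) (NGet aR (cell 37))))) s5
    (fun s' => counts s' = add_set (counts s) Z).
  apply: ptriple_post (tl _) _.
    by move=> v s' [an' _] H Ev; rewrite /= Ev H // (an' aR _ isT) ans.
  by move=> s' H; apply/ffunP => v; rewrite !ffunE H // r5.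
apply: triple_post (triple_pure tl' (f' := fun s' => phi (counts s')) (g' := f1) _) _.
  move=> s' ->; have := Hg (fun v => rmem s1 rAcc v) Z cZ sIZ.
  have Hs O : feasible J O -> \sum_(v in O) cur_score s r j (fun v => rmem s1 rAcc v) (counts s) v <=
      \sum_(v in Z) cur_score s r j (fun v => rmem s1 rAcc v) (counts s) v.
    case/andP=> /eqP cO sIO; apply: (top_sum sIO); first by rewrite cO cZ.
    have EV v : cur_score s r j (fun v => rmem s1 rAcc v) (counts s) v = rmem s4 rV v.
      rewrite (ar4 rV _ isT) (ar3 rV _ isT) V2 Ec1 /cur_score /score; congr (_ + _ * (_ + _ * _)).
      by apply: eq_bigr => t _; rewrite (an1 aD _ isT).
    by move=> u v uZ uI vZ; rewrite !EV; apply: topZ.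
  move/(_ Hs); rewrite /f1; lra.
by move=> s' Ec; exists Z.
Qed.

Definition valid_counts (j : nat) (c : {ffun 'I_n -> nat}) : Prop :=
  [/\ forall v, (c v <= j)%N, (\sum_v c v = j * k)%N & forall v, v \in I -> c v = j].

Lemma valid_add j c (Z : {set 'I_n}) : valid_counts j c -> #|Z| = k -> I \subset Z ->
  valid_counts j.+1 (add_set c Z).
Proof.
move=> [c1 c2 c3] kZ sIZ; split=> [v||v vI].
- by rewrite ffunE -addn1 leq_add ?leq_b1.
- under eq_bigr do rewrite ffunE.
  rewrite big_split /= c2 mulSn addnC; congr (_ + _)%N.
  by rewrite -kZ -sum1_card [RHS]big_mkcond; apply: eq_bigr => v _; case: (v \in Z).
- by rewrite ffunE c3 // (subsetP sIZ) // addn1.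
Qed.

(** Abstract in [lam], [phi] and [psi] to serve twice: with the greedy potential for the right
    guess, and with zeros wherever only the monotonicity of [rbest] matters. *)
Lemma try_greedy_spec s r (lam B : R) (phi : nat -> {ffun 'I_n -> nat} -> R)
    (psi : {set 'I_n} -> R) :
  0 <= lam -> (forall X v, gain h X v <= B) -> nmem s sN 0 = N ->
  nmem s sr 0 = r -> (r <= U)%N -> recorded s \/ rmem s rbest 0 < 0 ->
  (forall j c acc (Z : {set 'I_n}), (j < N)%N -> valid_counts j c -> #|Z| = k -> I \subset Z ->
     (forall O, feasible J O -> \sum_(v in O) cur_score s r j acc c v <=
                                \sum_(v in Z) cur_score s r j acc c v) ->
     phi j c + lam * (N%:R * n%:R) * B ^+ 2 <= phi j.+1 (add_set c Z) +
       lam * \sum_(v < n) (acc v - N%:R * mgain h (fractional R N c) v) ^+ 2) ->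
  (forall c, valid_counts N c -> phi N c <= mean (fractional R N c) psi) ->
  (forall X T : {set 'I_n}, I \subset X -> resized h I k X T -> feasible J T -> psi X <= obj T) ->
  triple try_greedy s (fun s' => recorded s' /\ rmem s rbest 0 <= rmem s' rbest 0)
    (fun s' => rmem s' rbest 0) (phi 0%N [ffun=> 0%N]).
Proof.
move=> lam0 gB EN Er rU Hb Hphi Hfin Hpsi.
have tz : ptriple (For 38 NVert (SetNat aC (cell 38) (NLit 0))) s
    (fun s' => counts s' = [ffun=> 0%N]).
  apply: ptriple_post (@fill_spec _ _ _ nU 38 aC (NLit 0) s (fun=> 0%N) isT _) _ => //.
  by move=> s' H; apply/ffunP => v; rewrite !ffunE H.
apply: triple_seqp tz _ => s1 [an1 ar1] E1.
pose Inv (j : nat) (s' : memory) := valid_counts j (counts s').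
have loop : triple (For 39 (cell sN) greedy_step) s1
    (fun s' => agree (For 39 (cell sN) greedy_step) s1 s' /\ Inv N s')
    (fun s' => phi N (counts s')) (phi 0%N (counts (set_nat s1 39 0 0))).
  apply: (@triple_for _ _ _ 39 (cell sN) greedy_step s1 N Inv
    (fun j s' => phi j (counts s')) NU).
  - rewrite /Inv (_ : counts _ = [ffun=> 0%N]); last by rewrite -E1; apply/ffunP => v; rewrite !ffunE.
    by split=> [v||v _]; rewrite ?ffunE // big1 // => v _; rewrite ffunE.
  - by move=> j s' [an _] _ _ _ /=; rewrite (an sN _ isT) (an1 sN _ isT).
  - move=> j s' [an ar] jN Hinv Ej.
    have Esc acc c v : cur_score s' r j acc c v = cur_score s r j acc c v.
      rewrite /cur_score /score; congr (_ + _ * (_ + _ * _)).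
      by apply: eq_bigr => t _; rewrite (an aD _ isT) (an1 aD _ isT).
    have [c1 c2 c3] := Hinv.
    have ts := @greedy_step_spec s' j r lam B (phi j.+1) (phi j (counts s')) lam0 gB.
    apply: (triple_conseq (a := 0) (triple_frame (ts _ Ej _ rU _ _))); last by rewrite addr0.
    + by rewrite (an sN _ isT) (an1 sN _ isT).
    + by rewrite (an sr _ isT) (an1 sr _ isT).
    + by move=> v; apply: leq_trans (c1 v) (ltnW jN).
    + move=> acc Z kZ sIZ top; apply: Hphi => // O fO.
      by have := top O fO; under eq_bigr do rewrite Esc; under [X in _ <= X]eq_bigr do rewrite Esc.
    move=> s2 [[Z [kZ sIZ E2]] [an2 _]].
    have Es : counts (set_nat s2 39 0 j.+1) = counts s2 by apply/ffunP => v; rewrite !ffunE.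
    rewrite addr0 Es; split=> //; split; first by rewrite (an2 39%N _ isT).
    by rewrite /Inv Es E2; apply: valid_add.
have Ez : counts (set_nat s1 39 0 0) = [ffun=> 0%N].
  by rewrite -E1; apply/ffunP => v; rewrite !ffunE.
rewrite Ez in loop; apply: triple_seq loop _.
move=> s2 [[an2 ar2] Hinv]; have [c1 c2 c3] := Hinv.
have ts := @sample_spec s2 psi; rewrite (an2 sN _ isT) (an1 sN _ isT) in ts.
apply: triple_seq (triple_conseq (a := 0) (f' := fun s' => psi (vertex_set J s' aR))
   (Q' := fun s' => (exists X, reps s' aR X /\ I \subset X) /\ agree sample s2 s')
   (g' := phi N (counts s2)) (triple_frame (ts EN c1)) _ _) _.
- move=> s3 [[X [rX HX]] ag]; rewrite addr0; split=> //; split=> //; exists X; split=> //.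
  by apply/subsetP => v vI; apply: HX; rewrite c3.
- by rewrite addr0; apply: Hfin.
move=> s3 [[X [rX sIX]] [an3 ar3]]; rewrite (vertex_set_reps rX).
have Eb : rmem s3 rbest 0 = rmem s rbest 0.
  by rewrite (ar3 rbest _ isT) (ar2 rbest _ isT) (ar1 rbest _ isT).
have Hb3 : recorded s3 \/ rmem s3 rbest 0 < 0.
  rewrite Eb; case: Hb => [[O [rO fO bO]]|]; [left|by right].
  exists O; split=> //; last by rewrite Eb.
  by move=> v; rewrite (an3 0%N _ isT) (an2 0%N _ isT) (an1 0%N _ isT).
apply: triple_post (triple_pure (fix_record_spec nU rX sIX Hb3)
  (f' := fun s' => rmem s' rbest 0) (g' := psi X) _) _.
  by move=> s4 [_ _ [T [rT fT le_T]]]; apply: le_trans le_T; apply: Hpsi.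
by move=> s4 [rec4 le4 _]; split=> //; rewrite -Eb.
Qed.

End Specs2.

(* Writes the r lowest digits in base n of the number in cell 43. *)
Definition decode : cmd :=
  sz ::= cell 43 ;;
  For 41 (cell sr)
    (sP ::= NLit 0 ;;
     For 42 (cell sB)
       (If (BNatLe NVert (cell sz))
         (sz ::= NSub (cell sz) NVert ;; sP ::= NAdd (cell sP) (NLit 1)) Skip) ;;
     SetNat aD (cell 41) (cell sz) ;;
     sz ::= cell sP).

Definition try_guess : cmd :=
  take_forced ;;
  For 40 (cell sr) (SetNat aR (NGet aD (cell 40)) (NLit 1)) ;;
  fix_record.

Definition attempt : cmd := decode ;; try_guess ;; try_greedy.

(** One round more than there are codes: for [n = 0 < r] there is no code at all, yet a set must be
    recorded. *)
Definition search : cmd := For 43 (NAdd (cell sB) (NLit 1)) attempt.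

(** [sL] receives the logarithm of [n], rounded up, by doubling; products and powers are repeated
    additions. [K.+1] keeps the number of greedy steps positive when [K = 0] and there are
    vertices. *)
Definition init (K : nat) : cmd :=
  sL ::= NLit 0 ;; sP ::= NLit 1 ;;
  For 44 NVert (If (BNatLe NVert (cell sP)) Skip
    (sP ::= NAdd (cell sP) (cell sP) ;; sL ::= NAdd (cell sL) (NLit 1))) ;;
  sr ::= NLit 0 ;;
  For 45 (NLit K) (sr ::= NAdd (cell sr) (NAdd (cell sL) (NLit 1))) ;;
  sz ::= NLit 0 ;;
  For 46 NVert (sz ::= NAdd (cell sz) NVert) ;;
  sN ::= NLit 0 ;;
  For 47 (NLit K.+1) (sN ::= NAdd (cell sN) (cell sz)) ;;
  sB ::= NLit 1 ;;
  For 48 (cell sr)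
    (sP ::= NLit 0 ;; For 49 NVert (sP ::= NAdd (cell sP) (cell sB)) ;;
     sB ::= cell sP) ;;
  rbest :r= RSub (RNat (NLit 0)) rone.

Definition program (K : nat) : cmd := init K ;; search.

Section Specs3.
Variables (R : realType) (J : instance R) (U : nat).
Local Notation n := (nvert J).
Local Notation k := (target J).
Local Notation I := (forced J).
Local Notation h := (reward J).
Local Notation w := (pair_weight (weight J)).
Local Notation triple := (triple J U).
Local Notation ptriple := (@ptriple R J U).
Local Notation memory := (memory R).
Local Notation recorded := (@recorded R J).
Hypothesis nU : (n <= U)%N.
Variables (N r B : nat).
Hypotheses (NU : (N <= U)%N) (N0 : (0 < n)%N -> (0 < N)%N).
Hypotheses (rU : (r <= U)%N) (BU : (B < U)%N).

(** Division by [n] is repeated subtraction; [B] rounds suffice because the number being divided is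
    at most [q < B]. The surplus code [q = B] may decode to anything. *)
Lemma decode_spec s q : nmem s 43 0 = q -> nmem s sr 0 = r -> nmem s sB 0 = B ->
  ptriple decode s (fun s' => (q < B)%N -> (0 < n)%N ->
    forall t, (t < r)%N -> nmem s' aD t = (q %/ n ^ t %% n)%N).
Proof.
move=> Eq Er EB; apply: triple_nat_seq.
pose Inv (t : nat) (s' : memory) := (q < B)%N -> (0 < n)%N ->
  nmem s' sz 0 = (q %/ n ^ t)%N /\
  forall i, (i < t)%N -> nmem s' aD i = (q %/ n ^ i %% n)%N.
apply: ptriple_post (@ptriple_for _ _ _ 41 _ _ _ r Inv _ _ _ _) _ => //.
- by move=> _ _ /=; rewrite /update /= Eq expn0 divn1.
- by move=> j s' [an _] _ _ _ /=; rewrite (an sr _ isT).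
- move=> t s1 [an1 _] tr Hinv Et; apply: triple_nat_seq; set s2 := set_nat _ _ _ _.
  pose z0 := nmem s1 sz 0.
  pose Inv2 (l : nat) (s' : memory) := z0 = (nmem s' sP 0 * n + nmem s' sz 0)%N /\
    ((nmem s' sz 0 < n)%N \/ nmem s' sP 0 = l).
  apply: triple_seqp (@ptriple_for _ _ _ 42 _ _ _ B Inv2 _ _ _ _) _.
  + exact: ltnW.
  + by split=> //; right.
  + by move=> j s' [an _] _ _ _ /=; rewrite (an sB _ isT) -EB; exact: (an1 sB 0%N isT).
  + move=> l s3 [an3 _] lB [Ez Hz] El; apply: triple_if; rewrite /=.
    case: leqP => nz.
      apply: triple_nat_seq; apply: triple_set_nat => //=; split=> //.
      rewrite /Inv2 /= /update /=; case: Hz => [|EP]; first by rewrite ltnNge nz.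
      by split; [rewrite Ez mulnDl mul1n -addnA subnKC|right; rewrite EP addn1].
    by apply: triple_skip => //; split=> //; split=> //; left.
  move=> s3 [an3 _] [Ez Hz]; apply: triple_nat_seq; apply: triple_set_nat => //=.
  have E41 : nmem s3 41 0 = t by rewrite (an3 41%N _ isT).
  split=> // qB n0; have [Ez0 HD] := Hinv qB n0.
  have lt_z : (nmem s3 sz 0 < n)%N.
    case: Hz => // EP; exfalso; move: Ez; rewrite EP /z0 Ez0.
    by have := leq_div q (n ^ t)%N; move: qB n0; clear; nia.
  rewrite /= /update /= E41; split.
    by rewrite expnSr divnMA -Ez0 -/z0 Ez divnMDl // divn_small // addn0.
  move=> i; rewrite ltnS leq_eqVlt => /orP[/eqP->|it].
    by rewrite eqxx -Ez0 -/z0 Ez modnMDl modn_small.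
  by rewrite ltn_eqF //= (an3 aD _ isT); apply: HD.
by move=> s' H qB n0; case: (H qB n0).
Qed.

Definition guessed (s : memory) : {set 'I_n} :=
  [set v : 'I_n | [exists t : 'I_r, nmem s aD t == v :> nat]].

(** A feasible [I :|: guessed s] already has size [k], so [resized] forces the repaired set to equal
    it. *)
Lemma try_guess_spec s : nmem s sr 0 = r -> recorded s \/ rmem s rbest 0 < 0 ->
  ptriple try_guess s (fun s' => [/\ recorded s', rmem s rbest 0 <= rmem s' rbest 0 &
    forall T, feasible J T -> T = I :|: guessed s -> obj T <= rmem s' rbest 0]).
Proof.
move=> Er Hb; apply: triple_seqp (take_forced_spec nU s) _ => s1 [an1 ar1] r1.
pose part (t : nat) := I :|:
  [set v : 'I_n | [exists i : 'I_r, (i < t)%N && (nmem s aD i == v :> nat)]].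
apply: triple_seqp (@ptriple_for _ _ _ 40 _ _ _ r (fun t s' => reps s' aR (part t)) rU _ _ _) _.
- move=> v; rewrite /= /update /= r1 /part !inE; congr (nat_of_bool _).
  by rewrite [X in _ || X](_ : _ = false) ?orbF //; apply/existsP => -[i].
- by move=> j s' [an _] _ _ _ /=; rewrite (an sr _ isT) (an1 sr _ isT).
- move=> t s2 [an2 ar2] tr H2 Et; apply: triple_set_nat => //=; split=> // v.
  rewrite /= /update /= Et (an2 aD _ isT) (an1 aD _ isT).
  have [Ev|nv] := eqVneq (v : nat) (nmem s aD t).
    rewrite !inE; have -> : [exists i : 'I_r, (i < t.+1)%N && (nmem s aD i == v)] = true.
      by apply/existsP; exists (Ordinal tr); rewrite /= ltnSn Ev eqxx.
    by rewrite orbT.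
  rewrite H2 !inE; congr (nat_of_bool (_ || _)); apply: eq_existsb => i.
  rewrite ltnS [in RHS]leq_eqVlt; have [Ei|//] := eqVneq (i : nat) t.
  by rewrite Ei ltnn /= eq_sym (negPf nv).
move=> s2 [an2 ar2] r2.
have Eb : rmem s2 rbest 0 = rmem s rbest 0 by rewrite (ar2 rbest _ isT) (ar1 rbest _ isT).
have Hb2 : recorded s2 \/ rmem s2 rbest 0 < 0.
  rewrite Eb; case: Hb => [[O [rO fO bO]]|]; [left|by right].
  exists O; split=> //; last by rewrite Eb.
  by move=> v; rewrite (an2 0%N _ isT) (an1 0%N _ isT).
have Ep : part r = I :|: guessed s.
  by congr (_ :|: _); apply/setP => v; rewrite !inE; apply: eq_existsb => i; rewrite ltn_ord.
apply: ptriple_post (fix_record_spec nU r2 _ Hb2) _; first exact: subsetUl.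
move=> s3 [rec3 le3 [T [[sIT kT up _] fT obj3]]]; split=> //; first by rewrite -Eb.
move=> T' /andP[/eqP kT' _] ET'; rewrite Ep -ET' kT' in up.
suff -> : T' = T by [].
by apply/eqP; rewrite eqEcard up //= kT kT'.
Qed.

Lemma gain_le_total (X : {set 'I_n}) v : gain h X v <= h setT.
Proof.
have : h (v |: X) <= h setT by apply: reward_monotone; apply: subsetT.
by have := reward_ge0 (i := J) X; rewrite /gain; lra.
Qed.

Lemma try_greedy_pure s : nmem s sN 0 = N -> nmem s sr 0 = r ->
  recorded s \/ rmem s rbest 0 < 0 ->
  ptriple try_greedy s (fun s' => recorded s' /\ rmem s rbest 0 <= rmem s' rbest 0).
Proof.
move=> EN Er Hb.
apply: ptriple_of (@try_greedy_spec R J U nU N NU N0 s r 0 (h setT) (fun _ _ => 0)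
  (fun=> 0) (lexx 0) gain_le_total EN Er rU Hb _ _ _).
- by move=> j c acc Z _ _ _ _ _; rewrite !mul0r.
- by move=> c _; rewrite mean_const.
- by move=> X T _ _ _; apply: obj_ge0.
Qed.

Definition ready (s : memory) : Prop :=
  [/\ nmem s sN 0 = N, nmem s sr 0 = r & nmem s sB 0 = B].

Lemma attempt_pure s : ready s -> recorded s \/ rmem s rbest 0 < 0 ->
  ptriple attempt s (fun s' => recorded s' /\ rmem s rbest 0 <= rmem s' rbest 0).
Proof.
move=> [EN Er EB] Hb.
apply: triple_seqp (decode_spec (erefl _) Er EB) _ => s2 [an2 ar2] _.
have Hb2 : recorded s2 \/ rmem s2 rbest 0 < 0.
  rewrite (ar2 rbest _ isT); case: Hb => [[O [rO fO bO]]|]; [left|by right].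
  exists O; split=> //; last by rewrite (ar2 rbest _ isT).
  by move=> v; rewrite (an2 0%N _ isT).
have Er2 : nmem s2 sr 0 = r by rewrite (an2 sr _ isT).
apply: triple_seqp (try_guess_spec Er2 Hb2) _ => s3 [an3 ar3] [rec3 le3 _].
apply: ptriple_post (try_greedy_pure _ _ _) _.
- by rewrite (an3 sN _ isT) (an2 sN _ isT).
- by rewrite (an3 sr _ isT).
- by left.
move=> s4 [rec4 le4]; split=> //; apply: le_trans le4; apply: le_trans le3.
by rewrite (ar2 rbest _ isT).
Qed.

(* Iteration q is the one whose guess suits the optimum. *)
Lemma search_spec s q (g : R) : ready s -> rmem s rbest 0 < 0 -> (q <= B)%N ->
  (forall s', ready s' -> nmem s' 43 0 = q -> recorded s' \/ rmem s' rbest 0 < 0 ->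
     triple attempt s' (fun s2 => recorded s2 /\ rmem s' rbest 0 <= rmem s2 rbest 0)
       (fun s2 => rmem s2 rbest 0) g) ->
  triple search s recorded (fun s' => rmem s' rbest 0) g.
Proof.
move=> [EN Er EB] b0 qB Hq.
pose Inv (j : nat) (s' : memory) :=
  (recorded s' \/ rmem s' rbest 0 < 0) /\ ((0 < j)%N -> recorded s').
pose phi (j : nat) (s' : memory) := if (j <= q)%N then g else rmem s' rbest 0.
have loop : triple search s (fun s' => agree search s s' /\ Inv B.+1 s')
    (phi B.+1) (phi 0%N (set_nat s 43 0 0)).
  apply: triple_for => //.
  - by split=> //; right.
  - by move=> j s' [an _] _ _ _ /=; rewrite (an sB _ isT) EB addn1.
  move=> j s1 [an1 ar1] jB [Hb _] Ej.
  have rd : ready s1 by split; rewrite ?(an1 sN _ isT) ?(an1 sr _ isT) ?(an1 sB _ isT).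
  have := Hq s1 rd; have [Ejq|nj] := eqVneq j q.
    rewrite -{1}Ejq => /(_ Ej Hb) ta; apply: (triple_conseq (a := 0) (triple_frame ta)).
      move=> s2 [[rec2 le2] [an2 _]]; split.
        split; first by rewrite (an2 43%N _ isT).
        by split; [left|].
      by rewrite addr0 /phi Ejq ltnn.
    by rewrite addr0 /phi Ejq leqnn.
  move=> _.
  have ta := attempt_pure rd Hb.
  apply: triple_post (triple_pure (triple_frame ta)
    (f' := fun s2 => phi j.+1 (set_nat s2 43 0 j.+1)) (g' := phi j s1) _) _.
    move=> s2 [[_ le2] _]; rewrite /phi ltn_neqAle nj /=.
    by case: (j <= q)%N.
  move=> s2 [[rec2 le2] [an2 _]]; split; first by rewrite (an2 43%N _ isT).
  by split; [left|].
apply: (triple_conseq (a := 0) loop); last by rewrite addr0.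
move=> s' [_ [_ rec]]; split; first exact: rec.
by rewrite addr0 /phi ltnNge qB.
Qed.

End Specs3.

Section Init.
Variables (R : realType) (J : instance R) (U K : nat).
Local Notation n := (nvert J).
Hypotheses (nU : (n <= U)%N) (KU : (K < U)%N).

Lemma init_spec : (forall L, (2 ^ L.-1 <= n.+1)%N -> K * L.+1 <= U)%N ->
  @ptriple R J U (init K) (memory0 R) (fun s' => exists L,
    [/\ (n <= 2 ^ L)%N, (L = 0 \/ 2 ^ L.-1 < n)%N,
        ready (K.+1 * (n * n)) (K * L.+1) (n ^ (K * L.+1)) s' & rmem s' rbest 0 = -1]).
Proof.
move=> HU.
do 2 apply: triple_nat_seq; set s0 := set_nat _ _ _ _.
pose Inv (j : nat) (s : memory R) := [/\ nmem s sP 0 = (2 ^ nmem s sL 0)%N,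
  (nmem s sL 0 = 0 \/ 2 ^ (nmem s sL 0).-1 < n)%N &
  (n <= nmem s sP 0)%N \/ nmem s sL 0 = j].
apply: triple_seqp (@ptriple_forv _ _ _ nU 44 _ _ Inv _ _) _.
- by split; [|left|right].
- move=> v s [an _] [EP EL H] Ev; apply: triple_if => /=; case: leqP => nP.
    by apply: triple_skip => //; split=> //; split=> //; left.
  apply: triple_nat_seq; apply: triple_set_nat => //=; split=> //.
  rewrite /Inv /= /update /= addn1 /=; split.
  + by rewrite EP expnS mul2n addnn.
  + by right; rewrite -EP.
  + by right; case: H => [|->] //; rewrite leqNgt nP.
move=> s1 _ [EP EL Hn]; set L := nmem s1 sL 0 in EP EL Hn.
have nL : (n <= 2 ^ L)%N.
  by case: Hn => [|<-]; [rewrite EP|apply/ltnW/ltn_expl].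
have LU : (K * L.+1 <= U)%N.
  by apply: HU; case: EL => [->|/ltnW/leqW] //.
apply: triple_nat_seq.
apply: triple_seqp (@ptriple_for _ _ _ 45 _ _ _ K (fun j s => nmem s sr 0 = j * L.+1)%N (ltnW KU) _ _ _) _ => //.
- move=> j s [an _] _ Es Ej; apply: triple_set_nat => //=; split=> //.
  by rewrite /update /= Es (an sL _ isT) /= -/L addn1 mulSn addnC.
move=> s2 [an2 _] E2; apply: triple_nat_seq.
apply: triple_seqp (@ptriple_forv _ _ _ nU 46 _ _ (fun j s => nmem s sz 0 = j * n)%N _ _) _ => //.
- move=> j s _ Es Ej; apply: triple_set_nat => //=; split=> //.
  by rewrite /update /= Es mulSn addnC.
move=> s3 [an3 _] E3; apply: triple_nat_seq.
apply: triple_seqp (@ptriple_for _ _ _ 47 _ _ _ K.+1 (fun j s => nmem s sN 0 = j * (n * n))%N KU _ _ _) _ => //.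
- move=> j s [an _] _ Es Ej; apply: triple_set_nat => //=; split=> //.
  by rewrite /update /= Es (an sz _ isT) /= /update /= E3 mulSn addnC.
move=> s4 [an4 _] E4; apply: triple_nat_seq; set s5 := set_nat _ _ _ _.
have Er5 : nmem s5 sr 0 = (K * L.+1)%N.
  by rewrite /= /update /= (an4 sr _ isT) /= /update /= (an3 sr _ isT) /= /update /= E2.
apply: triple_seqp (@ptriple_for _ _ _ 48 _ _ _ _ (fun j s => nmem s sB 0 = n ^ j)%N LU _ _ _) _ => //.
- by move=> j s [an _] _ _ _ /=; rewrite (an sr _ isT).
- move=> j s _ _ Es Ej; apply: triple_nat_seq.
  apply: triple_seqp (@ptriple_forv _ _ _ nU 49 _ _ (fun l s' => nmem s' sP 0 = l * n ^ j)%N _ _) _ => //.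
    move=> l s' [an' _] El' Ei; apply: triple_set_nat => //=; split=> //.
    by rewrite /update /= El' (an' sB _ isT) /= /update /= Es mulSn addnC.
  move=> s' [an' _] El'; apply: triple_set_nat => //=; split; first by rewrite /update /= (an' 48%N _ isT).
  by rewrite /update /= El' expnS.
move=> s6 [an6 _] E6; apply: triple_set_real => //; exists L; split=> //.
  split=> //=; first by rewrite (an6 sN _ isT).
  by rewrite (an6 sr _ isT).
by rewrite /= /update /= sub0r.
Qed.

End Init.

(** * Quality and running time *)

Lemma exists_code (n r : nat) (f : nat -> nat) : (forall t, (t < r)%N -> (f t < n)%N) ->
  exists2 q, (q < n ^ r)%N & forall t, (t < r)%N -> (q %/ n ^ t %% n)%N = f t.
Proof.
elim: r f => [|r IH] f Hf; first by exists 0%N.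
have [q qr Hq] := IH (fun t => f t.+1) (fun t tr => Hf t.+1 tr).
have f0 := Hf 0%N isT; have n0 : (0 < n)%N by apply: leq_ltn_trans f0.
exists (q * n + f 0)%N.
  rewrite expnSr; apply: (@leq_trans (q.+1 * n)); last by rewrite leq_mul2r qr orbT.
  by rewrite mulSn addnC ltn_add2r.
case=> [_|t tr]; first by rewrite expn0 divn1 modnMDl modn_small.
by rewrite expnS divnMA divnMDl // (divn_small f0) addn0 Hq.
Qed.

Lemma superset_of_size (V : finType) (X : {set V}) k : (#|X| <= k <= #|V|)%N ->
  exists2 T : {set V}, X \subset T & #|T| = k.
Proof.
move=> /andP[Xk kV]; move: {2}(k - #|X|)%N (leqnn (k - #|X|)) => d.
elim: d X Xk => [|d IH] X Xk le_d.
  by exists X => //; apply/eqP; rewrite eqn_leq Xk -subn_eq0 -leqn0.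
have [E|Xlt] := eqVneq #|X| k; first by exists X.
have lt_X : (#|X| < k)%N by rewrite ltn_neqAle Xlt.
have /card_gt0P[v vX] : (0 < #|~: X|)%N by rewrite cardsCs setCK subn_gt0 (leq_trans lt_X).
have vX' : v \notin X by rewrite inE in vX.
have cX : #|v |: X| = #|X|.+1 by rewrite cardsU1 vX' add1n.
have [||T sT kT] := IH (v |: X); rewrite ?cX //; first by move: le_d; clear -lt_X; lia.
by exists T => //; apply: subset_trans sT; apply: subsetUr.
Qed.

Section Quality.
Variables (R : realType) (J : instance R) (U s L : nat).
Local Notation n := (nvert J).
Local Notation k := (target J).
Local Notation I := (forced J).
Local Notation h := (reward J).
Local Notation w := (pair_weight (weight J)).
Local Notation K := (8 * s ^ 2)%N.
Local Notation N := (K.+1 * (n * n))%N.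
Local Notation r := (K * L.+1)%N.
Local Notation B := (n ^ r)%N.
Local Notation triple := (triple J U).
Local Notation memory := (memory R).
Local Notation recorded := (@recorded R J).
Hypotheses (nU : (n <= U)%N) (NU : (N <= U)%N) (rU : (r <= U)%N) (BU : (B < U)%N).
Hypotheses (s0 : (0 < s)%N) (nL : (n <= 2 ^ L)%N).

Lemma weightC (u v : 'I_n) : w u v = w v u.
Proof. by rewrite /pair_weight eq_sym setUC. Qed.

Lemma weightvv (v : 'I_n) : w v v = 0.
Proof. by rewrite /pair_weight eqxx. Qed.

Lemma pairs_le (T : {set 'I_n}) : kap R #|T| * pairs w T <= 1.
Proof.
case: (leqP #|T| 1) => [T1|T2].
  rewrite (_ : kap R #|T| = 0) ?mul0r ?ler01 // /kap.
  by case: #|T| T1 => [|[|]] //; rewrite ?mul0r ?subrr ?mulr0 ?invr0 ?mulr0.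
have kR : 2 <= #|T|%:R :> R by rewrite ler_nat.
have k0 : 0 < #|T|%:R * (#|T|%:R - 1) :> R by rewrite mulr_gt0; lra.
rewrite /kap mul1r mulrC ler_pdivrMr // mul1r.
apply: (@le_trans _ _ (\sum_(u in T) \sum_(v in T :\ u) 1)).
  apply: ler_sum => u uT; rewrite (bigD1 u) //= weightvv add0r.
  rewrite [X in _ <= X](eq_bigl (fun v => (v \in T) && (v != u))); last by move=> v; rewrite !inE andbC.
  by apply: ler_sum => v _; case/andP: (weight_range u v).
have E u : u \in T -> \sum_(v in T :\ u) (1 : R) = #|T|%:R - 1.
  move=> uT; rewrite sumr_const [in RHS](cardsD1 u) uT add1n -natr1; ring.
by rewrite (eq_bigr (fun=> #|T|%:R - 1)) // sumr_const mulr_natl.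
Qed.

Variables (O : {set 'I_n}) (H : R).
Hypotheses (fO : feasible J O) (HH : forall T, feasible J T -> h T <= H).

(** Of the loss, [(H + 6) / s] is due to rounding, [(2 * H + 6) / s] to the greedy steps and [3 / s]
    to the initial potential. *)
Definition guarantee : R :=
  (1 - (expR 1)^-1) * h O + den (weight J) O - (3 * H + 15) / s%:R.

Lemma H_ge0 : 0 <= H.
Proof. by apply: le_trans (HH fO); apply: reward_ge0. Qed.

Lemma guarantee_le : guarantee <= obj O.
Proof.
have : 0 <= (3 * H + 15) / s%:R by rewrite divr_ge0 // addr_ge0 // mulr_ge0 // H_ge0.
have : 0 <= (expR 1)^-1 * h O by rewrite mulr_ge0 ?reward_ge0 // invr_ge0 expR_ge0.
by rewrite /guarantee /obj; lra.
Qed.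

Lemma attempt_small q : (q < B)%N -> (0 < n)%N ->
  (forall D : nat -> nat, (forall t, (t < r)%N -> D t = (q %/ n ^ t %% n)%N) ->
     O = I :|: [set v : 'I_n | [exists t : 'I_r, D t == v :> nat]]) ->
  forall s', ready N r B s' -> nmem s' 43 0 = q -> recorded s' \/ rmem s' rbest 0 < 0 ->
  triple attempt s' (fun s2 => recorded s2 /\ rmem s' rbest 0 <= rmem s2 rbest 0)
    (fun s2 => rmem s2 rbest 0) guarantee.
Proof.
move=> qB n0 HO s1 [EN Er EB] Eq Hb.
have N0 : (0 < n)%N -> (0 < N)%N by move=> _; rewrite !muln_gt0 n0.
apply: triple_seqp (decode_spec J rU BU Eq Er EB) _ => s2 [an2 ar2] /(_ qB n0) HD.
have Hb2 : recorded s2 \/ rmem s2 rbest 0 < 0.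
  rewrite (ar2 rbest _ isT); case: Hb => [[T [rT fT bT]]|]; [left|by right].
  exists T; split=> //; last by rewrite (ar2 rbest _ isT).
  by move=> v; rewrite (an2 0%N _ isT).
have Er2 : nmem s2 sr 0 = r by rewrite (an2 sr _ isT).
apply: triple_seqp (try_guess_spec nU rU Er2 Hb2) _ => s3 [an3 ar3] [rec3 le3 best3].
have EN3 : nmem s3 sN 0 = N by rewrite (an3 sN _ isT) (an2 sN _ isT).
have Er3 : nmem s3 sr 0 = r by rewrite (an3 sr _ isT).
have tp := try_greedy_pure nU NU N0 rU EN3 Er3 (or_introl rec3).
apply: triple_post (triple_pure tp (f' := fun s2 => rmem s2 rbest 0) (g' := guarantee) _) _.
  move=> s4 [_ le4]; apply: le_trans guarantee_le _; apply: le_trans le4.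
  by apply: best3 => //; apply: HO.
move=> s4 [rec4 le4]; split=> //; apply: le_trans le4; apply: le_trans le3.
by rewrite (ar2 rbest _ isT).
Qed.

Lemma attempt_large q (f : 'I_r -> 'I_n) : (q < B)%N -> (r < k - #|I|)%N ->
  (forall v, `|k%:R / r%:R * (\sum_(t < r) w (f t) v) - \sum_(u in O) w u v|
             <= k%:R / s%:R) ->
  (forall t : 'I_r, (q %/ n ^ t %% n)%N = f t) ->
  forall s', ready N r B s' -> nmem s' 43 0 = q -> recorded s' \/ rmem s' rbest 0 < 0 ->
  triple attempt s' (fun s2 => recorded s2 /\ rmem s' rbest 0 <= rmem s2 rbest 0)
    (fun s2 => rmem s2 rbest 0) guarantee.
Proof.
move=> qB rk Hf Hq s1 [EN Er EB] Eq Hb.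
have /andP[Ik kn] := target_range J.
have Ik' : (#|I| < k)%N by move: rk; clear; lia.
have n0 : (0 < n)%N by move: Ik' kn; clear; lia.
have N0 : (0 < N)%N by rewrite !muln_gt0 n0.
have K8 : (8 <= K)%N by rewrite -{1}[8%N]muln1 leq_mul2l /= expn_gt0 s0.
have k2 : (1 < k)%N by move: rk K8; clear; nia.
apply: triple_seqp (decode_spec J rU BU Eq Er EB) _ => s2 [an2 ar2] /(_ qB n0) HD.
have Hb2 : recorded s2 \/ rmem s2 rbest 0 < 0.
  rewrite (ar2 rbest _ isT); case: Hb => [[T [rT fT bT]]|]; [left|by right].
  exists T; split=> //; last by rewrite (ar2 rbest _ isT).
  by move=> v; rewrite (an2 0%N _ isT).
have Er2 : nmem s2 sr 0 = r by rewrite (an2 sr _ isT).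
apply: triple_seqp (try_guess_spec nU rU Er2 Hb2) _ => s3 [an3 ar3] [rec3 le3 _].
have EN3 : nmem s3 sN 0 = N by rewrite (an3 sN _ isT) (an2 sN _ isT).
have Er3 : nmem s3 sr 0 = r by rewrite (an3 sr _ isT).
have H0 := H_ge0.
have sR : 1 <= s%:R :> R by rewrite ler1n.
have s0' : 0 < s%:R :> R by lra.
have nR : 1 <= n%:R :> R by rewrite ler1n.
have NR : 0 < N%:R :> R by rewrite ltr0n.
have /andP[/eqP cO sIO] := fO.
(* The summand 1 keeps [Bd], and with it [tau], positive when [H = 0]. *)
pose Bd : R := H + 1.
have Bd0 : 0 < Bd by rewrite /Bd; lra.
(* Gains are largest at the empty set, and as [#|I| < k], the set [v |: I] extends to a feasible
   one, whose reward is at most [H]. *)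
have gB (X : {set 'I_n}) (v : 'I_n) : gain h X v <= Bd.
  apply: le_trans (gain_decr (@reward_monotone _ J) (@reward_submodular _ J) v (sub0set X)) _.
  have [|T sT kT] := @superset_of_size _ (v |: I) k.
    by rewrite card_ord kn andbT cardsU1; case: (v \notin I); rewrite ?add0n // add1n.
  have : h (v |: set0) <= H.
    apply: le_trans (HH (T := T) _).
      by apply: reward_monotone; rewrite setU0 (subset_trans _ sT) // subsetUl.
    by rewrite /feasible kT eqxx (subset_trans _ sT) // subsetUr.
  by have := reward_ge0 (i := J) set0; rewrite /gain /Bd; lra.
pose y := @guess_degree R J s3 r.
pose E : R := k%:R / s%:R.
(* Over all [N] steps, each of the two noise terms of [step_error] is now at most [Bd / (2 * s)],
   because [n ^ 2 * s ^ 2 <= N]. *)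
pose tau : R := N%:R * Bd / (n%:R * s%:R).
have tau0 : 0 < tau by rewrite divr_gt0 ?mulr_gt0 //; lra.
have yE u : `|y u - \sum_(v in O) w u v| <= E.
  have -> : y u = k%:R / r%:R * (\sum_(t < r) w (f t) u).
    rewrite /y /guess_degree big_mkord mulr_sumr; apply: eq_bigr => t _; congr (_ * _).
    by rewrite (an3 aD _ isT) HD // Hq read_weightE.
  have -> : \sum_(v in O) w u v = \sum_(v in O) w v u by apply: eq_bigr => v _; apply: weightC.
  exact: Hf.
pose lam : R := (2 * tau * N%:R ^+ 2)^-1.
have lam0 : 0 <= lam by rewrite invr_ge0 mulr_ge0 ?sqr_ge0 // mulr_ge0 // ltW.
have lamE (t x a b : R) : 0 < t -> 0 < x ->
    a * b ^+ 2 / (2 * t * x) = (2 * t * x ^+ 2)^-1 * (x * a) * b ^+ 2.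
  by move=> t0 x0; field; rewrite !gt_eqF.
pose loss : R := (H + 6) / s%:R.
pose phi j (c : {ffun 'I_n -> nat}) := potential h w N k y O Bd E tau j c - loss.
have tg : triple try_greedy s3 (fun s' => recorded s' /\ rmem s3 rbest 0 <= rmem s' rbest 0)
    (fun s' => rmem s' rbest 0) (phi 0%N [ffun=> 0%N]).
  apply: (@try_greedy_spec _ _ _ nU N NU (fun=> N0) s3 r lam Bd phi (rounded h w I k H s)
    lam0 gB EN3 Er3 rU (or_introl rec3)).
  - move=> j c acc Z jN [c1 c2 c3] kZ sIZ top.
    have := potential_step (@reward_monotone _ J) (@reward_submodular _ J)
      (@weight_range _ J) weightC gB N0 cO yE tau0 (ltW Bd0) jN c1 c2 kZ (top O fO).
    rewrite -/lam card_ord.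
    have -> : n%:R * Bd ^+ 2 / (2 * tau * N%:R) = lam * (N%:R * n%:R) * Bd ^+ 2.
      exact: lamE.
    have -> : (fun v => c v + (v \in Z))%N = add_set c Z :> ('I_n -> nat).
      by apply: funext => v; rewrite ffunE.
    rewrite /phi; lra.
  - move=> c [c1 c2 c3]; rewrite /phi potentialN //.
    have p01 : unit_range (fractional R N c).
      move=> v; rewrite /fractional mulr_ge0 ?invr_ge0 ?(ltW NR) //=.
      by rewrite mulrC ler_pdivrMr // mul1r ler_nat.
    have sp : \sum_v fractional R N c v = k%:R.
      by rewrite -mulr_sumr -natr_sum c2 [(N * k)%:R]natrM mulKf ?gt_eqF.
    have pI v : v \in I -> fractional R N c v = 1.
      by move=> vI; rewrite /fractional c3 // mulVf ?gt_eqF.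
    have sk : (s ^ 2 <= k - #|I|)%N.
      by apply: leq_trans (ltnW rk); clear; nia.
    have := mean_rounded h weightvv s H0 Ik' p01 sp pI.
    by have := rounding_error H0 s0 Ik' k2 sk; rewrite /loss; lra.
  - move=> X T sIX rT fT; have /andP[/eqP kT _] := fT.
    have := resized_value (@reward_monotone _ J) (@weight_range _ J) H0 s0 Ik' sIX rT (HH fT).
    by rewrite /obj (den_pairs _ kT).
apply: (triple_conseq (a := 0) tg).
  move=> s4 [rec4 le4]; rewrite addr0; split=> //; split=> //.
  by apply: le_trans le4; apply: le_trans le3; rewrite (ar2 rbest _ isT).
rewrite addr0 /phi.
have := potential0 w (@reward_ge0 _ J) k y O Bd E tau N0
  (c := ([ffun=> 0%N] : {ffun 'I_n -> nat})) (fun v => ffunE _ v).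
set P0 := potential _ _ _ _ _ _ _ _ _ _ _.
rewrite /guarantee (den_pairs _ cO).
have kR : 2 <= k%:R :> R by rewrite ler_nat.
have knR : k%:R <= n%:R :> R by rewrite ler_nat.
have kk : kap R k * (k%:R * (k%:R - 1)) = 1.
  by rewrite /kap mul1r mulVf // mulf_neq0 // gt_eqF //; lra.
have kk0 := kap_ge0 R k.
have kk2 : kap R k * k%:R ^+ 2 <= 2.
  have : kap R k * k%:R ^+ 2 <= kap R k * (2 * (k%:R * (k%:R - 1))) by apply: ler_wpM2l => //; nra.
  lra.
have W1 : kap R k * pairs w O <= 1 by rewrite -cO pairs_le.
have NE : N%:R = (8 * s%:R ^+ 2 + 1) * n%:R ^+ 2 :> R.
  by rewrite natrM -natr1 natrM natrX natrM; ring.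
set i : R := s%:R^-1.
have i0 : 0 < i by rewrite invr_gt0.
have is1 : i * s%:R = 1 by rewrite mulVf ?gt_eqF.
have i1 : i <= 1 by rewrite invf_le1.
have n20 : 0 < n%:R ^+ 2 :> R by rewrite exprn_gt0 //; lra.
have n21 : 1 <= n%:R ^+ 2 :> R by rewrite exprn_ege1.
have ss := sqr_ge0 (s%:R : R).
have le_sN : s%:R <= N%:R * i.
  rewrite -(ler_pM2r s0') -mulrA is1 mulr1 NE.
  have : 0 <= (8 * s%:R ^+ 2 + 1) * (n%:R ^+ 2 - 1) :> R by rewrite mulr_ge0 //; lra.
  rewrite -expr2; lra.
have N1 : N%:R^-1 <= i.
  by rewrite lef_pV2 ?posrE //; apply: le_trans le_sN _; rewrite ler_piMr // ltW.
have nsN : n%:R ^+ 2 * s%:R <= N%:R * i.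
  rewrite -(ler_pM2r s0') -[N%:R * i * _]mulrA is1 mulr1 NE.
  have : 0 <= (7 * s%:R ^+ 2 + 1) * n%:R ^+ 2 :> R by rewrite mulr_ge0 //; lra.
  rewrite -mulrA -expr2; lra.
have errE : N%:R * step_error 'I_n N k Bd E tau =
    2 * (kap R k * k%:R ^+ 2) * i + k%:R ^+ 2 * Bd / N%:R + Bd * i / 2 +
    n%:R ^+ 2 * s%:R * Bd / (2 * N%:R).
  rewrite /step_error card_ord /E /tau /i; move: NR; set NN := N%:R => NN0.
  by field; rewrite !gt_eqF //; lra.
have e1 : k%:R ^+ 2 * Bd / N%:R <= Bd * i.
  rewrite ler_pdivrMr //.
  have : k%:R ^+ 2 <= N%:R * i.
    apply: le_trans nsN; apply: (@le_trans _ _ (n%:R ^+ 2)); first by rewrite lerXn2r ?nnegrE.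
    by rewrite ler_peMr // ltW.
  move/(ler_wpM2l (ltW Bd0)); lra.
have e2 : n%:R ^+ 2 * s%:R * Bd / (2 * N%:R) <= Bd * i / 2.
  rewrite ler_pdivrMr ?mulr_gt0 //.
  by move: nsN => /(ler_wpM2l (ltW Bd0)); lra.
have e3 : (1 - N%:R^-1) * (kap R k * (pairs w O - k%:R * E)) >=
    kap R k * pairs w O - i - 2 * i.
  have -> : kap R k * (pairs w O - k%:R * E) =
     kap R k * pairs w O - kap R k * k%:R ^+ 2 * i by rewrite /E -/i; ring.
  have iN0 : 0 < N%:R^-1 :> R by rewrite invr_gt0.
  have := ler_wpM2r (ltW i0) kk2.
  have : 0 <= kap R k * k%:R ^+ 2 * i by apply: mulr_ge0; [apply: mulr_ge0 => //; apply: sqr_ge0|exact: ltW].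
  set a := kap R k * pairs w O in W1 *; set b := _ * i; set x := N%:R^-1 in N1 iN0 *.
  move=> b0 b2.
  have : x * a <= x by rewrite ler_piMr // ltW.
  have : 0 <= x * b by rewrite mulr_ge0 // ltW.
  lra.
rewrite errE /loss -/i; have := ler_wpM2r (ltW i0) kk2; rewrite /Bd.
move: e1 e2 e3; rewrite /Bd.
set x1 := _ / N%:R; set x2 := _ / (2 * N%:R); set x3 := (1 - _) * (kap R k * _).
set x4 := kap R k * k%:R ^+ 2; set x5 := kap R k * pairs w O; set x6 := (1 - _) * h O.
lra.
Qed.

(** If [k - #|I| <= r], the code lists [O :\: I], padded with an element of [O]. Otherwise it lists
    the sparse multiset, and the size of [r] also provides the [s ^ 2 <= k - #|I|] that rounding
    requires. *)
Lemma attempt_quality : (0 < k)%N -> exists2 q, (q <= B)%N &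
  forall s', ready N r B s' -> nmem s' 43 0 = q -> recorded s' \/ rmem s' rbest 0 < 0 ->
  triple attempt s' (fun s2 => recorded s2 /\ rmem s' rbest 0 <= rmem s2 rbest 0)
    (fun s2 => rmem s2 rbest 0) guarantee.
Proof.
move=> k0; have /andP[Ik kn] := target_range J; have /andP[/eqP cO sIO] := fO.
have n0 : (0 < n)%N by apply: leq_trans kn.
case: (leqP (k - #|I|) r) => [small|large].
  have /card_gt0P[o oO] : (0 < #|O|)%N by rewrite cO.
  pose D := enum (O :\: I).
  have sD : (size D <= r)%N by rewrite -cardE cardsD (setIidPr sIO) cO.
  pose f t := nth o D t.
  have fD t : f t \in O.
    case: (ltnP t (size D)) => tD; last by rewrite /f nth_default.
    by have := mem_nth o tD; rewrite mem_enum => /setDP[].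
  have [q qB Hq] := @exists_code n r (fun t => f t) (fun t _ => ltn_ord (f t)).
  exists q; first exact: ltnW.
  apply: attempt_small => // E HE; apply/setP => v; rewrite !inE.
  apply/idP/idP => [vO|].
    case: (boolP (v \in I)) => //= vI; apply/existsP.
    have vD : v \in D by rewrite mem_enum inE vI.
    have lt_v : (index v D < r)%N by apply: leq_trans sD; rewrite index_mem.
    by exists (Ordinal lt_v); rewrite HE //= Hq // /f nth_index.
  case/orP=> [/(subsetP sIO)//|/existsP[t /eqP Et]].
  have : f t = v by apply: ord_inj; rewrite -Et HE // Hq.
  by move<-.
have [||f fI Hf] := @sparse_neighbourhood R 'I_n w (@weight_range _ J) O r s L _ s0 _ (leqnn _).
- by rewrite cO.
- by rewrite card_ord.
rewrite cO in Hf.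
have r0 : (0 < r)%N by rewrite !muln_gt0 /= s0.
pose g t := f (insubd (Ordinal r0) t).
have [q qB Hq] := @exists_code n r (fun t => g t) (fun t _ => ltn_ord (g t)).
exists q; first exact: ltnW.
apply: (attempt_large qB large Hf) => t; rewrite Hq // /g; congr (nat_of_ord (f _)).
exact: valKd.
Qed.

End Quality.

(** * Worst-case cost and the assembled run *)

Fixpoint cdepth (c : cmd) : nat :=
  match c with
  | Seq c1 c2 | If _ c1 c2 => maxn (cdepth c1) (cdepth c2)
  | While _ c1 => (cdepth c1).+1
  | _ => 0
  end.

Lemma tcost_le U c : (tcost U c <= tcost 0 c * U.+1 ^ cdepth c)%N.
Proof.
have pos d : (0 < U.+1 ^ d)%N by rewrite expn_gt0.
have mono d e : (d <= e)%N -> (U.+1 ^ d <= U.+1 ^ e)%N by move=> de; rewrite leq_pexp2l.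
elim: c => [|c1 IH1 c2 IH2|a i e|a i e|b c1 IH1 c2 IH2|b c1 IH1|a i e|a i b] /=;
  rewrite ?expn0 ?muln1 //.
- set d := maxn _ _.
  have := leq_trans IH1 (leq_mul (leqnn _) (mono _ d (leq_maxl _ _))).
  have := leq_trans IH2 (leq_mul (leqnn _) (mono _ d (leq_maxr _ _))).
  by have := pos d; nia.
- set d := maxn _ _.
  have := leq_trans IH1 (leq_mul (leqnn _) (mono _ d (leq_maxl _ _))).
  have := leq_trans IH2 (leq_mul (leqnn _) (mono _ d (leq_maxr _ _))).
  by have := pos d; nia.
- rewrite mul1n expnS mulnCA leq_mul2l /=.
  by have := pos (cdepth c1); move: IH1; nia.
Qed.

(** A literal costs one unit whatever its value, so this constant is independent of [gamma]; [K]
    enters the time only through [U]. *)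
Lemma tcost_program K : tcost 0 (program K) = tcost 0 (program 0).
Proof. by []. Qed.

Lemma cdepth_program K : cdepth (program K) = 4%N.
Proof. by []. Qed.

Lemma always_imp (R : realType) (J : instance R) t x (Q Q' : config R -> Prop) :
  (forall y, Q y -> Q' y) -> always J t x Q -> always J t x Q'.
Proof.
move=> QQ; elim: t x => [|t IH] x /=; first exact: QQ.
by case: (step J x) => [|m next]; [exact: QQ|move=> H i; apply: IH].
Qed.

Section Run.
Variables (R : realType) (J : instance R) (U K : nat).
Local Notation n := (nvert J).
Local Notation N := (K.+1 * (n * n))%N.
Hypotheses (nU : (n <= U)%N) (KU : (K < U)%N) (NU : (N <= U)%N).
Hypothesis LU : forall L, (2 ^ L.-1 <= n.+1)%N ->
  (K * L.+1 <= U)%N /\ (n ^ (K * L.+1) < U)%N.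

Lemma N_gt0 : (0 < n)%N -> (0 < N)%N.
Proof. by move=> n0; rewrite !muln_gt0 n0. Qed.

Lemma program_spec (g : R) :
  (forall L, (n <= 2 ^ L)%N -> (K * L.+1 <= U)%N -> (n ^ (K * L.+1) < U)%N ->
   exists2 q, (q <= n ^ (K * L.+1))%N &
   forall s, ready N (K * L.+1) (n ^ (K * L.+1)) s -> nmem s 43 0 = q ->
     recorded J s \/ rmem s rbest 0 < 0 ->
     triple J U attempt s (fun s2 => recorded J s2 /\ rmem s rbest 0 <= rmem s2 rbest 0)
       (fun s2 => rmem s2 rbest 0) g) ->
  triple J U (program K) (memory0 R) (fun s => feasible J (vertex_set J s 0))
    (fun s => obj (vertex_set J s 0)) g.
Proof.
move=> Hq.
apply: triple_seqp (@init_spec R J U K nU KU (fun L HL => (LU HL).1)) _.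
move=> s1 _ [L [nL L0 rd b1]].
have [rU BU] : (K * L.+1 <= U)%N /\ (n ^ (K * L.+1) < U)%N.
  by apply: LU; case: L0 => [->|/ltnW/leqW] //.
have [q qB Ha] := Hq L nL rU BU.
have ts := search_spec nU NU N_gt0 rU BU rd _ qB Ha.
apply: (triple_conseq (a := 0) (ts _)); last by rewrite addr0.
  by rewrite b1 oppr_lt0 ltr01.
move=> s2 [O [rO fO bO]].
by rewrite (vertex_set_reps rO) addr0 bO.
Qed.

(** Every round leaves a feasible set on record, so a bound common to all feasible sets needs no
    good guess. This settles large [gamma] and [k = 0]. *)
Lemma attempt_trivial (g : R) q L : (K * L.+1 <= U)%N -> (n ^ (K * L.+1) < U)%N ->
  (forall T, feasible J T -> g <= obj T) ->
  forall s, ready N (K * L.+1) (n ^ (K * L.+1)) s -> nmem s 43 0 = q ->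
     recorded J s \/ rmem s rbest 0 < 0 ->
     triple J U attempt s (fun s2 => recorded J s2 /\ rmem s rbest 0 <= rmem s2 rbest 0)
       (fun s2 => rmem s2 rbest 0) g.
Proof.
move=> rU BU Hg s rd _ Hb; apply: triple_pure (attempt_pure nU NU N_gt0 rU BU rd Hb) _.
by move=> s' [[O [_ fO ->]] _]; apply: Hg.
Qed.

Lemma triple_output (P : cmd) (g : R) :
  triple J U P (memory0 R) (fun s => feasible J (vertex_set J s 0))
    (fun s => obj (vertex_set J s 0)) g ->
  [/\ halts_within J P (tcost U P), output_always J P (tcost U P) (feasible J)
    & g <= output_expect J P (tcost U P) (fun T => reward J T + den (weight J) T)].
Proof.
move=> tr; have := tr 0%N; rewrite add0n => rn.
have Ql y : leaf [::] (tcost U P) (fun s => feasible J (vertex_set J s 0)) y ->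
    halted y /\ (clock y <= tcost U P)%N by case=> ty cy _; rewrite /halted ty.
split.
- exact: always_imp (run_always rn Ql (leqnn _)).
- by apply: always_imp (run_always rn Ql (leqnn _)) => y [].
exact: (run_expect rn Ql (leqnn _)).
Qed.

End Run.

Section RunningTime.
Variable R : realType.

Lemma ln_ge_half (n : nat) : (2 <= n)%N -> 2^-1 <= ln n%:R :> R.
Proof.
move=> n2; have n0 : 0 < n%:R :> R by rewrite ltr0n ltnW.
rewrite -ler_expR lnK ?posrE //.
have := expR_ge1Dx (- 2^-1 : R); rewrite expRN => H.
have e0 := expR_gt0 (2^-1 : R).
have : expR (2^-1 : R) <= 2.
  have := ler_wpM2r (ltW e0) H; rewrite mulVf ?gt_eqF //; lra.
by move/le_trans; apply; rewrite ler_nat.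
Qed.

(** [E x] is the power [n ^ x]. As the logarithm of [n] is at least 1/2, any [x >= 0] is at most
    [n ^ (2 * x)], which absorbs constants; also [n + 2 <= n ^ 2]. The exponent 4 is the depth of
    loop nesting. *)
Lemma time_bound (n K C0 : nat) (A M : R) : (2 <= n)%N -> 1 <= M -> 0 <= A ->
  K%:R * (trunc_log 2 n.+1).+2%:R <= A * M -> (2 * K + 4)%:R <= A * M ->
  (C0 * (K.+2 * n.+2 ^ (K * (trunc_log 2 n.+1).+2 + 3)).+1 ^ 4)%:R <=
  n%:R `^ ((2 * C0%:R + 16 * A + 24) * M).
Proof.
move=> n2 M1 A0 h1 h2; have l2 := ln_ge_half n2; set l := ln _ in l2.
have n0 : 0 < n%:R :> R by rewrite ltr0n ltnW.
rewrite /powR gt_eqF // -/l.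
pose E x := expR (x * l).
have ED x y : E x * E y = E (x + y) by rewrite /E mulrDl expRD.
have E0 x : 0 <= E x by apply: expR_ge0.
have leE x : 0 <= x -> x <= E (2 * x).
  move=> x0; apply: (@le_trans _ _ (expR x)); last by rewrite ler_expR; nra.
  by have := expR_ge1Dx x; lra.
have EX x m : E x ^+ m = E (m%:R * x) by rewrite /E -expRM_natl mulrA.
have monoE x y : x <= y -> E x <= E y by move=> xy; rewrite ler_expR ler_wpM2r //; lra.
have n2E : n.+2%:R <= E 2.
  have -> : E 2 = n%:R ^+ 2 by rewrite -[n%:R]lnK ?posrE // -/l -expRM_natl.
  rewrite -natrX ler_nat; move: n2; clear; nia.
set e := (K * _ + 3)%N.
have eA : e%:R <= A * M + 3 by rewrite natrD natrM lerD2r.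
have pw : n.+2%:R ^+ e <= E (2 * (A * M + 3)).
  apply: (@le_trans _ _ (E 2 ^+ e)); first by rewrite lerXn2r ?nnegrE.
  by rewrite EX; apply: monoE; rewrite mulrC ler_pM2l.
have step1 : (K.+2 * n.+2 ^ e).+1%:R <= E (4 * A * M + 6).
  apply: (@le_trans _ _ ((2 * K + 4)%:R * n.+2%:R ^+ e)).
    rewrite -natrX -natrM ler_nat.
    have : (0 < n.+2 ^ e)%N by rewrite expn_gt0.
    by clear; nia.
  have AM : 0 <= A * M by rewrite mulr_ge0 //; lra.
  have : (2 * K + 4)%:R <= E (2 * (A * M)) by apply: le_trans h2 (leE _ AM).
  move=> h3; apply: (@le_trans _ _ (E (2 * (A * M)) * E (2 * (A * M + 3)))).
    by apply: ler_pM => //; apply: exprn_ge0.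
  by rewrite ED; apply: monoE; lra.
rewrite natrM natrX; apply: (@le_trans _ _ (E (2 * C0%:R) * E (4 * A * M + 6) ^+ 4)).
  apply: ler_pM; [by []|exact: exprn_ge0|exact: leE|].
  by rewrite lerXn2r ?nnegrE.
rewrite EX ED; apply: monoE.
have : 0 <= C0%:R * (M - 1) by rewrite mulr_ge0 //; lra.
lra.
Qed.

Lemma trunc_log_bound (n : nat) : (2 <= n)%N ->
  (trunc_log 2 n.+1).+2%:R <= 8 * ln n%:R :> R.
Proof.
move=> n2; have l2 := ln_ge_half n2.
have n0 : 0 < n%:R :> R by rewrite ltr0n ltnW.
set t := trunc_log 2 n.+1.
have : (2 ^ t <= n ^ 2)%N.
  by apply: leq_trans (trunc_logP _ _) _ => //; move: n2; clear; nia.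
rewrite -(ler_nat R) !natrX => le_t.
have : ln (2%:R ^+ t : R) <= ln (n%:R ^+ 2) by rewrite ler_ln // posrE exprn_gt0.
rewrite !lnXn //.
have := ler_wpM2l (ler0n R t) (@ln_ge_half 2 isT).
rewrite -[ln 2%:R *+ t]mulr_natl -[ln n%:R *+ 2]mulr_natl.
have -> : t.+2%:R = t%:R + 2 :> R by rewrite -natrD addn2.
lra.
Qed.

End RunningTime.

Theorem theorem18 (R : realType) :
  exists C : R, 0 < C /\
  forall gamma : R, 0 < gamma ->
  exists P : cmd,
  forall J : instance R,
  exists t : nat,
  [/\ (2 <= nvert J)%N ->
        t%:R <= (nvert J)%:R `^ (C * Num.max 1 (ln (nvert J)%:R / gamma ^+ 2)),
      halts_within J P t,
      output_always J P t (fun T => feasible J T)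
    & forall Topt : {set 'I_(nvert J)}, feasible J Topt ->
        (1 - (expR 1)^-1 - gamma) * reward J Topt + den (weight J) Topt - gamma
        <= output_expect J P t (fun T => reward J T + den (weight J) T)].
Proof.
(* [K <= 8 * 241 ^ 2 / gamma ^ 2], and the logarithmic factor is at most 8 times the logarithm of
   [n]: hence 64. The 4 serves the summand in [2 * K + 4]. *)
pose C0 := tcost 0 (program 0); pose A : R := 64 * 241 ^+ 2 + 4.
exists (2 * C0%:R + 16 * A + 24); split.
  by rewrite /A; have : 0 <= C0%:R :> R by []; lra.
move=> gamma g0.
(* 240 is 24 times 10: the error [(3 * H + 15) / s] becomes [(3 * h O + 24) / s] by [H <= h O + 3],
   and has to be at most [gamma / 10 * (h O + 1)]. For [gamma >= 1] any nonnegative value is good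
   enough. *)
pose s := if gamma < 1 then (Num.truncn (240 / gamma)).+1 else 0%N.
pose K := (8 * s ^ 2)%N.
exists (program K) => J; set n := nvert J.
pose Lm := (trunc_log 2 n.+1).+1.
pose U := (K.+2 * n.+2 ^ (K * Lm.+1 + 3))%N.
have pw1 : (1 <= n.+2 ^ (K * Lm.+1))%N by rewrite expn_gt0.
have UE : U = (K.+2 * (n.+2 ^ (K * Lm.+1) * n.+2 ^ 3))%N by rewrite /U expnD.
have nU : (n <= U)%N by rewrite UE; move: pw1; clear; nia.
have KU : (K < U)%N by rewrite UE; move: pw1; clear; nia.
have NU : (K.+1 * (n * n) <= U)%N.
  rewrite UE; apply: leq_mul => //; apply: (@leq_trans (n.+2 ^ 3)); first by clear; nia.
  by rewrite leq_pmull.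
have LU L : (2 ^ L.-1 <= n.+1)%N -> (K * L.+1 <= U)%N /\ (n ^ (K * L.+1) < U)%N.
  move=> hL; have LLm : (L <= Lm)%N.
    have : (L.-1 <= trunc_log 2 n.+1)%N by apply: trunc_log_max.
    by rewrite /Lm; clear; lia.
  have KL : (K * L.+1 <= K * Lm.+1)%N by rewrite leq_mul2l ltnS LLm orbT.
  have lt_pw : (n.+2 ^ (K * L.+1) <= n.+2 ^ (K * Lm.+1))%N by rewrite leq_pexp2l.
  have lt_e : (K * L.+1 < n.+2 ^ (K * L.+1))%N by apply: ltn_expl.
  have le_n e : (n ^ e <= n.+2 ^ e)%N by elim: e => // e IH; rewrite !expnS leq_mul // leqW.
  have := le_n (K * L.+1)%N; rewrite UE; move: KL lt_pw lt_e.
  have : (1 <= n.+2 ^ 3)%N by rewrite expn_gt0.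
  set p := (n.+2 ^ (K * Lm.+1))%N; set p' := (n.+2 ^ (K * L.+1))%N; set q := (n.+2 ^ 3)%N.
  by clear; nia.
exists (tcost U (program K)).
have sK : gamma < 1 -> s%:R <= 241 / gamma /\ 240 / gamma <= s%:R :> R.
  move=> g1; rewrite /s g1; have x0 : 0 <= 240 / gamma by rewrite divr_ge0 // ltW.
  have /andP[t1 /ltW t2] := truncn_itv x0; split=> //.
  rewrite -natr1 (_ : 241 / gamma = 240 / gamma + gamma^-1); last by ring.
  by apply: lerD => //; rewrite invf_ge1 // ltW.
have trivial_run : triple J U (program K) (memory0 R)
    (fun s => feasible J (vertex_set J s 0)) (fun s => obj (vertex_set J s 0)) 0.
  apply: program_spec => // L nL rU BU; exists 0%N => //.
  by apply: attempt_trivial => // T _; apply: obj_ge0.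
have [halt out exp0] := triple_output trivial_run.
have den1 T : feasible J T -> den (weight J) T <= 1.
  by case/andP=> /eqP kT _; rewrite (den_pairs _ kT) -kT pairs_le.
split=> //.
- move=> n2; have l2 := ln_ge_half R n2; set l := ln _ in l2 *; set M := Num.max _ _.
  have M1 : 1 <= M by rewrite le_max lexx.
  have lM : l / gamma ^+ 2 <= M by rewrite le_max lexx orbT.
  have g20 : 0 < gamma ^- 2 by rewrite invr_gt0 exprn_gt0.
  have Kb : K%:R <= 8 * 241 ^+ 2 * gamma ^- 2.
    case: (ltP gamma 1) => g1; last first.
      rewrite /K /s ltNge g1 /= muln0 mulr_ge0 ?mulr_ge0 ?sqr_ge0 //; exact: ltW.
    have [s1 _] := sK g1.
    rewrite natrM natrX -mulrA ler_pM2l // -exprVn -exprMn lerXn2r ?nnegrE //.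
    by rewrite divr_ge0 // ltW.
  have tl := trunc_log_bound R n2; rewrite -/l in tl.
  have gM : gamma ^- 2 <= 2 * M.
    by have := ler_wpM2r (ltW g20) l2; rewrite -/(l / gamma ^+ 2); lra.
  have h1 : K%:R * (trunc_log 2 n.+1).+2%:R <= A * M.
    apply: (@le_trans _ _ (8 * 241 ^+ 2 * gamma ^- 2 * (8 * l))); first by apply: ler_pM.
    by rewrite /A; move: lM; set x := gamma ^- 2; lra.
  have h2 : (2 * K + 4)%:R <= A * M by rewrite natrD natrM /A; lra.
  have A0 : 0 <= A by rewrite /A; lra.
  apply: le_trans (time_bound C0 n2 M1 A0 h1 h2).
  rewrite ler_nat; apply: leq_trans (tcost_le _ _) _.
  by rewrite tcost_program cdepth_program.
move=> Topt fT.
have e2 : (expR 1)^-1 <= 2^-1 :> R.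
  by rewrite lef_pV2 ?posrE ?expR_gt0 //; have := expR_ge1Dx (1 : R); lra.
have ei0 : 0 <= (expR 1)^-1 :> R by rewrite invr_ge0 expR_ge0.
(* For [gamma >= 1] the left-hand side is at most 0, as densities do not exceed 1. *)
case: (ltP gamma 1) => g1; last first.
  apply: le_trans exp0; have := den1 _ fT.
  have : 0 <= (gamma - 1 + (expR 1)^-1) * reward J Topt.
    by rewrite mulr_ge0 ?reward_ge0 //; lra.
  lra.
have [s1 s2] := sK g1.
have s0 : (0 < s)%N by rewrite /s g1.
have Hd : reward J Topt * gamma >= 0 by rewrite mulr_ge0 ?reward_ge0 // ltW.
case: (posnP (target J)) => k0.
  have tr : triple J U (program K) (memory0 R)
      (fun s => feasible J (vertex_set J s 0)) (fun s => obj (vertex_set J s 0)) (obj Topt).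
    apply: program_spec => // L nL rU BU; exists 0%N => //.
    apply: attempt_trivial => // T /andP[/eqP kT _].
    have /andP[/eqP kO _] := fT; rewrite k0 in kT kO.
    by rewrite (cards0_eq kT) (cards0_eq kO).
  have [_ _ /(le_trans _)] := triple_output tr; apply.
  have : 0 <= (expR 1)^-1 * reward J Topt by rewrite mulr_ge0 ?reward_ge0.
  rewrite /obj; lra.
(* The discount [g'] on the reward in [val] pays for the error at [O]; only afterwards is [O]
   exchanged for [Topt], at no further loss. *)
pose g' := gamma / 10.
pose val T := (1 - (expR 1)^-1 - g') * reward J T + den (weight J) T.
case: (arg_maxP val fT) => O fO Omax.
case: (arg_maxP (reward J) fT) => Th fTh Hmax.
set H := reward J Th in Hmax.
(* Otherwise [Th] would beat [O] in [val]: rewards count there with a factor of at least 1/3, and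
   densities differ by at most 1. *)
have HO : H <= reward J O + 3.
  have : val Th <= val O := Omax Th fTh; rewrite /val -/H.
  have /andP[/eqP kTh _] : feasible J Th := fTh.
  have : 0 <= den (weight J) Th.
    by have := obj_ge0 (J := J) Th; rewrite (den_pairs _ kTh); move=> _;
      apply: mulr_ge0; [exact: kap_ge0|];
      apply: sumr_ge0 => u _; apply: sumr_ge0 => v _; case/andP: (weight_range u v).
  have := den1 O fO; have : 3^-1 <= 1 - (expR 1)^-1 - g' by rewrite /g'; lra.
  set a := 1 - _ - g' => a3 d1 d0 H1.
  have : a * (H - reward J O) <= 1 by lra.
  case: (leP (H - reward J O) 0) => H2; first by lra.
  by have := ler_wpM2r (ltW H2) a3; lra.
have tr : triple J U (program K) (memory0 R)
      (fun s => feasible J (vertex_set J s 0)) (fun s => obj (vertex_set J s 0)) (guarantee s O H).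
  apply: program_spec => // L nL rU BU.
  by apply: attempt_quality => // T; apply: Hmax.
have [_ _ /(le_trans _)] := triple_output tr; apply.
have : val Topt <= val O := Omax Topt fT; rewrite /val /guarantee.
have sR : 0 < s%:R :> R by rewrite ltr0n.
have e3 : (3 * H + 15) / s%:R <= g' * (reward J O + 1).
  rewrite ler_pdivrMr //.
  have : 24 <= g' * s%:R.
    move: s2; rewrite ler_pdivrMr // /g'; lra.
  have r0 : 0 <= reward J O + 1 by rewrite addr_ge0 ?reward_ge0.
  move/(ler_wpM2r r0); have := reward_ge0 (i := J) O; lra.
have g'g : g' * reward J Topt <= gamma * reward J Topt.
  by rewrite ler_wpM2r ?reward_ge0 // /g'; lra.
have : g' <= gamma by rewrite /g'; lra.
lra.
Qed.
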